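(* $\rho(3,6)=\frac{1}{2}\left(1-\frac{1}{r(3,3)}\right)=\frac{5}{12}$; equivalently $RT(n,3,6,o(n))=\frac{5}{12}n^2+o(n^2)$. Moreover, the weak stability property holds for $RT(n,3,6,o(n))$: if $(S_n)$ and $(Z_n)$ are two sequences of graphs such that, for each $n$, both $S_n$ and $Z_n$ have $n$ vertices and are $(K_3,K_6)$-free, $\alpha(S_n)=o(n)$, $\alpha(Z_n)=o(n)$, and $e(S_n)=\frac{5}{12}n^2+o(n^2)$, $e(Z_n)=\frac{5}{12}n^2+o(n^2)$, then $\Delta(S_n,Z_n)=o(n^2)$.
   Context: For integers $p,q\ge 2$, a graph $G$ is $(K_p,K_q)$-free if there is a colouring of the edges of $G$ with two colours (colour 1 and colour 2) containing no $K_p$ all of whose edges have colour 1 and no $K_q$ all of whose edges have colour 2. $\alpha(G)$ is the independence number and $e(G)$ the number of edges. $RT(n,p,q,m)$ is the maximum number of edges in an $n$-vertex $(K_p,K_q)$-free graph $G$ with $\alpha(G)<m$. For $0<\delta<1$, $\rho(p,q,\delta)=\lim_{n\to\infty}RT(n,p,q,\delta n)/n^2$ and $\rho(p,q)=\lim_{\delta\to 0}\rho(p,q,\delta)$ (the Ramsey–Turán density). $r(p,q)$ denotes the classical two-colour Ramsey number (so $r(3,3)=6$). For graphs $S,Z$ on the same number of vertices, $\Delta(S,Z)$ is the minimum number of edges one must delete from and add to $S$ to obtain a graph isomorphic to $Z$. *)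

(* Defs.v *)
From HB Require Import structures.
From mathcomp Require Import all_boot all_order all_fingroup all_algebra.
From mathcomp Require Import reals.
Set Implicit Arguments. Unset Strict Implicit. Unset Printing Implicit Defensive.
Import Order.TTheory GRing.Theory Num.Theory.
Local Open Scope ring_scope.

Definition is_graph (n : nat) (G : {set {set 'I_n}}) : bool :=
  [forall e in G, #|e| == 2]%N.

Definition nedges (n : nat) (G : {set {set 'I_n}}) : nat := #|G|.

Definition has_clique (n : nat) (E : {set {set 'I_n}}) (p : nat) : bool :=
  [exists S : {set 'I_n}, (#|S| == p)%N &&
     [forall e : {set 'I_n}, ((e \subset S) && (#|e| == 2)%N) ==> (e \in E)]].

(* (K_p,K_q)-free: a 2-colouring of the edges (C = colour 1, G minus C = colour 2)
   with no colour-1 K_p and no colour-2 K_q. *)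
Definition KpKq_free (n : nat) (G : {set {set 'I_n}}) (p q : nat) : bool :=
  [exists C : {set {set 'I_n}}, [&& C \subset G, ~~ has_clique C p
                                 & ~~ has_clique (G :\: C) q]].

Definition independent (n : nat) (G : {set {set 'I_n}}) (S : {set 'I_n}) : bool :=
  [forall e in G, ~~ (e \subset S)].

Definition alpha (n : nat) (G : {set {set 'I_n}}) : nat :=
  (\max_(S : {set 'I_n} | independent G S) #|S|)%N.

Definition RT (R : realType) (n p q : nat) (m : R) : nat :=
  (\max_(G : {set {set 'I_n}} | [&& is_graph G, KpKq_free G p q
                                   & ((alpha G)%:R < m)%R]) nedges G)%N.

Definition relabel (n : nat) (s : {perm 'I_n}) (G : {set {set 'I_n}}) :
  {set {set 'I_n}} := [set (s @: e) | e : {set 'I_n} in G].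

(* Delta(S,Z): the minimum number of edges to delete from and add to S to
   obtain a graph isomorphic to Z *)
Definition Delta (n : nat) (S Z : {set {set 'I_n}}) : nat :=
  (\big[minn/(#|S| + #|Z|)]_(s : {perm 'I_n})
      #|(S :\: relabel s Z) :|: (relabel s Z :\: S)|)%N.

Definition littleo_n (R : realType) (a : nat -> R) : Prop :=
  forall eps : R, 0 < eps -> exists N : nat, forall n : nat, (N <= n)%N ->
    `|a n| <= eps * n%:R.
Definition littleo_n2 (R : realType) (a : nat -> R) : Prop :=
  forall eps : R, 0 < eps -> exists N : nat, forall n : nat, (N <= n)%N ->
    `|a n| <= eps * n%:R ^+ 2.

(* Main.v *)
Require Import Defs.
From HB Require Import structures.
From mathcomp Require Import all_boot all_order all_fingroup all_algebra.
From mathcomp Require Import reals.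
From mathcomp Require Import zify ring lra.
Set Implicit Arguments. Unset Strict Implicit. Unset Printing Implicit Defensive.
Import Order.TTheory GRing.Theory Num.Theory.
Local Open Scope ring_scope.

(** Lower bound: join completely six parts, each spanning a triangle-free graph
    of small independence number.  Colour the first five parts as a pentagon,
    with colour 2 inside, and let the sixth part be of colour 1 inside and of
    colour 2 towards the rest: a clique of colour 2 meets at most two of the
    first five parts, in two vertices each, and the sixth in one vertex.

    Upper bound and stability: regularize both colours.  A cluster either
    has colour 1 in all its large subsets, or it has a large core without
    colour 1, in which every large subset spans colour 2.  A pair of
    clusters receives weight 1/2 if only colour 2 is present with density at
    most 1/2, and weight 1 if it carries colour 1, or more of colour 2.
    Zykov symmetrization, applied to the vertices with these weights, partitions them
    into classes represented by pairwise adjacent clusters, and bounds the weight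
    by the quadratic form of the representatives minus the weight inside the
    classes.  Representatives are bounded in number by Ramsey's theorem, and
    their form is at most 83/100, by copositivity certificates, unless they are
    six clusters with all weights 1.  In that case the form is at most 5/6,
    hardly anything lies inside the classes, and the graph is close to the
    balanced complete 6-partite graph. *)

(** * Copositivity and symmetrization *)

(** Below, red and blue are colours 1 and 2, and a heavy pair is one of weight 1. Stability needs a
    fixed gap between 5/6, attained by six clusters with all pairs heavy, and every other
    configuration. The constant 83/100 comes from averaging two Motzkin-Straus bounds: [m] clusters
    whose heavy cliques have at most [p] members give [1 - (1/p + 1/m)/2], and the worst case met,
    [p = 4] and [m = 11], gives 73/88, just below 83/100. The obstacle is a heavy 5-clique when no
    cluster is of the first type: fourteen clusters are not excluded, and the averaged bound, about
    0.864, exceeds 5/6. There the certificate is built by hand, from the clique and from the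
    vertices missing only one heavy pair to it. Symmetrization acts on vertices because the clusters
    have unequal sizes. *)

Definition copos (R : realFieldType) (I : finType) (M : I -> I -> R) (S : {set I}) :=
  forall y : I -> R, (forall i, 0 <= y i) -> (forall i, i \notin S -> y i = 0) ->
    0 <= \sum_i \sum_j M i j * y i * y j.

(* Moving [y] along [- t *: c] decreases the form and leaves the orthant at a
   point supported on a proper subset. *)
Lemma copos_certificate (R : realFieldType) (I : finType) (M : I -> I -> R)
    (S : {set I}) (c : I -> R) :
  (forall i j, M i j = M j i) ->
  (forall i, 0 <= c i) -> (exists2 i, i \in S & 0 < c i) ->
  (forall j, j \in S -> 0 <= \sum_i c i * M i j) ->
  (forall S' : {set I}, S' \proper S -> copos M S') ->
  (forall i, i \notin S -> c i = 0) -> copos M S.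
Proof.
move=> Msym c0 [i0 i0S ci0] cM IH cS y y0 yS.
case: (@Order.TotalTheory.arg_minP _ _ _ i0 (fun i => 0 < c i) (fun i => y i / c i)) => // k ck kmin.
set t := y k / c k.
have t0 : 0 <= t by rewrite divr_ge0.
pose z i := y i - t * c i.
have z0 i : 0 <= z i.
  rewrite /z subr_ge0; have [ci|] := boolP (0 < c i).
    by rewrite -ler_pdivlMr // kmin.
  by rewrite -leNgt => ci; have /eqP -> : c i == 0 by [rewrite eq_le ci c0]; rewrite mulr0.
have kS : k \in S by apply: contraTT ck => /cS ->; rewrite ltxx.
have zS i : i \notin S :\ k -> z i = 0.
  rewrite in_setD1 negb_and negbK => /orP [/eqP ->|iS]; last by rewrite /z yS // cS // mulr0 subrr.
  by rewrite /z /t divfK ?subrr // gt_eqF.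
have zpos : 0 <= \sum_i \sum_j M i j * z i * z j.
  by apply: (IH (S :\ k)) => //; rewrite properD1.
apply: le_trans zpos _; rewrite -subr_ge0.
have sym : \sum_i \sum_j M i j * y i * z j = \sum_i \sum_j M i j * z i * y j.
  rewrite exchange_big; apply: eq_bigr => i _; apply: eq_bigr => j _.
  by rewrite Msym; ring.
(* By symmetry the two forms differ by the bilinear form at [y - z = t c] and [y + z], and the
   column sums of [c] on [S] are nonnegative. *)
have -> : \sum_i \sum_j M i j * y i * y j - \sum_i \sum_j M i j * z i * z j
  = \sum_i \sum_j M i j * (y i - z i) * (y j + z j).
  have -> : \sum_i \sum_j M i j * (y i - z i) * (y j + z j) =
    (\sum_i \sum_j M i j * y i * y j + \sum_i \sum_j M i j * y i * z j)
     - (\sum_i \sum_j M i j * z i * y j + \sum_i \sum_j M i j * z i * z j).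
    rewrite -!big_split /= -sumrB; apply: eq_bigr => i _.
    rewrite -!big_split /= -sumrB; apply: eq_bigr => j _; ring.
  rewrite sym; ring.
rewrite exchange_big; apply: sumr_ge0 => j _.
have -> : \sum_i M i j * (y i - z i) * (y j + z j) = t * (y j + z j) * \sum_i c i * M i j.
  by rewrite mulr_sumr; apply: eq_bigr => i _; rewrite /z; ring.
have [jS|jS] := boolP (j \in S).
  by apply: mulr_ge0; [apply: mulr_ge0 => //; apply: addr_ge0|exact: cM].
by rewrite yS // zS ?in_setD1 ?(negPf jS) ?andbF // addr0 mulr0 mul0r.
Qed.

Lemma copos0 (R : realFieldType) (I : finType) (M : I -> I -> R) : copos M set0.
Proof.
move=> y _ yS; rewrite big1 // => i _; rewrite big1 // => j _.
by rewrite (yS i) ?in_set0 // mulr0 mul0r.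
Qed.

Definition clique (I : finType) (h : rel I) (A : {set I}) : bool :=
  [forall i in A, forall j in A, (i != j) ==> h i j].

Lemma cliqueP (I : finType) (h : rel I) (A : {set I}) :
  reflect (forall i j, i \in A -> j \in A -> i != j -> h i j) (clique h A).
Proof.
apply: (iffP forallP) => [H i j iA jA ij|H i].
  by have /implyP/(_ iA)/forallP/(_ j)/implyP/(_ jA)/implyP/(_ ij) := H i.
by apply/implyP => iA; apply/forallP => j; apply/implyP => jA; apply/implyP => ij; apply: H.
Qed.

Lemma cliqueS (I : finType) (h : rel I) (A B : {set I}) :
  B \subset A -> clique h A -> clique h B.
Proof.
move=> /subsetP sub /cliqueP hA; apply/cliqueP => i j iB jB.
by apply: hA; apply: sub.
Qed.

Lemma clique0 (I : finType) (h : rel I) : clique h set0.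
Proof. by apply/cliqueP => i j; rewrite in_set0. Qed.

(** The certificate is the indicator of a maximal clique [P] of [S]: each [j] in [S] has a
    non-neighbour in [P] (itself if it lies there), so its column sum is at least
    [#|P| (1 - 1/p) - (#|P| - 1)], that is [1 - #|P|/p]. *)
Lemma motzkin_straus (R : realFieldType) (I : finType) (h : rel I) (p : nat) (S : {set I}) :
  symmetric h -> irreflexive h -> (0 < p)%N ->
  (forall P : {set I}, P \subset S -> clique h P -> (#|P| <= p)%N) ->
  copos (fun i j => 1 - p%:R^-1 - (h i j)%:R : R) S.
Proof.
move=> hsym hirr p0.
have [m] := ubnP #|S|; elim: m S => // m IH S Sm hp.
have [->|[i0 i0S]] := set_0Vmem S; first exact: copos0.
pose ok (P : {set I}) := (P \subset S) && clique h P.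
have ok0 : ok set0 by rewrite /ok sub0set clique0.
have [P /maxsetP [/andP [PS Pc] Pmax] _] := maxset_exists ok0.
have [j0 j0P] : exists j, j \in P.
  apply/set0Pn; apply/eqP => P0.
  have /(Pmax) : ok [set i0].
    rewrite /ok sub1set i0S; apply/cliqueP => i j; rewrite !inE => /eqP -> /eqP ->.
    by rewrite eqxx.
  rewrite P0 sub0set => /(_ isT) /setP /(_ i0).
  by rewrite !inE eqxx.
apply: (@copos_certificate _ _ _ _ (fun i => (i \in P)%:R)).
- by move=> i j; rewrite hsym.
- by move=> i; case: (_ \in _).
- by exists j0; rewrite ?j0P ?ltr01 ?(subsetP PS).
- move=> j jS.
  have -> : \sum_i (i \in P)%:R * (1 - p%:R^-1 - (h i j)%:R) =
    #|P|%:R * (1 - p%:R^-1) - #|[set i in P | h i j]|%:R :> R.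
    have cardE (A : {set I}) : #|A|%:R = \sum_i (i \in A)%:R :> R.
      by rewrite -sum1_card natr_sum big_mkcond; apply: eq_bigr => i _; case: (_ \in _).
    rewrite !cardE mulr_suml -sumrB; apply: eq_bigr => i _.
    by rewrite inE; case: (i \in P); case: (h i j); rewrite /=; ring.
  have lt1 : (#|[set i in P | h i j]| < #|P|)%N.
    apply: proper_card; apply/properP; split; first by apply/subsetP => i; rewrite inE => /andP [].
    have [jP|jP] := boolP (j \in P).
      by exists j => //; rewrite inE hirr andbF.
    apply/exists_inP; apply: contraR jP; rewrite negb_exists => /forallP Hj.
    have okj : ok (j |: P).
      rewrite /ok subUset sub1set jS PS; apply/cliqueP => a b; rewrite !inE.
      move=> /orP [/eqP ->|aP] /orP [/eqP ->|bP]; rewrite ?eqxx //.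
      + by move: (Hj b); rewrite inE bP /= negbK hsym.
      + by move: (Hj a); rewrite inE aP /= negbK.
      + by move: Pc => /cliqueP; apply.
    by rewrite -(Pmax _ okj (subsetU1 _ _)) setU11.
  have pP : (#|P| <= p)%N by apply: hp.
  have p0' : 0 < p%:R :> R by rewrite ltr0n.
  have le1 : #|P|%:R / p%:R <= 1 :> R by rewrite ler_pdivrMr // mul1r ler_nat.
  have : #|[set i in P | h i j]|%:R + 1 <= #|P|%:R :> R by rewrite natr1 ler_nat.
  by rewrite mulrBr mulr1 subr_ge0; lra.
- move=> S' S'S; apply: IH; first by apply: leq_trans (proper_card S'S) _.
  by move=> Q QS; apply: hp; apply: subset_trans QS (proper_sub S'S).
- by move=> i iS; rewrite (contraNF (subsetP PS i)).
Qed.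

(** Classes are split off one by one: among the vertices left, one of maximal degree is chosen, and
    all those left at weight 0 from it are replaced by it. The weight inside the classes, kept on
    the left, later yields stability; the clause on equal rows makes [rep] constant on clusters. *)
Lemma symmetrization (R : realFieldType) (T : finType) (w : T -> T -> R) :
  (forall x y, w x y = w y x) -> (forall x y, 0 <= w x y) -> (forall x, w x x = 0) ->
  exists rep : T -> T,
    [/\ forall x y, rep x != rep y -> 0 < w (rep x) (rep y),
     forall x y, w x =1 w y -> rep x = rep y &
    \sum_x \sum_y w x y + \sum_x \sum_(y | rep x == rep y) w x y
      <= \sum_x \sum_y w (rep x) (rep y)].
Proof.
move=> wsym w0 wxx.
(* [C] is the part already divided into classes; its representatives have positive weight to
   everything outside, where [rep] is still the identity. *)
pose inv (C : {set T}) (rep : T -> T) :=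
  [/\ (forall x, x \notin C -> rep x = x),
      (forall x, x \in C -> rep x \in C),
      (forall x y, x \in C -> y \notin C -> 0 < w (rep x) y),
      (forall x y, x \in C -> y \in C -> rep x != rep y -> 0 < w (rep x) (rep y)) &
      (forall x y, w x =1 w y -> x \in C -> y \in C /\ rep x = rep y) /\
    \sum_x \sum_y w x y + \sum_(x in C) \sum_(y in C | rep x == rep y) w x y
      <= \sum_x \sum_y w (rep x) (rep y)].
suff H m : forall C rep, (#|~: C| <= m)%N -> inv C rep -> exists rep', inv setT rep'.
  have inv0 : inv set0 id.
    split=> [x _|x|x y|x y|]; rewrite ?in_set0 //; split=> [x y _|]; rewrite ?in_set0 //.
    by rewrite [X in _ + X <= _]big_set0 addr0.
  have [rep [_ _ _ H1 [Htw H2]]] := H _ _ _ (leqnn _) inv0.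
  exists rep; split=> [x y|x y xy|]; first by apply: H1; rewrite inE.
    by have [] := Htw x y xy; rewrite inE.
  apply: le_trans H2; rewrite lerD2l.
  rewrite le_eqVlt; apply/orP; left; apply/eqP; rewrite [RHS]big_mkcond /=; apply: eq_bigr => x _.
  by rewrite inE /=; apply: eq_bigl => y; rewrite inE.
elim: m => [|m IH] C rep.
  rewrite leqn0 cards_eq0 => /eqP /(congr1 (@setC _)); rewrite setCK setC0 => -> H.
  by exists rep.
move=> Cm [rC rCC rU rr [rtw rI]].
have [C0|[u0 u0U]] := set_0Vmem (~: C).
  by exists rep; rewrite -(setCK C) C0 setC0 in rC rCC rU rr rtw rI *; split.
pose D j := \sum_i w j (rep i).
case: (@Order.TotalTheory.arg_maxP _ _ _ u0 (fun i => i \in ~: C) D) => // j jU jmax.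
pose A := [set i in ~: C | w j i == 0].
pose rep' i := if i \in A then j else rep i.
have jC : j \notin C by rewrite inE in jU.
have jA : j \in A by rewrite !inE wxx eqxx jC.
have AC i : i \in A -> i \notin C by rewrite !inE => /andP [].
have CA i : i \in C -> (i \in A) = false by move=> iC; apply: contraTF iC => /AC.
apply: (IH (C :|: A) rep').
  rewrite -ltnS; apply: leq_trans Cm; apply: proper_card; apply/properP.
  split; first by rewrite setCS subsetUl.
  by exists j; rewrite // !inE wxx eqxx jC orbT.
have wj y : y \notin C -> y \notin A -> 0 < w j y.
  by move=> yC; rewrite !inE yC /= => wj0; rewrite lt_def wj0 w0.
split.
- by move=> x; rewrite in_setU negb_or /rep' => /andP [xC /negPf ->]; apply: rC.
- move=> x; rewrite !in_setU /rep'; have [_ _|_] := ifP; first by rewrite jA orbT.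
  by rewrite orbF => xC; rewrite rCC.
- move=> x y; rewrite !in_setU negb_or /rep' => xCA /andP [yC yA].
  have [_|xA] := ifP; first exact: wj.
  by apply: rU => //; move: xCA; rewrite xA orbF.
- move=> x y; rewrite !in_setU /rep' => xC yC.
  have [xA|xA] := ifP; have [yA|yA] := ifP; rewrite ?eqxx //;
    move: xC yC; rewrite xA yA ?orbF => xC yC.
  + by rewrite wsym => _; apply: rU => //.
  + by move=> _; apply: rU.
  + exact: rr.
split.
  move=> x y xy; rewrite !in_setU /rep'.
  have [xC|xC] /= := boolP (x \in C).
    by have [yC <-] := rtw x y xy xC; rewrite yC (CA x xC) (CA y yC).
  move=> xA; have yA : y \in A.
    move: xA; rewrite !inE xC /= [w j x]wsym [w j y]wsym (xy j) => ->; rewrite andbT.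
    by apply: contra xC => yC; have [] := rtw y x (fun z => esym (xy z)) yC.
  by rewrite xA yA orbT.
have repA i : i \in A -> rep i = i by move=> /AC /rC.
have repNA i : i \notin A -> rep i \notin A.
  move=> iA; have [iC|iC] := boolP (i \in C); last by rewrite rC.
  by rewrite (CA _ (rCC _ iC)).
pose a := \sum_(x in A) \sum_(y in A) w x y.
(* Collapsing [A] onto [j] replaces the degrees [D x] by the maximal [D j], and
   the weight [a] inside [A], counted twice in the degrees, is gained. *)
have split2 (F : T -> T -> R) : (forall x y, F x y = F y x) -> \sum_x \sum_y F x y =
   \sum_(x in A) \sum_(y in A) F x y + \sum_(x in A) \sum_(y | y \notin A) F x y *+ 2
    + \sum_(x | x \notin A) \sum_(y | y \notin A) F x y.
  move=> Fs; rewrite (bigID (mem A)) /=.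
  have E (P : pred T) : \sum_(x | P x) \sum_y F x y =
    \sum_(x | P x) \sum_(y in A) F x y + \sum_(x | P x) \sum_(y | y \notin A) F x y.
    by rewrite -big_split; apply: eq_bigr => x _; rewrite (bigID (mem A)).
  rewrite !E [X in _ + (X + _)]exchange_big /=.
  have -> : \sum_(j0 in A) \sum_(i | i \notin A) F i j0 = \sum_(x in A) \sum_(y | y \notin A) F x y.
    by apply: eq_bigr => x _; apply: eq_bigr => y _; rewrite Fs.
  have -> : \sum_(x in A) \sum_(y | y \notin A) F x y *+ 2 = (\sum_(x in A) \sum_(y | y \notin A) F x y) *+ 2.
    by rewrite -sumrMnl; apply: eq_bigr => x _; rewrite -sumrMnl.
  ring.
have oldE : \sum_x \sum_y w (rep x) (rep y) =
  (\sum_(x in A) D x) *+ 2 - a + \sum_(x | x \notin A) \sum_(y | y \notin A) w (rep x) (rep y).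
  rewrite split2; last by move=> x y; rewrite wsym.
  congr (_ + _).
  have -> : \sum_(x in A) \sum_(y in A) w (rep x) (rep y) = a.
    by apply: eq_bigr => x xA; apply: eq_bigr => y yA; rewrite !repA.
  have -> : \sum_(x in A) D x = a + \sum_(x in A) \sum_(y | y \notin A) w (rep x) (rep y).
    rewrite /a -big_split; apply: eq_bigr => x xA; rewrite /D (bigID (mem A)) /=.
    congr (_ + _); apply: eq_bigr => y yA; first by rewrite repA.
    by rewrite (repA x).
  have -> : \sum_(x in A) \sum_(y | y \notin A) w (rep x) (rep y) *+ 2 = (\sum_(x in A) \sum_(y | y \notin A) w (rep x) (rep y)) *+ 2.
    by rewrite -sumrMnl; apply: eq_bigr => x _; rewrite -sumrMnl.
  ring.
have newE : \sum_x \sum_y w (rep' x) (rep' y) =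
  (\sum_(x in A) D j) *+ 2 + \sum_(x | x \notin A) \sum_(y | y \notin A) w (rep x) (rep y).
  rewrite split2; last by move=> x y; rewrite wsym.
  congr (_ + _).
    rewrite [X in X + _]big1 ?add0r; last first.
      by move=> x xA; rewrite big1 // => y yA; rewrite /rep' xA yA.
    rewrite -sumrMnl; apply: eq_bigr => x xA; rewrite sumrMnl; congr (_ *+ _).
    rewrite /D [RHS](bigID (mem A)) /= [X in X + _]big1 ?add0r.
      by apply: eq_bigr => y yA; rewrite /rep' xA (negPf yA).
    by move=> y yA; rewrite repA //; move: yA; rewrite inE => /andP [_ /eqP].
  by apply: eq_bigr => x xA; apply: eq_bigr => y yA; rewrite /rep' (negPf xA) (negPf yA).
have DA : \sum_(x in A) D x <= \sum_(x in A) D j.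
  by apply: ler_sum => x xA; apply: jmax; move: xA; rewrite inE => /andP [].
have -> : \sum_(x in C :|: A) \sum_(y in C :|: A | rep' x == rep' y) w x y =
  \sum_(x in C) \sum_(y in C | rep x == rep y) w x y + a.
  rewrite (eq_bigl (fun x => (x \in C) || (x \in A))); last by move=> x; rewrite in_setU.
  rewrite bigU /=; last by apply/pred0P => x /=; case: (boolP (x \in C)) => // /CA.
  congr (_ + _); apply: eq_bigr => x xX; apply: eq_bigl => y; rewrite in_setU /rep'.
    rewrite (CA _ xX); have [yC|yC] := boolP (y \in C); first by rewrite (CA _ yC).
    have [yA|] := boolP (y \in A) => //=; apply/negbTE.
    by apply: contra jC => /eqP <-; apply: rCC.
  rewrite xX; have [yA|yA] := boolP (y \in A); first by rewrite orbT eqxx.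
  rewrite orbF; have [yC|] := boolP (y \in C) => //=; apply/negbTE.
  by apply: contra jC => /eqP ->; apply: rCC.
rewrite newE addrA; move: rI; rewrite oldE; move: DA; lra.
Qed.

(** * Regular partitions *)

Lemma sqr_sum_le (R : realFieldType) (O : finType) (P : {set O}) (g : O -> R) :
  (\sum_(p in P) g p) ^+ 2 <= #|P|%:R * \sum_(p in P) g p ^+ 2.
Proof.
have H : 0 <= \sum_(p in P) \sum_(q in P) (g p - g q) ^+ 2.
  by apply: sumr_ge0 => p _; apply: sumr_ge0 => q _; apply: sqr_ge0.
have E : \sum_(p in P) \sum_(q in P) (g p - g q) ^+ 2 =
   (#|P|%:R * \sum_(p in P) g p ^+ 2) *+ 2 - (\sum_(p in P) g p) ^+ 2 *+ 2.
  have E1 : #|P|%:R * \sum_(p in P) g p ^+ 2 = \sum_(p in P) \sum_(q in P) g p ^+ 2.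
    rewrite mulr_sumr; apply: eq_bigr => p _.
    by rewrite sumr_const mulr_natl.
  have E2 : (\sum_(p in P) g p) ^+ 2 = \sum_(p in P) \sum_(q in P) g p * g q.
    rewrite expr2 mulr_suml; apply: eq_bigr => p _.
    by rewrite mulr_sumr.
  have E3 : \sum_(p in P) \sum_(q in P) g p ^+ 2 = \sum_(p in P) \sum_(q in P) g q ^+ 2.
    by rewrite exchange_big.
  rewrite mulr2n {2}E1 E3 E1 E2 -!big_split /= -sumrMnl -sumrB.
  apply: eq_bigr => p _; rewrite -!big_split /= -sumrMnl -sumrB.
  by apply: eq_bigr => q _; ring.
by move: H; rewrite E; lra.
Qed.

(** Conditional expectation of [e] given [F = l], for the uniform measure on [O]; it is 0 on an
    empty fibre. *)
Definition cexp (R : realFieldType) (O L : finType) (F : O -> L) (e : O -> R) (l : L) : R :=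
  (\sum_(q | F q == l) e q) / #|[set q | F q == l]|%:R.

(** Checked fibre by fibre, this makes [cexp] the orthogonal projection onto the functions of the
    label. *)
Lemma cexp_sum (R : realFieldType) (O L : finType) (F : O -> L) (e : O -> R) (v : L -> R) :
  \sum_p cexp F e (F p) * v (F p) = \sum_p e p * v (F p).
Proof.
rewrite (partition_big F predT) //= [RHS](partition_big F predT) //=.
apply: eq_bigr => l _.
under eq_bigr => p /eqP -> do [].
rewrite [RHS](eq_bigr (fun p => e p * v l)); last by move=> p /eqP ->.
rewrite sumr_const -mulr_suml -(mulr_natl (cexp _ _ _ * _)) mulrA; congr (_ * _).
rewrite /cexp cardsE; have [/eqP N0|N0] := boolP (#|[pred q | F q == l]| == 0%N).
  rewrite N0 mul0r big1 // => p /eqP Fp.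
  by have := card0_eq N0 p; rewrite !inE Fp eqxx.
by rewrite mulrC divfK // pnatr_eq0.
Qed.

Definition energy (R : realFieldType) (O L : finType) (F : O -> L) (e : O -> R) : R :=
  \sum_p cexp F e (F p) ^+ 2.

(** Pythagoras: the coarse expectation is a function of the fine label and the projection of the
    fine expectation, so the cross term equals the coarse energy. *)
Lemma energy_refine (R : realFieldType) (O L L' : finType) (F : O -> L) (F' : O -> L')
    (r : L' -> L) (e : O -> R) :
  (forall p, F p = r (F' p)) ->
  energy F' e - energy F e = \sum_p (cexp F' e (F' p) - cexp F e (F p)) ^+ 2.
Proof.
move=> Fr.
have cross : \sum_p cexp F' e (F' p) * cexp F e (F p) = energy F e.
  under eq_bigr => p _ do rewrite Fr.
  rewrite (cexp_sum F' e (fun l => cexp F e (r l))).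
  under eq_bigr => p _ do rewrite -Fr.
  by rewrite -(cexp_sum F e (fun l => cexp F e l)).
have -> : energy F' e - energy F e = energy F' e - energy F e *+ 2 + energy F e by ring.
rewrite -{1}cross /energy -sumrMnl -sumrB -big_split /=; apply: eq_bigr => p _; ring.
Qed.

Lemma cexp_itv (R : realFieldType) (O L : finType) (F : O -> L) (e : O -> R) l :
  (forall p, 0 <= e p <= 1) -> 0 <= cexp F e l <= 1.
Proof.
move=> e01; rewrite /cexp cardsE.
have s0 : 0 <= \sum_(q | F q == l) e q by apply: sumr_ge0 => q _; case/andP: (e01 q).
rewrite divr_ge0 //=.
have [/eqP ->|N0] := boolP (#|[pred q | F q == l]| == 0%N); first by rewrite invr0 mulr0.
rewrite ler_pdivrMr ?ltr0n ?lt0n // mul1r -sum1_card natr_sum.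
by apply: ler_sum => q _; case/andP: (e01 q).
Qed.

Lemma energy_le (R : realFieldType) (O L : finType) (F : O -> L) (e : O -> R) :
  (forall p, 0 <= e p <= 1) -> energy F e <= #|O|%:R.
Proof.
move=> e01; rewrite -sum1_card natr_sum; apply: ler_sum => p _.
have /andP [c0 c1] := cexp_itv F (F p) e01.
by rewrite -(expr1n _ 2) lerXn2r // nnegrE.
Qed.

Definition ecount (T : finType) (E : rel T) (X Y : {set T}) : nat :=
  (\sum_(x in X) #|[set y in Y | E x y]|)%N.

Definition density (R : realFieldType) (T : finType) (E : rel T) (X Y : {set T}) : R :=
  (ecount E X Y)%:R / (#|X|%:R * #|Y|%:R).

(** Denominators are cleared, so that an empty [X] or [Y] imposes nothing. *)
Definition regular (R : realFieldType) (T : finType) (E : rel T) (eps : R) (A B : {set T}) : bool :=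
  [forall X : {set T}, forall Y : {set T},
    [&& X \subset A, Y \subset B, eps * #|A|%:R <= #|X|%:R & eps * #|B|%:R <= #|Y|%:R] ==>
    (`|(ecount E X Y)%:R - density R E A B * (#|X|%:R * #|Y|%:R)| <= eps * (#|X|%:R * #|Y|%:R))].

Definition class (T K : finType) (f : T -> K) (i : K) : {set T} := [set x | f x == i].

Definition pairmap (T K : finType) (f : T -> K) (p : T * T) : K * K := (f p.1, f p.2).

Definition ind (R : realFieldType) (T : finType) (E : rel T) (p : T * T) : R := (E p.1 p.2)%:R.

Lemma ecountE (R : realFieldType) (T : finType) (E : rel T) (X Y : {set T}) :
  (ecount E X Y)%:R = \sum_(p | (p.1 \in X) && (p.2 \in Y)) ind R E p.
Proof.
rewrite natr_sum -(pair_big_dep (mem X) (fun _ y => y \in Y) (fun x y => (E x y)%:R)) /=.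
apply: eq_bigr => x _; rewrite -sum1_card natr_sum big_mkcond [RHS]big_mkcond /=.
by apply: eq_bigr => y _; rewrite inE; case: (y \in Y); case: (E x y).
Qed.

Lemma cexp_density (R : realFieldType) (T K : finType) (f : T -> K) (E : rel T) i j :
  cexp (pairmap f) (ind R E) (i, j) = density R E (class f i) (class f j).
Proof.
rewrite /cexp /density ecountE -natrM -cardsX; congr (_ / _%:R).
  by apply: eq_bigl => p; rewrite !inE.
by apply: eq_card => p; rewrite !inE.
Qed.

Lemma sum_pairs_const (R : realFieldType) (T : finType) (X Y : {set T}) (a : R) :
  \sum_(p : T * T | (p.1 \in X) && (p.2 \in Y)) a = a * (#|X|%:R * #|Y|%:R).
Proof.
rewrite sumr_const -natrM mulr_natr -cardsX; congr (_ *+ _).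
by apply: eq_card => p; rewrite !inE.
Qed.

(** Each vertex additionally records, for every pair of classes, its membership in the two witnesses
    of irregularity. On a witness rectangle the mean deviation exceeds [eps], and the rectangle
    fills at least a share [eps ^+ 2] of the pair of classes, hence [eps ^+ 4]. *)
Lemma energy_boost (R : realFieldType) (T K : finType) (f : T -> K) (E : rel T) (eps : R) :
  0 < eps ->
  exists f' : T -> K * {ffun K * K -> bool * bool},
    (forall x, (f' x).1 = f x) /\
    energy (pairmap f) (ind R E) + eps ^+ 4 *
      \sum_(p : T * T) (~~ regular E eps (class f (f p.1)) (class f (f p.2)))%:R
    <= energy (pairmap f') (ind R E).
Proof.
move=> eps0.
pose V := class f.
pose bad (ij : K * K) (XY : {set T} * {set T}) :=
  [&& XY.1 \subset V ij.1, XY.2 \subset V ij.2, eps * #|V ij.1|%:R <= #|XY.1|%:R,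
      eps * #|V ij.2|%:R <= #|XY.2|%:R &
   eps * (#|XY.1|%:R * #|XY.2|%:R) <
     `|(ecount E XY.1 XY.2)%:R - density R E (V ij.1) (V ij.2) * (#|XY.1|%:R * #|XY.2|%:R)|].
pose wit ij := odflt (set0, set0) [pick XY | bad ij XY].
have witP i j : ~~ regular E eps (V i) (V j) -> bad (i, j) (wit (i, j)).
  rewrite /wit; case: pickP => [XY //|nobad] /negP [].
  apply/forallP => X; apply/forallP => Y; apply/implyP => /and4P [XA YB cX cY].
  by have := nobad (X, Y); rewrite /bad /= XA YB cX cY /= => /negbT; rewrite -leNgt.
pose f' x := (f x, [ffun ij : K * K => (x \in (wit ij).1, x \in (wit ij).2)]).
exists f'; split=> //.
rewrite addrC -lerBrDr (@energy_refine _ _ _ _ _ (pairmap f') (fun l => (l.1.1, l.2.1))) //.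
pose D p : R := cexp (pairmap f') (ind R E) (pairmap f' p) - cexp (pairmap f) (ind R E) (pairmap f p).
rewrite -[X in _ <= X]/(\sum_p D p ^+ 2).
rewrite (partition_big (pairmap f) predT) //= [X in _ <= X](partition_big (pairmap f) predT) //=.
rewrite mulr_sumr; apply: ler_sum => -[i j] _.
have predE (p : T * T) : (pairmap f p == (i, j)) = (p.1 \in V i) && (p.2 \in V j).
  by rewrite !inE.
rewrite (eq_bigr (fun=> (~~ regular E eps (V i) (V j))%:R)); last first.
  by move=> p /eqP [-> ->].
rewrite (eq_bigl _ _ predE) sum_pairs_const [X in _ <= X](eq_bigl _ _ predE).
have D0 (P : pred (T * T)) : 0 <= \sum_(p | P p) D p ^+ 2 by apply: sumr_ge0 => p _; apply: sqr_ge0.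
have [|irr] := boolP (regular _ _ _ _); first by rewrite /= mul0r mulr0.
have /and5P [/= XA YB cX cY dev] := witP _ _ irr.
set X := (wit (i, j)).1 in XA cX dev; set Y := (wit (i, j)).2 in YB cY dev.
pose XY : {set T * T} := setX X Y.
(* The witness rectangle is a union of fibres of the new labelling, so its edge count is the sum of
   the new conditional expectations. *)
have sumD : \sum_(p in XY) D p =
   (ecount E X Y)%:R - density R E (V i) (V j) * (#|X|%:R * #|Y|%:R).
  rewrite sumrB; congr (_ - _).
    rewrite ecountE.
    pose v (l : (K * {ffun K * K -> bool * bool}) * (K * {ffun K * K -> bool * bool})) : R :=
      ((l.1.2 (i, j)).1 && (l.2.2 (i, j)).2)%:R.
    have vE p : v (pairmap f' p) = (p \in XY)%:R by rewrite /v /= !ffunE /= inE.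
    have condE (g : T * T -> R) : \sum_(p in XY) g p = \sum_p g p * v (pairmap f' p).
      by rewrite big_mkcond; apply: eq_bigr => p _; rewrite vE; case: ifP; rewrite ?mulr1 ?mulr0.
    rewrite condE cexp_sum -condE.
    by apply: eq_bigl => p; rewrite inE.
  rewrite -sum_pairs_const; apply: eq_big => [p|p]; rewrite !inE // => /andP [pX pY].
  rewrite -cexp_density; congr cexp; apply/eqP; rewrite predE.
  by rewrite (subsetP XA) ?(subsetP YB).
have sub : \sum_(p in XY) D p ^+ 2 <= \sum_(p : T * T | (p.1 \in V i) && (p.2 \in V j)) D p ^+ 2.
  rewrite [X in _ <= X](bigID (mem XY)) /= -[X in X <= _]addr0 lerD //.
  rewrite le_eqVlt; apply/orP; left; apply/eqP; apply: eq_bigl => p; rewrite !inE.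
  have [pX|_] := boolP (p.1 \in X); last by rewrite andbF.
  have [pY|_] := boolP (p.2 \in Y); last by rewrite !andbF.
  by move: (subsetP XA _ pX) (subsetP YB _ pY); rewrite !inE => -> ->.
have CS := sqr_sum_le XY D; rewrite sumD in CS.
have cXY : #|XY|%:R = #|X|%:R * #|Y|%:R :> R by rewrite cardsX natrM.
rewrite cXY in CS; set N := #|X|%:R * #|Y|%:R in dev CS *.
have N0 : 0 <= N by rewrite mulr_ge0.
have devsq : (eps * N) ^+ 2 < ((ecount E X Y)%:R - density R E (V i) (V j) * N) ^+ 2.
  by rewrite -[X in _ < X]real_normK ?num_real // ltrXn2r ?nnegrE ?mulr_ge0 // ltW.
have Npos : 0 < N.
  rewrite lt_def N0 andbT; apply/eqP => N00.
  by move: (lt_le_trans devsq CS); rewrite N00 !mul0r mulr0 expr0n ltxx.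
have Q1 : eps ^+ 2 * N <= \sum_(p in XY) D p ^+ 2.
  have := ltW (lt_le_trans devsq CS).
  have -> : (eps * N) ^+ 2 = N * (eps ^+ 2 * N) by ring.
  by rewrite ler_pM2l.
have Q2 : eps ^+ 2 * (#|V i|%:R * #|V j|%:R) <= N.
  have -> : eps ^+ 2 * (#|V i|%:R * #|V j|%:R) = (eps * #|V i|%:R) * (eps * #|V j|%:R) by ring.
  by apply: ler_pM => //; rewrite mulr_ge0 // ltW.
rewrite /= mul1r; apply: le_trans sub; apply: le_trans Q1.
have -> : eps ^+ 4 = eps ^+ 2 * eps ^+ 2 by ring.
by rewrite -mulrA ler_pM2l // exprn_gt0.
Qed.

Lemma energy_mono (R : realFieldType) (T K K' : finType) (f : T -> K) (f' : T -> K')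
    (r : K' -> K) (E : rel T) :
  (forall x, f x = r (f' x)) ->
  energy (pairmap f) (ind R E) <= energy (pairmap f') (ind R E).
Proof.
move=> fr; rewrite -subr_ge0 (@energy_refine _ _ _ _ _ (pairmap f') (fun l => (r l.1, r l.2))).
  by apply: sumr_ge0 => p _; apply: sqr_ge0.
by move=> p; rewrite /pairmap /= !fr.
Qed.

(** The two colours share one energy, at most [2 #|T|^2]. Refining for an irregular colour gains at
    least [eps ^+ 5 #|T|^2] and loses nothing for the other. Classes may have any size, since
    irregularity is counted in pairs of vertices; [r] remembers the initial partition. *)
Lemma regularity (R : realType) (eps : R) (m : nat) : 0 < eps ->
  exists M : nat, forall (T : finType) (E : bool -> rel T) (f0 : T -> 'I_m),
    exists (K : finType) (f : T -> K) (r : K -> 'I_m),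
    [/\ (#|K| <= M)%N, (forall x, f0 x = r (f x)) &
      forall c, \sum_(p : T * T)
         (~~ regular (E c) eps (class f (f p.1)) (class f (f p.2)))%:R
         <= eps * #|T|%:R ^+ 2].
Proof.
move=> eps0.
have [t Ht] : exists t : nat, 2 <= t%:R * eps ^+ 5.
  exists (Num.bound (2 / eps ^+ 5)).
  rewrite -ler_pdivrMr ?exprn_gt0 //; apply: ltW; apply: archi_boundP.
  by rewrite divr_ge0 // ltW // exprn_gt0.
(* A refinement adds one of four labels for each of the [M * M] pairs of classes. *)
pose step M := (M * 4 ^ (M * M))%N.
exists (iter t step m) => T E f0.
pose Q (K : finType) (f : T -> K) : R :=
  energy (pairmap f) (ind R (E true)) + energy (pairmap f) (ind R (E false)).
have Qle (K : finType) (f : T -> K) : Q K f <= 2 * #|T|%:R ^+ 2.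
  have b c : energy (pairmap f) (ind R (E c)) <= #|T|%:R ^+ 2.
    rewrite -natrX expnS expn1 -card_prod; apply: energy_le => p.
    by rewrite /ind; case: (E _ _ _); rewrite /= ?lexx ?ler01.
  by move: (b true) (b false); rewrite /Q; lra.
suff H s : forall (K : finType) (f : T -> K) (r : K -> 'I_m) M,
    (#|K| <= M)%N -> (forall x, f0 x = r (f x)) ->
    2 * #|T|%:R ^+ 2 <= Q K f + s%:R * eps ^+ 5 * #|T|%:R ^+ 2 ->
    exists (K' : finType) (f' : T -> K') (r' : K' -> 'I_m),
    [/\ (#|K'| <= iter s step M)%N, (forall x, f0 x = r' (f' x)) &
      forall c, \sum_(p : T * T)
         (~~ regular (E c) eps (class f' (f' p.1)) (class f' (f' p.2)))%:R
         <= eps * #|T|%:R ^+ 2].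
  apply: (H t _ f0 id) => //; first by rewrite card_ord.
  have Q0 : 0 <= Q _ f0 by apply: addr_ge0; apply: sumr_ge0 => p _; apply: sqr_ge0.
  have T0 : 0 <= #|T|%:R ^+ 2 :> R by rewrite sqr_ge0.
  have := ler_wpM2r T0 Ht; lra.
elim: s => [|s IH] K f r M KM fr Qf.
  (* With no step left the energy is already maximal, and an irregular colour would raise it
     further. *)
  exists K, f, r; split=> // c; rewrite leNgt; apply/negP => bad.
  have [f' [f'f boost]] := energy_boost f (E c) eps0.
  have mono c' := @energy_mono R _ _ _ f f' (fun k => k.1) (E c') (fun x => esym (f'f x)).
  have pos : 0 < eps ^+ 4 * \sum_(p : T * T) (~~ regular (E c) eps (class f (f p.1)) (class f (f p.2)))%:R.
    rewrite mulr_gt0 ?exprn_gt0 //; apply: le_lt_trans bad.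
    by rewrite mulr_ge0 ?sqr_ge0 // ltW.
  have := Qle _ f'; move: Qf; rewrite mul0r mul0r addr0 => Qf Qf'.
  have QQ := le_trans Qf' Qf.
  by case: c boost pos {bad} => boost pos; move: (mono true) (mono false) QQ;
     rewrite /Q; lra.
have [good|/forallPn [c]] := boolP [forall c, \sum_(p : T * T)
         (~~ regular (E c) eps (class f (f p.1)) (class f (f p.2)))%:R <= eps * #|T|%:R ^+ 2].
  exists K, f, r; split=> //; last by move=> c; move/forallP: good.
  apply: leq_trans KM _.
  have stepge N : (N <= step N)%N by rewrite leq_pmulr // expn_gt0.
  by elim: s.+1 => //= s' IHs; apply: leq_trans IHs (stepge _).
rewrite -ltNge => bad.
have [f' [f'f boost]] := energy_boost f (E c) eps0.
have mono c' := @energy_mono R _ _ _ f f' (fun k => k.1) (E c') (fun x => esym (f'f x)).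
rewrite iterSr; apply: (IH _ f' (fun k => r k.1)).
- rewrite card_prod card_ffun !card_prod card_bool leq_mul //.
  apply: leq_trans (_ : 4 ^ (#|K| * #|K|) <= _)%N; first by [].
  by rewrite leq_exp2l // leq_mul.
- by move=> x; rewrite f'f.
have gain : eps ^+ 5 * #|T|%:R ^+ 2 <= eps ^+ 4 * \sum_(p : T * T) (~~ regular (E c) eps (class f (f p.1)) (class f (f p.2)))%:R.
  have -> : eps ^+ 5 * #|T|%:R ^+ 2 = eps ^+ 4 * (eps * #|T|%:R ^+ 2) by ring.
  by rewrite ler_pM2l ?exprn_gt0 // ltW.
have Qf' : Q _ f + eps ^+ 5 * #|T|%:R ^+ 2 <= Q _ f'.
  by case: c boost gain {bad} => boost gain; move: (mono true) (mono false);
     rewrite /Q; lra.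
move: Qf; rewrite -natr1 !mulrDl ?mul1r; lra.
Qed.

(** * Embedding cliques *)

Lemma mem_tail (T : eqType) (x y : T) (s : seq T) : x \in s -> x \in y :: s.
Proof. by rewrite inE => ->; rewrite orbT. Qed.
Arguments mem_tail {T x y s}.

Definition nb (T : finType) (B : rel T) (v : T) (X : {set T}) : {set T} := [set y in X | B v y].

(** The lower half of regularity, in a form that passes from clusters to their cores. *)
Definition lreg (R : realFieldType) (T : finType) (B : rel T) (eps d : R) (A C : {set T}) : Prop :=
  forall X Y : {set T}, X \subset A -> Y \subset C ->
    eps * #|A|%:R <= #|X|%:R -> eps * #|C|%:R <= #|Y|%:R ->
    d * (#|X|%:R * #|Y|%:R) <= (ecount B X Y)%:R.

(** If there were too many exceptional vertices, they would themselves form with [Y] a large pair of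
    density below [d]. *)
Lemma few_bad (R : realFieldType) (T : finType) (B : rel T) (eps d : R) (A C X Y : {set T}) :
  0 < eps -> (0 < #|A|)%N -> lreg B eps d A C -> X \subset A -> Y \subset C ->
  eps * #|C|%:R <= #|Y|%:R ->
  #|[set v in X | #|nb B v Y|%:R < d * #|Y|%:R]|%:R <= eps * #|A|%:R.
Proof.
move=> eps0 A0 reg XA YC cY; set Z := [set v in X | _].
rewrite leNgt; apply/negP => cZ.
have ZA : Z \subset A by apply: subset_trans XA; apply/subsetP => v; rewrite inE => /andP [].
have := reg Z Y ZA YC (ltW cZ) cY; apply/negP; rewrite -ltNge.
have Z0 : (0 < #|Z|)%N.
  by rewrite -(ltr_nat R); apply: le_lt_trans cZ; rewrite mulr_ge0 // ltW.
have -> : d * (#|Z|%:R * #|Y|%:R) = \sum_(v in Z) d * #|Y|%:R.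
  by rewrite sumr_const -[RHS]mulr_natl; ring.
rewrite natr_sum; apply: ltr_sum; last by move=> v; rewrite inE => /andP [].
move/card_gt0P: Z0 => [v vZ]; by apply/hasP; exists v.
Qed.

Lemma few_bad_seq (R : realFieldType) (T I : finType) (B : rel T) (eps : R) (dd : I -> R)
    (A X : {set T}) (U Y : I -> {set T}) (s : seq I) :
  0 < eps -> (0 < #|A|)%N -> X \subset A ->
  (forall j, j \in s -> [/\ lreg B eps (dd j) A (U j), Y j \subset U j &
       eps * #|U j|%:R <= #|Y j|%:R]) ->
  #|X|%:R - (size s)%:R * (eps * #|A|%:R) <=
  #|[set v in X | all (fun j => dd j * #|Y j|%:R <= #|nb B v (Y j)|%:R) s]|%:R.
Proof.
move=> eps0 A0 XA; elim: s => [|j s IH] H.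
  by rewrite mul0r subr0 ler_nat; apply: subset_leq_card; apply/subsetP => v; rewrite inE => ->.
have [reg YU cY] := H j (mem_head _ _).
have {}IH := IH (fun i is_ => H i (mem_tail is_)).
set G := [set v in X | _] in IH *.
set G' := [set v in X | _].
have b := few_bad eps0 A0 reg XA YU cY; set Z := [set v in X | _] in b.
have : (#|G| <= #|G'| + #|Z|)%N.
  apply: leq_trans (_ : #|G' :|: Z| <= _)%N; last by rewrite cardsU leq_subr.
  apply: subset_leq_card; apply/subsetP => v; rewrite !inE /= => /andP [-> ->].
  by rewrite andbT /=; case: leP.
rewrite -(ler_nat R) natrD /= -natr1 mulrDl mul1r => c; lra.
Qed.

(** Greedy: pick an edge in the first cluster whose ends are typical towards all the others. Each
    end sees a share [(1 + d) / 2] of every candidate set, so their common neighbourhood keeps a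
    share [d]. [kappa] bounds the share of each cluster still available; the numerical condition
    leaves room for the exceptional vertices towards the remaining clusters and for an [eps] share
    in which to find the edge. *)
Lemma embed_edges (R : realFieldType) (T I : finType) (B : rel T) (eps d : R)
    (U : I -> {set T}) (s : seq I) :
  symmetric B -> irreflexive B -> 0 < eps -> 0 < d -> d <= 1 -> uniq s ->
  (forall i, i \in s -> (0 < #|U i|)%N) ->
  (forall i j, i \in s -> j \in s -> i != j -> lreg B eps ((1 + d) / 2) (U i) (U j)) ->
  (forall i (Y : {set T}), i \in s -> Y \subset U i -> eps * #|U i|%:R <= #|Y|%:R ->
     exists x y, [/\ x \in Y, y \in Y & B x y]) ->
  forall (kappa : R) (X : I -> {set T}),
  (size s).+1%:R * eps <= kappa * d ^+ size s ->
  (forall i, i \in s -> X i \subset U i /\ kappa * #|U i|%:R <= #|X i|%:R) ->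
  exists K : {set T}, [/\ clique B K, #|K| = (2 * size s)%N &
    forall z, z \in K -> exists2 i, i \in s & z \in X i].
Proof.
move=> Bs Bi eps0 d0 d1; elim: s => [|i s IH] su U0 reg edge kappa X kap HX.
  exists set0; rewrite cards0 muln0; split=> //; first exact: clique0.
  by move=> z; rewrite in_set0.
have kappa0 : 0 < kappa.
  rewrite -(pmulr_lgt0 _ (exprn_gt0 (size (i :: s)) d0)).
  by apply: lt_le_trans kap; rewrite mulr_gt0 // ltr0n.
have kap1 : (size s).+2%:R * eps <= kappa.
  apply: le_trans kap _; rewrite -[X in _ <= X]mulr1 ler_pM2l //.
  by apply: exprn_ile1 => //; apply: ltW.
have kapeps : eps <= kappa.
  by apply: le_trans kap1; rewrite -[X in X <= _]mul1r ler_pM2r // (ler_nat R 1).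
have [XU cX] := HX i (mem_head _ _).
have Ui0 := U0 i (mem_head _ _).
have [is_ su'] : i \notin s /\ uniq s by move: su => /= /andP.
have good := @few_bad_seq R T I B eps (fun _ => (1 + d) / 2) (U i) (X i) U X s eps0 Ui0 XU.
set Y := [set v in X i | _] in good.
have YU : Y \subset U i by apply: subset_trans XU; apply/subsetP => v; rewrite inE => /andP [].
have {good} cY : eps * #|U i|%:R <= #|Y|%:R.
  apply: le_trans (good _).
    have : (size s).+2%:R * eps * #|U i|%:R <= kappa * #|U i|%:R by rewrite ler_wpM2r.
    rewrite -natr1 -natr1 !mulrDl !mul1r; move: cX.
    have : 0 <= eps * #|U i|%:R by rewrite mulr_ge0 // ltW.
    rewrite -mulrA; lra.
  move=> j js; have [XUj cXj] := HX j (mem_tail js); split=> //.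
    apply: reg; rewrite ?mem_head ?mem_tail //.
    by apply: contraNneq is_ => ->.
  by apply: le_trans cXj; rewrite ler_wpM2r.
have [x [y [xY yY Bxy]]] := edge i Y (mem_head _ _) YU cY.
pose X' j := nb B x (X j) :&: nb B y (X j).
have [|||||K' [K'c K's K'X]] := IH su' _ _ _ (kappa * d) X'.
- by move=> j js; apply: U0; rewrite mem_tail.
- by move=> j k js ks; apply: reg; rewrite mem_tail.
- by move=> j Z js; apply: edge; rewrite mem_tail.
- rewrite -mulrA -exprS; apply: le_trans kap; rewrite ler_pM2r // ler_nat //.
- move=> j js; have [XUj cXj] := HX j (mem_tail js).
  split; first by apply: subset_trans XUj; apply/subsetP => v; rewrite !inE => /andP [/andP []].
  have gx v : v \in Y -> (1 + d) / 2 * #|X j|%:R <= #|nb B v (X j)|%:R.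
    by rewrite inE => /andP [_ /allP]; apply.
  have cU : (#|nb B x (X j)| + #|nb B y (X j)| <= #|X' j| + #|X j|)%N.
    rewrite -cardsUI addnC leq_add2l; apply: subset_leq_card; apply/subsetP => v.
    by rewrite !inE => /orP [] /andP [].
  move: cU; rewrite -(ler_nat R) !natrD => cU.
  have := gx x xY; have := gx y yY.
  have : d * (kappa * #|U j|%:R) <= d * #|X j|%:R by rewrite ler_pM2l.
  lra.
have adj v z : v \in [set x; y] -> z \in K' -> B v z.
  move=> vxy zK; have [j _] := K'X z zK; rewrite !inE => /andP [/andP [_ bx] /andP [_ by_]].
  by move: vxy; rewrite !inE => /orP [] /eqP ->.
have nin v : v \in [set x; y] -> v \notin K'.
  by move=> vxy; apply/negP => /(adj v v vxy); rewrite Bi.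
have xy : x != y by apply: contraTneq Bxy => ->; rewrite Bi.
exists ([set x; y] :|: K'); split.
- apply/cliqueP => a b; rewrite !inE -!orbA => ha hb ab.
  have [aK|aK] := boolP (a \in K'); have [bK|bK] := boolP (b \in K').
  + by move/cliqueP: K'c; apply.
  + rewrite Bs; apply: adj => //; rewrite !inE; move: hb; rewrite (negPf bK) orbF; done.
  + apply: adj => //; rewrite !inE; move: ha; rewrite (negPf aK) orbF; done.
  + move: ha hb; rewrite (negPf aK) (negPf bK) !orbF.
    by move=> /orP [] /eqP Ea /orP [] /eqP Eb; move: ab; rewrite Ea Eb ?eqxx // Bs.
- rewrite cardsU (_ : [set x; y] :&: K' = set0).
    by rewrite cards0 subn0 cards2 xy K's mulnS.
  apply/setP => v; rewrite in_setI in_set0; case: (boolP (v \in [set x; y])) => //= /nin.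
  by move/negPf.
- move=> z; rewrite in_setU => /orP [zxy|/K'X [j js]].
    exists i; rewrite ?mem_head //.
    have YX : {subset Y <= X i} by move=> v; rewrite inE => /andP [].
    by move: zxy; rewrite !inE => /orP [] /eqP ->; apply: YX.
  by rewrite !inE => /andP [/andP [zX _] _]; exists j; rewrite ?mem_tail.
Qed.

(** Clusters in [s1] give one vertex, those in [s2] an edge. The single vertices are chosen first,
    at the cost of a factor [d] each, and [embed_edges] finishes. *)
Lemma embed (R : realFieldType) (T I : finType) (B : rel T) (eps d : R)
    (U : I -> {set T}) (s1 s2 : seq I) :
  symmetric B -> irreflexive B -> 0 < eps -> 0 < d -> d <= 1 -> uniq (s1 ++ s2) ->
  (forall i, i \in s1 ++ s2 -> (0 < #|U i|)%N) ->
  (forall i j, i \in s1 ++ s2 -> j \in s1 ++ s2 -> i != j -> lreg B eps d (U i) (U j)) ->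
  (forall i j, i \in s2 -> j \in s2 -> i != j -> lreg B eps ((1 + d) / 2) (U i) (U j)) ->
  (forall i (Y : {set T}), i \in s2 -> Y \subset U i -> eps * #|U i|%:R <= #|Y|%:R ->
     exists x y, [/\ x \in Y, y \in Y & B x y]) ->
  forall (kappa : R) (X : I -> {set T}),
  (size (s1 ++ s2)).+1%:R * eps <= kappa * d ^+ size (s1 ++ s2) ->
  (forall i, i \in s1 ++ s2 -> X i \subset U i /\ kappa * #|U i|%:R <= #|X i|%:R) ->
  exists K : {set T}, [/\ clique B K, #|K| = (size s1 + 2 * size s2)%N &
    forall z, z \in K -> exists2 i, i \in s1 ++ s2 & z \in X i].
Proof.
move=> Bs Bi eps0 d0 d1; elim: s1 => [|i s IH] su U0 reg reg2 edge kappa X kap HX.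
  exact: (embed_edges Bs Bi eps0 d0 d1 su U0 reg2 edge kap HX).
rewrite cat_cons in su U0 reg kap HX *; set t := s ++ s2 in su U0 reg kap HX IH *.
have kappa0 : 0 < kappa.
  rewrite -(pmulr_lgt0 _ (exprn_gt0 (size (i :: t)) d0)).
  by apply: lt_le_trans kap; rewrite mulr_gt0 // ltr0n.
have kap1 : (size t).+2%:R * eps <= kappa.
  apply: le_trans kap _; rewrite -[X in _ <= X]mulr1 ler_pM2l //.
  by apply: exprn_ile1 => //; apply: ltW.
have kapeps : eps <= kappa.
  by apply: le_trans kap1; rewrite -[X in X <= _]mul1r ler_pM2r // (ler_nat R 1).
have [XU cX] := HX i (mem_head _ _).
have Ui0 := U0 i (mem_head _ _).
have [is_ su'] : i \notin t /\ uniq t by move: su => /= /andP.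
have good := @few_bad_seq R T I B eps (fun _ => d) (U i) (X i) U X t eps0 Ui0 XU.
set Y := [set v in X i | _] in good.
have {good} cY : eps * #|U i|%:R <= #|Y|%:R.
  apply: le_trans (good _).
    have : (size t).+2%:R * eps * #|U i|%:R <= kappa * #|U i|%:R by rewrite ler_wpM2r.
    rewrite -natr1 -natr1 !mulrDl !mul1r; move: cX.
    have : 0 <= eps * #|U i|%:R by rewrite mulr_ge0 // ltW.
    rewrite -mulrA; lra.
  move=> j js; have [XUj cXj] := HX j (mem_tail js); split=> //.
    apply: reg; rewrite ?mem_head ?mem_tail //.
    by apply: contraNneq is_ => ->.
  by apply: le_trans cXj; rewrite ler_wpM2r.
have [x xY] : exists x, x \in Y.
  apply/card_gt0P; rewrite -(ltr_nat R); apply: lt_le_trans cY.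
  by rewrite mulr_gt0 // ltr0n.
have xY' : forall j, j \in t -> d * #|X j|%:R <= #|nb B x (X j)|%:R.
  by move=> j js; move: xY; rewrite inE => /andP [_ /allP]; apply.
have [||||K' [K'c K's K'X]] := IH su' _ _ reg2 edge (kappa * d) (fun j => nb B x (X j)).
- by move=> j js; apply: U0; rewrite mem_tail.
- by move=> j k js ks; apply: reg; rewrite mem_tail.
- rewrite -mulrA -exprS; apply: le_trans kap; rewrite ler_pM2r // ler_nat //.
- move=> j js; have [XUj cXj] := HX j (mem_tail js).
  split; first by apply: subset_trans XUj; apply/subsetP => v; rewrite !inE => /andP [].
  apply: le_trans (xY' j js); rewrite [kappa * d]mulrC -mulrA ler_pM2l //.
have adj z : z \in K' -> B x z.
  by move=> zK; have [j _] := K'X z zK; rewrite inE => /andP [_ bx].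
exists (x |: K'); split.
- apply/cliqueP => a b; rewrite !inE => /orP [/eqP ->|aK] /orP [/eqP ->|bK]; rewrite ?eqxx // => ab.
  + exact: adj.
  + by rewrite Bs adj.
  + by move/cliqueP: K'c; apply.
- rewrite cardsU1 K's /= (_ : x \notin K').
    by rewrite addnA.
  by apply/negP => /adj; rewrite Bi.
- move=> z; rewrite in_setU1 => /orP [/eqP ->|/K'X [j js]].
    by exists i; rewrite ?mem_head //; move: xY; rewrite inE => /andP [].
  by rewrite inE => /andP [zX _]; exists j; rewrite ?mem_tail.
Qed.

(** * Cliques of the reduced graph *)

Section ReducedClique.
Variables (R : realFieldType) (I : finType).
Implicit Types (M : I -> I -> R) (S B A F P Q : {set I}) (rd fu hh : rel I).

Lemma copos_le M M' S : (forall i j, i \in S -> j \in S -> M i j <= M' i j) ->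
  copos M S -> copos M' S.
Proof.
move=> MM cM y y0 yS; apply: le_trans (cM y y0 yS) _.
apply: ler_sum => i _; apply: ler_sum => j _.
have [iS|/yS ->] := boolP (i \in S); last by rewrite !mulr0 !mul0r.
have [jS|/yS ->] := boolP (j \in S); last by rewrite !mulr0.
by rewrite ler_wpM2r // ler_wpM2r // MM.
Qed.

Lemma copos_add M M' S : copos M S -> copos M' S -> copos (fun i j => M i j + M' i j) S.
Proof.
move=> cM cM' y y0 yS; have := addr_ge0 (cM y y0 yS) (cM' y y0 yS).
rewrite -big_split /=; congr (_ <= _); apply: eq_bigr => i _.
by rewrite -big_split /=; apply: eq_bigr => j _; ring.
Qed.

Lemma copos_scale (a : R) M S : 0 <= a -> copos M S -> copos (fun i j => a * M i j) S.
Proof.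
move=> a0 cM y y0 yS; have := mulr_ge0 a0 (cM y y0 yS).
rewrite mulr_sumr; congr (_ <= _); apply: eq_bigr => i _.
by rewrite mulr_sumr; apply: eq_bigr => j _; ring.
Qed.

(* [copos (wform lam hh) S] bounds by [lam] the Lagrangian, on [S], of the
   weighting with 1 on the [hh]-pairs and 1/2 on the other pairs. *)
Definition wform (lam : R) hh (i j : I) : R :=
  lam - (if i == j then 0 else (1 + (hh i j)%:R) / 2).

(** The weight [(1 + hh) / 2] is the average of the complete graph and [hh]; Motzkin-Straus applies
    to both, with clique numbers at most [m] and [p]. *)
Lemma wform_bound lam hh p m S :
  symmetric hh -> irreflexive hh -> (0 < p)%N -> (0 < m)%N ->
  (forall P, P \subset S -> clique hh P -> (#|P| <= p)%N) -> (#|S| <= m)%N ->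
  2 * (1 - lam) <= p%:R^-1 + m%:R^-1 -> copos (wform lam hh) S.
Proof.
move=> hsym hirr p0 m0 hp Sm hlam.
have c1 := @motzkin_straus R I hh p S hsym hirr p0 hp.
have c2 : copos (fun i j => 1 - m%:R^-1 - (i != j)%:R : R) S.
  apply: motzkin_straus => //; first by move=> i j; rewrite eq_sym.
    by move=> i; rewrite eqxx.
  by move=> P PS _; apply: leq_trans Sm; apply: subset_leq_card.
have half0 : 0 <= 1/2 :> R by lra.
apply: copos_le (copos_scale half0 (copos_add c1 c2)) => i j _ _.
rewrite /wform; case: eqP => [->|_] /=; first by rewrite hirr /=; lra.
lra.
Qed.

(** The sum of column [j] is the covering quantity of [j] minus [17/100] of the total mass, and
    [17/100 * 17/3 < 1]. The bound [17/3], that is [5 + 2/3], is what the pentagon certificates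
    spend. *)
Lemma wform_certificate hh S (c : I -> R) :
  symmetric hh -> irreflexive hh ->
  (forall i, 0 <= c i) -> (forall i, i \notin S -> c i = 0) -> S != set0 ->
  (forall j, j \in S -> 1 <= c j + (\sum_(i | (i != j) && ~~ hh i j) c i) / 2) ->
  \sum_i c i <= 17%:R / 3%:R ->
  (forall S', S' \proper S -> copos (wform (83%:R / 100%:R) hh) S') ->
  copos (wform (83%:R / 100%:R) hh) S.
Proof.
move=> hsym hirr c0 cS S0 cov tot IH.
apply: (@copos_certificate _ _ _ _ c) => //.
- by move=> i j; rewrite /wform eq_sym hsym.
- apply/exists_inP; apply: contraNT S0 => /exists_inPn H.
  apply/set0Pn => -[j jS]; have := cov j jS.
  have cz i : c i = 0.
    apply/eqP; rewrite eq_le c0 andbT; have [iS|/cS ->] := boolP (i \in S); last by [].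
    by have := H i iS; rewrite -leNgt.
  by rewrite cz big1 ?mul0r ?addr0 ?ler10.
move=> j jS.
have -> : \sum_i c i * wform (83%:R / 100%:R) hh i j =
   c j + (\sum_(i | (i != j) && ~~ hh i j) c i) / 2 - 17%:R / 100%:R * \sum_i c i.
  have -> : c j = \sum_i (if i == j then c i else 0) by rewrite -big_mkcond big_pred1_eq.
  rewrite mulr_sumr [X in _ + X / 2]big_mkcond mulr_suml -big_split -sumrB /=.
  apply: eq_bigr => i _; rewrite /wform; case: eqP => [->|_] /=; first by rewrite /=; field.
  by case: (hh i j) => /=; field.
by have := cov j jS; lra.
Qed.

Lemma sum_ge_seq (c : I -> R) (P : pred I) (s : seq I) :
  uniq s -> (forall i, i \in s -> P i) -> (forall i, 0 <= c i) ->
  \sum_(i <- s) c i <= \sum_(i | P i) c i.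
Proof.
move=> us sP c0; rewrite big_uniq // [X in _ <= X](bigID (mem s)) /=.
rewrite -[X in X <= _]addr0 lerD ?sumr_ge0 //.
rewrite le_eqVlt; apply/orP; left; apply/eqP; apply: eq_bigl => i.
by have [/sP ->|] := boolP (i \in s); rewrite ?andbF.
Qed.

Lemma clique1 (h : rel I) (v : I) : clique h [set v].
Proof. by apply/cliqueP => i j; rewrite !inE => /eqP -> /eqP ->; rewrite eqxx. Qed.

(* [ram t = t (t + 3) / 2] bounds [r(3, t + 1) - 1]. *)
Fixpoint ram (t : nat) : nat := if t is t'.+1 then (ram t' + t' + 2)%N else 0%N.

Definition nrd rd : rel I := fun i j => ~~ rd i j.

Definition trifree rd B := forall i j k, i \in B -> j \in B -> k \in B ->
  rd i j -> rd j k -> ~~ rd i k.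

Lemma trifreeS rd B B' : B' \subset B -> trifree rd B -> trifree rd B'.
Proof. by move=> /subsetP sub tf i j k /sub iB /sub jB /sub kB; apply: tf. Qed.

Lemma red_nbrs_indep rd B v : symmetric rd -> trifree rd B -> v \in B ->
  clique (nrd rd) [set u in B | rd v u].
Proof.
move=> rs tf vB; apply/cliqueP => i j; rewrite !inE => /andP [iB vi] /andP [jB vj] _.
by apply: (tf i v j) => //; rewrite rs.
Qed.

(** The classical recursion at a vertex [v]: its red neighbours are independent, and an independent
    set among its non-neighbours can be extended by [v]. *)
Lemma ramsey3 rd t B : symmetric rd -> irreflexive rd -> trifree rd B ->
  (forall A, A \subset B -> clique (nrd rd) A -> (#|A| <= t)%N) -> (#|B| <= ram t)%N.
Proof.
move=> rs ri; elim: t B => [|t IH] B tf indep.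
  have [->|[v vB]] := set_0Vmem B; first by rewrite cards0.
  by have := indep [set v]; rewrite sub1set vB cards1 clique1 => /(_ isT isT).
have [->|[v vB]] := set_0Vmem B; first by rewrite cards0.
set N := [set u in B | rd v u]; set M := B :\ v :\: N.
have cN : (#|N| <= t.+1)%N.
  apply: indep; last exact: red_nbrs_indep.
  by apply/subsetP => u; rewrite inE => /andP [].
have cM : (#|M| <= ram t)%N.
  apply: IH => [|A AM Ac].
    by apply: trifreeS tf; apply/subsetP => i; rewrite !inE => /andP [_ /andP []].
  have vA : v \notin A by apply/negP => /(subsetP AM); rewrite !inE eqxx andbF.
  have := indep (v |: A); rewrite cardsU1 vA add1n ltnS; apply.
    rewrite subUset sub1set vB; apply/subsetP => u /(subsetP AM).
    by rewrite !inE => /andP [_ /andP []].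
  have vu u : u \in A -> ~~ rd v u.
    by move=> /(subsetP AM); rewrite !inE => /andP [] /[swap] /andP [_ ->].
  apply/cliqueP => i j; rewrite !inE => /orP [/eqP ->|iA] /orP [/eqP ->|jA]; rewrite ?eqxx //.
  + by move=> _; apply: vu.
  + by move=> _; rewrite /nrd rs; apply: vu.
  + by move/cliqueP: Ac; apply.
have : (#|B| <= #|M| + #|N| + 1)%N.
  rewrite (cardsD1 v) vB addnC leq_add2r.
  by rewrite -(cardsID N (B :\ v)) addnC leq_add2l subset_leq_card // subsetIr.
move=> H; apply: leq_trans H _; rewrite /=; move: cN cM; lia.
Qed.

(* Each cluster of [A] contributes a vertex to a clique of colour 2, and each
   cluster of [F], all pairs of which are full, a second one. *)
Definition capped rd fu (c : nat) B := forall A F, A \subset B -> F \subset A ->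
  clique (nrd rd) A -> clique fu F -> (#|A| + #|F| <= c)%N.

Definition hrel rd fu : rel I := fun i j => rd i j || fu i j.

Lemma hclique_fu rd fu P : clique (hrel rd fu) P -> clique (nrd rd) P -> clique fu P.
Proof.
move=> /cliqueP h /cliqueP n; apply/cliqueP => i j iP jP ij.
by have := h i j iP jP ij; rewrite /hrel (negPf (n i j iP jP ij)).
Qed.

Lemma capped_indep rd fu c B A : (0 < c)%N -> capped rd fu c B -> A \subset B ->
  clique (nrd rd) A -> (#|A| <= c.-1)%N.
Proof.
move=> c0 cap AB Ac; have [->|[v vA]] := set_0Vmem A; first by rewrite cards0.
have : (#|A| + #|[set v]| <= c)%N.
  apply: cap => //; first by rewrite sub1set.
  by apply/cliqueP => i j; rewrite !inE => /eqP -> /eqP ->; rewrite eqxx.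
by rewrite cards1; lia.
Qed.

(** A red-independent subset of a heavy clique is full, so it counts twice in the cap and has at
    most [c./2] elements; [ramsey3] then bounds the clique. *)
Lemma capped_hclique rd fu c B P : symmetric rd -> irreflexive rd -> trifree rd B ->
  capped rd fu c B -> P \subset B -> clique (hrel rd fu) P -> (#|P| <= ram c./2)%N.
Proof.
move=> rs ri tf cap PB hP; apply: (ramsey3 rs ri (trifreeS PB tf)) => A AP Ac.
have := cap A A (subset_trans AP PB) (subxx _) Ac (hclique_fu (cliqueS AP hP) Ac).
by lia.
Qed.

Lemma clique2 (h : rel I) i j : symmetric h -> h i j -> clique h [set i; j].
Proof.
move=> hs hij; apply/cliqueP => a b; rewrite !inE.
by move=> /orP [] /eqP -> /orP [] /eqP ->; rewrite ?eqxx // hs.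
Qed.

Lemma cliqueU1 (h : rel I) v A : symmetric h -> clique h A -> (forall u, u \in A -> h v u) ->
  clique h (v |: A).
Proof.
move=> hs /cliqueP hA hv; apply/cliqueP => i j; rewrite !inE.
move=> /orP [/eqP ->|iA] /orP [/eqP ->|jA]; rewrite ?eqxx // => ij.
- exact: hv.
- by rewrite hs hv.
- exact: hA.
Qed.

Lemma nrd_sym rd : symmetric rd -> symmetric (nrd rd).
Proof. by move=> rs i j; rewrite /nrd rs. Qed.

Lemma capped_no4 rd fu B u v x y : symmetric rd -> symmetric fu -> capped rd fu 5 B ->
  u \in B -> v \in B -> x \in B -> y \in B -> fu u v ->
  u != v -> x != u -> x != v -> y != u -> y != v -> x != y ->
  ~~ rd u v -> ~~ rd x u -> ~~ rd x v -> ~~ rd y u -> ~~ rd y v -> ~~ rd x y -> False.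
Proof.
move=> rs fs cap uB vB xB yB fuv uv xu xv yu yv xy r1 r2 r3 r4 r5 r6.
have ns := nrd_sym rs.
have := cap (x |: (y |: [set u; v])) [set u; v].
rewrite !cardsU1 !inE !negb_or xy xu xv yu yv uv cards1 /= => H.
suff : (1 + (1 + 2) + 2 <= 5)%N by [].
apply: H.
- by rewrite !subUset !sub1set xB yB uB vB.
- by apply/subsetP => i; rewrite !inE => ->; rewrite !orbT.
- apply: cliqueU1 => //; last first.
    by move=> z; rewrite !inE => /or3P [] /eqP ->; rewrite /nrd.
  apply: cliqueU1 => //; first by apply: clique2.
  by move=> z; rewrite !inE => /orP [] /eqP ->; rewrite /nrd.
- exact: clique2.
Qed.

Lemma capped_no3 rd fu c B u v x : (c <= 5)%N -> symmetric rd -> symmetric fu -> capped rd fu c B ->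
  u \in B -> v \in B -> x \in B -> u != v -> u != x -> v != x ->
  fu u v -> fu u x -> fu v x -> ~~ rd u v -> ~~ rd u x -> ~~ rd v x -> False.
Proof.
move=> c5 rs fs cap uB vB xB uv ux vx fuv fux fvx r1 r2 r3.
have ns := nrd_sym rs.
have := cap (u |: [set v; x]) (u |: [set v; x]).
rewrite !cardsU1 !inE !negb_or uv ux vx cards1 /= => H.
suff : (1 + 2 + (1 + 2) <= c)%N by move/leq_trans/(_ c5).
apply: H => //.
- by rewrite !subUset !sub1set xB uB vB.
- by apply: cliqueU1 => //; [apply: clique2|move=> z; rewrite !inE => /orP [] /eqP ->].
- by apply: cliqueU1 => //; [apply: clique2|move=> z; rewrite !inE => /orP [] /eqP ->].
Qed.

Lemma card_le2_of_trifree rd B A : symmetric rd -> irreflexive rd -> trifree rd B ->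
  A \subset B -> clique rd A -> (#|A| <= 2)%N.
Proof.
move=> rs ri tf AB Ac; rewrite leqNgt; apply/negP => /card_gt2P [i [j [k [[iA jA kA] [ij jk ki]]]]].
have r := cliqueP rd A Ac.
have := tf i j k; rewrite !(subsetP AB) // => /(_ isT isT isT).
by rewrite !r // 1?eq_sym // => /(_ isT isT).
Qed.

(** For a non-red pair [u], [v] of [P], the other vertices red to neither form a red clique by
    [capped_no4], so they are at most two and [#|B| <= 4 + #|red u :|: red v|]. With twelve
    vertices, all four red neighbourhoods would have size four and be disjoint, for red pairs by
    triangle-freeness and for the others by this inequality; [B] would then have 16 vertices,
    against the same inequality. *)
Lemma hclique4_card rd fu B P : symmetric rd -> irreflexive rd -> symmetric fu ->
  trifree rd B -> capped rd fu 5 B -> P \subset B -> clique (hrel rd fu) P -> #|P| = 4%N ->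
  (#|B| <= 11)%N.
Proof.
move=> rs ri fs tf cap PB hP P4.
pose red u := [set x in B | rd u x].
have redB u : red u \subset B by apply/subsetP => x; rewrite inE => /andP [].
have red4 u : u \in B -> (#|red u| <= 4)%N.
  by move=> uB; apply: (capped_indep _ cap) => //; apply: red_nbrs_indep.
have fuP u v : u \in P -> v \in P -> u != v -> ~~ rd u v -> fu u v.
  by move=> uP vP uv r; move/cliqueP: hP => /(_ u v uP vP uv); rewrite /hrel (negPf r).
have fubound u v : u \in P -> v \in P -> u != v -> ~~ rd u v ->
  (#|B| <= 4 + #|red u :|: red v|)%N.
  move=> uP vP uv ruv.
  have uB := subsetP PB u uP; have vB := subsetP PB v vP.
  pose C := B :\: [set u; v] :\: (red u :|: red v).
  have cC : (#|C| <= 2)%N.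
    apply: (card_le2_of_trifree rs ri tf).
      by apply/subsetP => x; rewrite !inE => /andP [_ /andP []].
    apply/cliqueP => x y; rewrite !inE !negb_or.
    move=> /andP [/andP [xu xv] /andP [/andP [nxu nxv] xB]].
    move=> /andP [/andP [yu yv] /andP [/andP [nyu nyv] yB]] xy.
    rewrite xB /= in xu xv; rewrite yB /= in yu yv.
    apply/negPn/negP => rxy.
    by apply: (@capped_no4 rd fu B u v x y) => //; rewrite 1?rs ?fuP // 1?rs.
  have : (#|B| <= #|[set u; v]| + (#|red u :|: red v| + #|C|))%N.
    rewrite -(cardsID [set u; v] B) leq_add ?subset_leq_card ?subsetIr //.
    by rewrite -(cardsID (red u :|: red v) (B :\: _)) leq_add ?subset_leq_card ?subsetIr.
  by rewrite cards2 uv; lia.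
(* If [u] were red to the three others, these would be pairwise non-red, a full triple forbidden by
   [capped_no3]. *)
have nbr u : u \in P -> exists2 v, v \in P & (u != v) && ~~ rd u v.
  move=> uP; apply/exists_inP; apply: contraT => /exists_inPn H; exfalso.
  have H' v : v \in P -> u != v -> rd u v.
    by move=> /H; rewrite negb_and negbK => /orP [/eqP ->|/negPn //]; rewrite ?eqxx.
  have : (2 < #|P :\ u|)%N by move: P4; rewrite (cardsD1 u) uP add1n => -[->].
  move=> /card_gt2P [i [j [k [[iA jA kA] [ij jk ki]]]]].
  move: iA jA kA; rewrite !inE => /andP [iu iP] /andP [ju jP] /andP [ku kP].
  have nr x y : x \in P -> y \in P -> x != u -> y != u -> ~~ rd x y.
    move=> xP yP xu yu; apply: (tf x u y); rewrite ?(subsetP PB) //.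
      by rewrite rs H' // eq_sym.
    by rewrite H' // eq_sym.
  have ik : i != k by rewrite eq_sym.
  apply: (@capped_no3 rd fu 5 B i j k); rewrite ?(subsetP PB) ?nr // ?fuP // ?nr //.
rewrite leqNgt; apply/negP => B12.
have sz u : u \in P -> (4 <= #|red u|)%N.
  move=> uP; have [v vP /andP [uv ruv]] := nbr u uP.
  have := fubound u v uP vP uv ruv; have := red4 v (subsetP PB v vP).
  by rewrite cardsU; move: B12; lia.
have disj u v x : u \in P -> v \in P -> u != v -> x \in red u -> x \in red v -> False.
  move=> uP vP uv; rewrite !inE => /andP [xB rux] /andP [_ rvx].
  have [ruv|ruv] := boolP (rd u v).
    by have := tf u v x (subsetP PB u uP) (subsetP PB v vP) xB ruv rvx; rewrite rux.
  have := fubound u v uP vP uv ruv; have := red4 v (subsetP PB v vP).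
  have := red4 u (subsetP PB u uP); rewrite cardsU.
  have : (0 < #|red u :&: red v|)%N by apply/card_gt0P; exists x; rewrite !inE xB rux rvx.
  by move: B12; lia.
have : (16 <= #|B|)%N.
  have -> : (16 = \sum_(u in P) 4)%N by rewrite sum_nat_const P4.
  apply: leq_trans (_ : \sum_(u in P) #|red u| <= _)%N; first by apply: leq_sum => u /sz.
  have -> : (\sum_(u in P) #|red u| = \sum_(u in P) \sum_(x in B) rd u x)%N.
    apply: eq_bigr => u _; rewrite -sum1_card big_mkcond [RHS]big_mkcond /=.
    by apply: eq_bigr => x _; rewrite inE; case: (x \in B); case: (rd u x).
  rewrite exchange_big /= -sum1_card; apply: leq_sum => x xB.
  have [/exists_inP [u uP rux]|/exists_inPn H] := boolP [exists u in P, rd u x]; last first.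
    by rewrite big1 // => u uP; rewrite (negPf (H u uP)).
  rewrite (bigD1 u) //= big1 ?addn0; first by case: (rd u x).
  move=> v /andP [vP vu]; apply/eqP; rewrite eqb0; apply/negP => rvx.
  by apply: (disj u v x); rewrite 1?eq_sym // inE xB.
have [u uP] : exists u, u \in P by apply/card_gt0P; rewrite P4.
have [v vP /andP [uv ruv]] := nbr u uP.
have := fubound u v uP vP uv ruv; have := red4 v (subsetP PB v vP).
have := red4 u (subsetP PB u uP); rewrite cardsU; lia.
Qed.

End ReducedClique.

(** * Heavy cliques under the cap 4 *)

Lemma red_in_indep (I : finType) (rd : rel I) (B P : {set I}) v :
  symmetric rd -> trifree rd B -> v \in B -> P \subset B ->
  clique (nrd rd) [set u in P | rd v u].
Proof.
move=> rs tf vB PB; apply: cliqueS (red_nbrs_indep rs tf vB).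
by apply/subsetP => u; rewrite !inE => /andP [/(subsetP PB) -> ->].
Qed.

(** The red neighbours of [v] in [P] form a full set, counted twice in the cap. Two non-neighbours
    that are not red to each other would be a full pair, and with [v] they would count 3 + 2. *)
Lemma capped4_out (I : finType) (rd fu : rel I) (B P : {set I}) v :
  symmetric rd -> irreflexive rd -> symmetric fu ->
  trifree rd B -> capped rd fu 4 B -> P \subset B -> clique (hrel rd fu) P ->
  v \in B :\: P ->
  let X := [set u in P | rd v u] in
  [/\ clique (nrd rd) X, (#|X| <= 2)%N, clique rd (P :\: X) & (#|P :\: X| <= 2)%N].
Proof.
move=> rs ri fs tf cap PB hP; rewrite inE => /andP [vP vB] X.
have XP : X \subset P by apply/subsetP => u; rewrite inE => /andP [].
have Xc : clique (nrd rd) X by apply: (red_in_indep rs tf).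
have PXc : clique rd (P :\: X).
  apply/cliqueP => i j; rewrite !inE => /andP [iX iP] /andP [jX jP] ij.
  rewrite iP /= in iX; rewrite jP /= in jX.
  apply/negPn/negP => rij.
  have ns := nrd_sym rs.
  have fij : fu i j by move/cliqueP: hP => /(_ i j iP jP ij); rewrite /hrel (negPf rij).
  have vi : v != i by apply: contraNneq vP => ->.
  have vj : v != j by apply: contraNneq vP => ->.
  have := cap (v |: [set i; j]) [set i; j].
  rewrite !cardsU1 !inE !negb_or vi vj ij cards1 /= => H.
  suff : (1 + 2 + 2 <= 4)%N by [].
  apply: H.
  - by rewrite !subUset !sub1set vB !(subsetP PB).
  - by apply/subsetP => x; rewrite !inE => ->; rewrite orbT.
  - by apply: cliqueU1 => //; [apply: clique2|move=> z; rewrite !inE => /orP [] /eqP ->].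
  - exact: clique2.
split=> //.
  have := cap X X (subset_trans XP PB) (subxx _) Xc (hclique_fu (cliqueS XP hP) Xc); lia.
apply: (card_le2_of_trifree rs ri tf) => //.
by apply: subset_trans PB; apply: subsetDl.
Qed.

Lemma capped4_hclique5 (I : finType) (rd fu : rel I) (B P : {set I}) :
  symmetric rd -> irreflexive rd -> symmetric fu ->
  trifree rd B -> capped rd fu 4 B -> P \subset B -> clique (hrel rd fu) P -> #|P| = 5%N ->
  B = P.
Proof.
move=> rs ri fs tf cap PB hP P5; apply/eqP; rewrite eqEsubset PB andbT; apply/subsetP => v vB.
apply/negPn/negP => vP.
have [] := @capped4_out I rd fu B P v rs ri fs tf cap PB hP _; first by rewrite inE vP.
move=> _ X2 _ PX2; have := cardsID [set u in P | rd v u] P.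
rewrite P5; have : (#|P :&: [set u in P | rd v u]| <= #|[set u in P | rd v u]|)%N.
  by apply: subset_leq_card; apply: subsetIr.
by move: X2 PX2; lia.
Qed.

(** By [capped4_out], a vertex outside [P] is red to exactly two vertices of [P], and the other two
    are a red pair. All outside vertices turn out to be red to one common [b], which also has a red
    neighbour in [P]; as the red degree of [b] is at most three, at most two vertices lie
    outside. *)
Lemma capped4_hclique4 (I : finType) (rd fu : rel I) (B P : {set I}) :
  symmetric rd -> irreflexive rd -> symmetric fu ->
  trifree rd B -> capped rd fu 4 B -> P \subset B -> clique (hrel rd fu) P -> #|P| = 4%N ->
  (#|B| <= 6)%N.
Proof.
move=> rs ri fs tf cap PB hP P4.
have PBe u : u \in P -> u \in B by move/(subsetP PB).
have fuP u v : u \in P -> v \in P -> u != v -> ~~ rd u v -> fu u v.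
  by move=> uP vP uv r; move/cliqueP: hP => /(_ u v uP vP uv); rewrite /hrel (negPf r).
have tri3 i j k : i \in P -> j \in P -> k \in P -> i != j -> i != k -> j != k ->
    ~~ rd i j -> ~~ rd i k -> ~~ rd j k -> False.
  move=> iP jP kP ij ik jk rij rik rjk.
  by apply: (@capped_no3 I rd fu 4 B i j k) => //; auto.
have out v : v \in B :\: P -> let X := [set u in P | rd v u] in
    [/\ clique (nrd rd) X, #|X| = 2%N, clique rd (P :\: X) & #|P :\: X| = 2%N].
  move=> vBP X; have [c1 c2 c3 c4] := capped4_out rs ri fs tf cap PB hP vBP.
  have XP : P :&: X = X by apply/setIidPr; apply/subsetP => u; rewrite inE => /andP [].
  have := cardsID X P; rewrite P4 XP => E; split=> //; move: c2 c4 E; rewrite -/X; lia.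
have [BP|[v0 v0BP]] := set_0Vmem (B :\: P).
  by have := cardsID P B; rewrite BP cards0 (setIidPr PB) P4 => <-.
have [X0c /eqP /cards2P [b [c [bc X0E]]] Y0c /eqP /cards2P [a [d [ad Y0E]]]] := out v0 v0BP.
set X0 := [set u in P | rd v0 u] in X0E X0c Y0E Y0c.
have inX0 u : (u \in X0) = (u \in P) && rd v0 u by rewrite inE.
have [bX cX] : b \in X0 /\ c \in X0 by rewrite X0E !inE !eqxx orbT.
have [aY dY] : a \in P :\: X0 /\ d \in P :\: X0 by rewrite Y0E !inE !eqxx orbT.
have rbc : ~~ rd b c by move/cliqueP: X0c; apply.
have rad : rd a d by move/cliqueP: Y0c; apply.
have [bP cP] : b \in P /\ c \in P by move: bX cX; rewrite !inX0 => /andP [-> _] /andP [-> _].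
have [aP dP] : a \in P /\ d \in P by move: aY dY; rewrite !in_setD => /andP [_ ->] /andP [_ ->].
have [ba bd] : b != a /\ b != d.
  by split; [apply: contraTneq bX => ->; move: aY|apply: contraTneq bX => ->; move: dY];
     rewrite inE => /andP [].
have [ca cd] : c != a /\ c != d.
  by split; [apply: contraTneq cX => ->; move: aY|apply: contraTneq cX => ->; move: dY];
     rewrite inE => /andP [].
have abcd u : u \in P -> [|| u == a, u == b, u == c | u == d].
  move=> uP; have : (u \in X0) || (u \in P :\: X0) by rewrite in_setD uP andbT orbN.
  by rewrite Y0E X0E !inE => /orP [/orP [] ->|/orP [] ->]; rewrite ?orbT.
have rda : rd d a by rewrite rs.
have allb v : v \in B :\: P -> rd v b.
  move=> vBP; have [X1c X12 Y1c /eqP Y12] := out v vBP.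
  set X1 := [set u in P | rd v u] in X1c X12 Y1c Y12.
  apply: contraT => rvb.
  have bY : b \in P :\: X1 by rewrite !inE bP (negPf rvb).
  (* Used with [{e, f} = {a, d}]: if [v] is red neither to [b] nor to [e], it is red to [c] and [f],
     so these are not red to each other, and [b], [c], [f] form a forbidden non-red triple of
     [P]. *)
  have key e f : e \in P -> f \in P -> b != e -> b != f -> c != e -> c != f -> e != f ->
      e \in P :\: X1 -> rd e f -> False.
    move=> eP fP be bf ce cf ef eY ref.
    have rbe : rd b e by move/cliqueP: Y1c; apply.
    have rbf : ~~ rd b f by apply: (tf b e f); auto.
    have Y1E : P :\: X1 = [set b; e].
      apply/eqP; rewrite eq_sym eqEcard (eqP Y12) cards2 be leqnn andbT.
      by apply/subsetP => u; rewrite !inE => /orP [] /eqP ->; [move: bY|move: eY]; rewrite !inE.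
    have inX1 u : u \in P -> u != b -> u != e -> u \in X1.
      move=> uP ub ue; apply: contraT => uX1.
      by have : u \in P :\: X1 by [rewrite inE uX1]; rewrite Y1E !inE (negPf ub) (negPf ue).
    have rcf : ~~ rd c f.
      by move/cliqueP: X1c; apply => //; apply: inX1; rewrite // eq_sym.
    exact: (tri3 b c f).
  have /existsP [e /andP [eY eb]] : [exists e, (e \in P :\: X1) && (e != b)].
    apply: contraT => /existsPn H.
    have : P :\: X1 \subset [set b].
      by apply/subsetP => u uY; have := H u; rewrite uY /= negbK inE.
    by move/subset_leq_card; rewrite (eqP Y12) cards1.
  have eP : e \in P by move: eY; rewrite inE => /andP [].
  have rbe : rd b e by move/cliqueP: Y1c; apply; rewrite // eq_sym.
  have /or4P [] := abcd e eP => /eqP Ee; subst e.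
  + by case: (key a d).
  + by rewrite eqxx in eb.
  + by rewrite rbe in rbc.
  + by case: (key d a) => //; rewrite eq_sym.
have [j jP rbj] : exists2 j, j \in P & rd b j.
  have [rba|rba] := boolP (rd b a); first by exists a.
  have [rbd|rbd] := boolP (rd b d); first by exists d.
  have rca : rd c a by apply/negPn/negP => r; apply: (tri3 b c a).
  have rcd : rd c d by apply/negPn/negP => r; apply: (tri3 b c d).
  by have := tf c a d (PBe c cP) (PBe a aP) (PBe d dP) rca rad; rewrite rcd.
have cR : (#|[set u in B | rd b u]| <= 3)%N.
  apply: (capped_indep _ cap) => //; first by apply/subsetP => u; rewrite inE => /andP [].
  by apply: red_nbrs_indep; auto.
have : (#|j |: (B :\: P)| <= 3)%N.
  apply: leq_trans cR; apply: subset_leq_card; rewrite subUset sub1set inE PBe // rbj /=.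
  apply/subsetP => v vBP; rewrite inE rs allb // andbT.
  by move: vBP; rewrite inE => /andP [].
have jn : j \notin B :\: P by rewrite inE jP.
by rewrite cardsU1 jn -(cardsID P B) (setIidPr PB) P4 add1n ltnS (leq_add2l 4 _ 2).
Qed.

(** * Heavy 5-cliques under the cap 5 *)

Section Pentagon.
Variables (I : finType) (rd fu : rel I) (B : {set I}).
Hypotheses (rs : symmetric rd) (ri : irreflexive rd) (fs : symmetric fu) (fi : irreflexive fu).
Hypotheses (tf : trifree rd B) (cap : capped rd fu 5 B).
Let hh := hrel rd fu.

Let hs : symmetric hh. Proof. by move=> i j; rewrite /hh /hrel rs fs. Qed.
Let hi : irreflexive hh. Proof. by move=> i; rewrite /hh /hrel ri fi. Qed.

(** Named after its red graph, which is 2-regular by [pentagon_degrees] and hence a 5-cycle. *)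
Definition pentagon (Q : {set I}) := [/\ Q \subset B, clique hh Q & #|Q| = 5%N].

Let hhE u v : hh u v -> ~~ rd u v -> fu u v.
Proof. by rewrite /hh /hrel => /orP [->|]. Qed.

Let nhr u v : ~~ hh u v -> ~~ rd u v.
Proof. by rewrite /hh /hrel negb_or => /andP []. Qed.

Lemma hclique_le5 (P : {set I}) : P \subset B -> clique hh P -> (#|P| <= 5)%N.
Proof. by move=> PB hP; apply: (capped_hclique rs ri tf cap PB hP). Qed.

(** The red neighbours of [z] are mutually full and count twice in the cap; the full ones are
    mutually red by [capped_no3]. Neither set exceeds two elements, and together they have four. *)
Lemma pentagon_degrees Q z : pentagon Q -> z \in Q ->
  #|[set x in Q | rd z x]| = 2%N /\ #|[set x in Q :\ z | ~~ rd z x]| = 2%N.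
Proof.
move=> [QB hQ Q5] zQ; set X := [set x in Q | rd z x]; set Y := [set x in Q :\ z | ~~ rd z x].
have zB := subsetP QB z zQ.
have XQ : X \subset Q by apply/subsetP => x; rewrite inE => /andP [].
have YQ : Y \subset Q by apply/subsetP => x; rewrite !inE => /andP [/andP []].
have X2 : (#|X| <= 2)%N.
  have Xc : clique (nrd rd) X by apply: (red_in_indep rs tf zB QB).
  have := cap (subset_trans XQ QB) (subxx _) Xc (hclique_fu (cliqueS XQ hQ) Xc).
  by move: #|X| => n; clear; lia.
have fuz x : x \in Y -> fu z x.
  rewrite !inE => /andP [/andP [xz xQ] rzx]; apply: hhE rzx.
  by move/cliqueP: hQ; apply; rewrite // eq_sym.
have Y2 : (#|Y| <= 2)%N.
  apply: (card_le2_of_trifree rs ri tf (subset_trans YQ QB)); apply/cliqueP => i j iY jY ij.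
  have [fzi fzj] := (fuz i iY, fuz j jY).
  move: iY jY; rewrite !inE => /andP [/andP [iz iQ] rzi] /andP [/andP [jz jQ] rzj].
  apply/negPn/negP => rij.
  apply: (@capped_no3 I rd fu 5 B z i j); rewrite ?(subsetP QB i iQ) ?(subsetP QB j jQ) // 1?eq_sym //.
  by apply: hhE rij; move/cliqueP: hQ; apply.
have E : (#|X| + #|Y| = 4)%N.
  have XYE : X :|: Y = Q :\ z.
    apply/setP => x; rewrite !inE; case: (x =P z) => [->|_]; first by rewrite ri andbF.
    by case: (x \in Q); case: (rd z x).
  have XY0 : X :&: Y = set0 by apply/setP => x; rewrite !inE; case: (rd z x); rewrite ?andbF.
  have := cardsU X Y; rewrite XYE XY0 cards0 subn0 => <-.
  by move: Q5; rewrite (cardsD1 z) zQ add1n => -[].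
by move: X2 Y2 E; move: #|X| #|Y| => n m; clear; lia.
Qed.

Definition halfset (Q : {set I}) u : {set I} := [set z in Q | ~~ hh u z].

(** Such a [u] can replace [z] in [Q]. Twins are the obstacle to the certificate, since only one
    pair of weight 1/2 joins them to [Q]. *)
Definition twin (Q : {set I}) u z := [/\ u \in B, u \notin Q & halfset Q u = [set z]].

Lemma twinP Q u z : twin Q u z -> [/\ z \in Q, ~~ hh u z, u != z &
   forall x, x \in Q -> x != z -> hh u x].
Proof.
move=> [uB uQ Hz].
have inH x : (x \in Q) && ~~ hh u x = (x == z).
  by have /setP /(_ x) := Hz; rewrite !inE.
have /andP [zQ huz] : (z \in Q) && ~~ hh u z by rewrite inH.
split=> //; first by apply: contraNneq uQ => ->.
by move=> x xQ xz; have := inH x; rewrite xQ (negPf xz) => /negbFE.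
Qed.

Lemma pentagon_swap Q u z : pentagon Q -> u \in B -> u \notin Q -> z \in Q ->
  (forall x, x \in Q -> x != z -> hh u x) -> pentagon (u |: Q :\ z).
Proof.
move=> [QB hQ Q5] uB uQ zQ hu; split.
- by rewrite subUset sub1set uB; apply: subset_trans (subD1set _ _) QB.
- apply: cliqueU1 => //; first exact: cliqueS (subD1set _ _) hQ.
  by move=> x; rewrite !inE => /andP [xz xQ]; apply: hu.
- by move: Q5; rewrite cardsU1 !inE (negPf uQ) andbF (cardsD1 z) zQ.
Qed.

Lemma twin_swap Q u z : pentagon Q -> twin Q u z -> pentagon (u |: Q :\ z) /\ twin (u |: Q :\ z) z u.
Proof.
move=> pQ tw; have [zQ huz uz hu] := twinP tw; have [uB uQ Hz] := tw.
split; first exact: pentagon_swap.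
have [QB hQ Q5] := pQ; split; first exact: (subsetP QB).
  by rewrite !inE eqxx /= orbF eq_sym.
apply/setP => x; rewrite !inE; have [->|xu] := eqVneq x u; first by rewrite hs huz.
rewrite /=; have [->|xz] := eqVneq x z => //=.
have [xQ|//] := boolP (x \in Q).
by apply/negbTE; rewrite negbK; move/cliqueP: hQ; apply; rewrite // eq_sym.
Qed.

(** The red degree of [x] is 2 both in [Q] and in the swapped pentagon, which differ only in [z] and
    [u]. *)
Lemma twin_red Q u z x : pentagon Q -> twin Q u z -> x \in Q -> x != z -> rd u x = rd z x.
Proof.
move=> pQ tw xQ xz; have [zQ huz uz hu] := twinP tw; have [uB uQ Hz] := tw.
have [pQ' _] := twin_swap pQ tw.
have [d _] := pentagon_degrees pQ xQ.
have xQ' : x \in u |: Q :\ z by rewrite !inE xz xQ orbT.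
have [d' _] := pentagon_degrees pQ' xQ'.
pose W := [set y in Q :\ z | rd x y].
have e : (#|[set y in Q | rd x y]| = rd x z + #|W|)%N.
  rewrite (cardsD1 z) !inE zQ /=; congr (_ + #|pred_of_set _|)%N.
  by apply/setP => y; rewrite !inE andbA.
have e' : (#|[set y in u |: Q :\ z | rd x y]| = rd x u + #|W|)%N.
  rewrite (cardsD1 u) !inE eqxx /=; congr (_ + #|pred_of_set _|)%N.
  apply/setP => y; rewrite !inE; have [->|yu] := eqVneq y u => //=.
  by rewrite (negPf uQ) andbF.
move: e'; rewrite d' -d e => /addIn; rewrite [rd u x]rs [rd z x]rs.
by case: (rd x z); case: (rd x u).
Qed.

(** Two twins of [z] share a red neighbour, so they are not red to each other; together with [z] and
    a full neighbour of [z] they contradict [capped_no4]. *)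
Lemma twin_uniq Q u u' z : pentagon Q -> twin Q u z -> twin Q u' z -> u = u'.
Proof.
move=> pQ tw tw'; have [zQ huz uz hu] := twinP tw; have [_ huz' uz' hu'] := twinP tw'.
have [uB uQ _] := tw; have [uB' uQ' _] := tw'; have [QB hQ Q5] := pQ.
have [dr dn] := pentagon_degrees pQ zQ.
apply/eqP/negPn/negP => uu'.
have [x] : exists x, x \in [set x in Q | rd z x] by apply/card_gt0P; rewrite dr.
rewrite inE => /andP [xQ rzx].
have xz : x != z by apply: contraTneq rzx => ->; rewrite ri.
have [y] : exists y, y \in [set x in Q :\ z | ~~ rd z x] by apply/card_gt0P; rewrite dn.
rewrite !inE => /andP [/andP [yz yQ] rzy].
have zB := subsetP QB z zQ; have yB := subsetP QB y yQ; have xB := subsetP QB x xQ.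
have ruu' : ~~ rd u u'.
  by apply: (@tf u x u') => //; [rewrite (twin_red pQ tw)|rewrite rs (twin_red pQ tw')].
have fzy : fu z y by apply: hhE rzy; move/cliqueP: hQ; apply; rewrite // eq_sym.
apply: (@capped_no4 I rd fu B z y u u') => //.
- by rewrite eq_sym.
- by apply: contraNneq uQ => ->.
- by apply: contraNneq uQ' => ->.
- exact: nhr.
- by rewrite (twin_red pQ tw).
- exact: nhr.
- by rewrite (twin_red pQ tw').
Qed.

(** Otherwise [z] and [z'] are full, and [capped_no4] forces [u] and [u'] to be red. But the red
    neighbourhoods of [z] and [z'] in [Q] lie within three vertices and share one, which is red to
    both twins: a red triangle. *)
Lemma twin_centres_red Q u u' z z' : pentagon Q -> twin Q u z -> twin Q u' z' -> z != z' ->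
  rd z z'.
Proof.
move=> pQ tw tw' zz'; have [zQ huz uz hu] := twinP tw; have [zQ' huz' uz' hu'] := twinP tw'.
have [uB uQ _] := tw; have [uB' uQ' _] := tw'; have [QB hQ Q5] := pQ.
apply/negPn/negP => rzz'.
have fzz' : fu z z' by apply: hhE rzz'; move/cliqueP: hQ; apply.
have z'z : z' != z by rewrite eq_sym.
have uu' : u != u'.
  apply: contraNneq huz => uu'; rewrite uu'; exact: hu'.
have ruz' : ~~ rd u z' by rewrite (twin_red pQ tw).
have ruz : ~~ rd u' z by rewrite (twin_red pQ tw') // rs.
have [ruu'|ruu'] := boolP (rd u u'); last first.
  apply: (@capped_no4 I rd fu B z z' u u'); rewrite ?(subsetP QB z zQ) ?(subsetP QB z' zQ') //.
  - by apply: contraNneq uQ => ->.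
  - by apply: contraNneq uQ' => ->.
  - exact: nhr.
  - exact: nhr.
have [d _] := pentagon_degrees pQ zQ; have [d' _] := pentagon_degrees pQ zQ'.
have sub : [set x in Q | rd z x] :|: [set x in Q | rd z' x] \subset Q :\ z :\ z'.
  apply/subsetP => x; rewrite !inE => /orP [] /andP [-> rx]; rewrite andbT.
    apply/andP; split; first by apply: contraNneq rzz' => <-.
    by apply: contraTneq rx => ->; rewrite ri.
  apply/andP; split; first by apply: contraTneq rx => ->; rewrite ri.
  by apply: contraNneq rzz' => <-; rewrite rs.
have c3 : #|Q :\ z :\ z'| = 3.
  by move: Q5; rewrite (cardsD1 z) zQ (cardsD1 z' (Q :\ z)) !inE z'z zQ' => -[].
have [x] : exists x, x \in [set x in Q | rd z x] :&: [set x in Q | rd z' x].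
  apply/card_gt0P; have := subset_leq_card sub; rewrite cardsU d d' c3.
  by case: #|_|.
rewrite !inE => /andP [/andP [xQ rzx] /andP [_ rzx']].
have xz : x != z by apply: contraTneq rzx => ->; rewrite ri.
have xz' : x != z' by apply: contraTneq rzx' => ->; rewrite ri.
suff : ~~ rd u u' by rewrite ruu'.
apply: (@tf u x u'); rewrite ?(subsetP QB x xQ) //.
  by rewrite (twin_red pQ tw).
by rewrite rs (twin_red pQ tw').
Qed.

Lemma halfset_gt0 Q u : pentagon Q -> u \in B -> u \notin Q -> (0 < #|halfset Q u|)%N.
Proof.
move=> [QB hQ Q5] uB uQ; rewrite lt0n cards_eq0; apply/eqP => H0.
have : (#|u |: Q| <= 5)%N.
  apply: hclique_le5; first by rewrite subUset sub1set uB.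
  apply: cliqueU1 => // x xQ; have /setP/(_ x) := H0.
  by rewrite !inE xQ => /negbFE.
by rewrite cardsU1 uQ Q5.
Qed.

Lemma halfset_ge2 Q u : pentagon Q -> u \in B -> u \notin Q -> (forall z, ~ twin Q u z) ->
  exists x y, [/\ x \in halfset Q u, y \in halfset Q u & x != y].
Proof.
move=> pQ uB uQ notw; apply/card_gt1P.
rewrite ltn_neqAle halfset_gt0 // andbT eq_sym; apply/negP => /cards1P [z Hz].
exact: (notw z).
Qed.

Lemma twin_after_swap Q u u' z z' : pentagon Q -> twin Q u z -> twin Q u' z' ->
  z != z' -> hh u u' -> twin (u |: Q :\ z) u' z'.
Proof.
move=> pQ tw tw' zz' huu'.
have [uB uQ _] := tw; have [uB' uQ' _] := tw'; have [zQ' _ _ _] := twinP tw'.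
have u'u : u' != u by apply: contraTneq huu' => ->; rewrite hi.
split=> //; first by rewrite !inE negb_or u'u (negPf uQ') andbF.
apply/setP => y; rewrite !inE; have [->|yu] := eqVneq y u.
  rewrite hs huu' /=; apply/esym/negbTE; apply: contraNneq uQ => ->; exact: zQ'.
have [->|yz] := eqVneq y z; first by rewrite (negPf zz').
by have [_ _ /setP/(_ y)] := tw'; rewrite !inE => <- //=.
Qed.

(* Otherwise, in the pentagon with [u] in place of [z], the vertices [z], [u'] and
   [v] are twins of [u], [z'] and [x], which then form a red triangle. *)
Lemma half_of_twin Q u u' z z' v x : pentagon Q -> twin Q u z -> twin Q u' z' ->
  z != z' -> hh u u' -> v \in B -> v \notin Q -> v != u ->
  halfset Q v = [set z; x] -> x != z -> x != z' -> ~~ hh v u.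
Proof.
move=> pQ tw tw' zz' huu' vB vQ vu Hv xz xz'.
have [zQ huz uz hu] := twinP tw; have [zQ' huz' uz' hu'] := twinP tw'.
have [uB uQ _] := tw; have [uB' uQ' _] := tw'; have [QB hQ Q5] := pQ.
apply/negP => hvu.
have [pQu tzu] := twin_swap pQ tw; set Qu := u |: Q :\ z in pQu tzu.
have z'z : z' != z by rewrite eq_sym.
have inH y : (y \in Q) && ~~ hh v y = (y == z) || (y == x).
  by have /setP/(_ y) := Hv; rewrite !inE.
have xQ : x \in Q by have := inH x; rewrite eqxx orbT => /andP [].
have hvx : ~~ hh v x by have := inH x; rewrite eqxx orbT => /andP [].
have twv : twin Qu v x.
  split=> //; first by rewrite !inE negb_or vu (negPf vQ) andbF.
  apply/setP => y; rewrite !inE; have [->|yu] := eqVneq y u.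
    by rewrite hvu /=; apply/esym/negbTE; apply: contraNneq uQ => ->.
  have := inH y; have [->|yz] /= := eqVneq y z; last by move=> ->.
  by rewrite eq_sym (negPf xz).
have twu' : twin Qu u' z' by apply: twin_after_swap.
have xu : x != u by apply: contraNneq uQ => <-.
have z'u : z' != u by apply: contraNneq uQ => <-.
have r1 : rd x u := twin_centres_red pQu twv tzu xu.
have r2 : rd x z' := twin_centres_red pQu twv twu' xz'.
have r3 : rd z' u := twin_centres_red pQu twu' tzu z'u.
have := @tf u x z' uB (subsetP QB x xQ) (subsetP QB z' zQ').
by rewrite rs => /(_ r1 r2); rewrite rs r3.
Qed.


(** After [u] and [u'] replace [z] and [z'], the vertex [v] would be heavy to a whole pentagon. *)
Lemma some_half_twin Q u u' z z' v : pentagon Q -> twin Q u z -> twin Q u' z' ->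
  z != z' -> hh u u' -> v \in B -> v \notin Q -> v != u -> v != u' ->
  halfset Q v = [set z; z'] -> ~~ hh v u || ~~ hh v u'.
Proof.
move=> pQ tw tw' zz' huu' vB vQ vu vu' Hv.
rewrite -negb_and; apply/negP => /andP [hvu hvu'].
have [pQu _] := twin_swap pQ tw.
have twu' := twin_after_swap pQ tw tw' zz' huu'.
have [pQuu _] := twin_swap pQu twu'.
have vn : v \notin u' |: (u |: Q :\ z) :\ z'.
  by rewrite !inE (negPf vu) (negPf vu') (negPf vQ) !andbF.
have := halfset_gt0 pQuu vB vn; rewrite lt0n cards_eq0 => /eqP [].
apply/setP => y; rewrite !inE.
have [->|yu'] := eqVneq y u'; first by rewrite hvu'.
have [->|yu] := eqVneq y u; first by rewrite hvu andbF.
have := congr1 (fun A : {set I} => y \in A) Hv; rewrite !inE /=.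
case: (y == z); case: (y == z') => //=; rewrite ?andbF //.
Qed.

Variable R : realFieldType.
Let lam : R := 83%:R / 100%:R.

Let cardE (A : {set I}) : \sum_i (i \in A)%:R = #|A|%:R :> R.
Proof. by rewrite -sum1_card natr_sum [RHS]big_mkcond; apply: eq_bigr => i _; case: (_ \in _). Qed.

Let half_sum (c : I -> R) (j : I) (s : seq I) : (forall i, 0 <= c i) ->
  uniq s -> (forall i, i \in s -> (i != j) && ~~ hh i j) ->
  1 <= c j + (\sum_(i <- s) c i) / 2 ->
  1 <= c j + (\sum_(i | (i != j) && ~~ hh i j) c i) / 2.
Proof.
move=> c0 us sP H; apply: le_trans H _; rewrite lerD2l ler_pM2r ?invr_gt0 ?ltr0n //.
exact: sum_ge_seq.
Qed.

(** Mass 1 on [Q] covers [Q] and every vertex with two weight-1/2 pairs into [Q]. Only twins lack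
    these, and there are at most two, their centres being distinct and pairwise red. An extra mass
    of at most 2/3 serves them. *)
Lemma pentagon_copos Q : pentagon Q ->
  (forall S' : {set I}, S' \proper B -> copos (wform lam hh) S') -> copos (wform lam hh) B.
Proof.
move=> pQ IH; have [QB hQ Q5] := pQ.
have B0 : B != set0.
  have [z zQ] : exists z, z \in Q by apply/card_gt0P; rewrite Q5.
  by apply/set0Pn; exists z; apply: (subsetP QB).
pose TW := [set u in B :\: Q | #|halfset Q u| == 1%N].
have TWB u : u \in TW -> u \in B by rewrite !inE => /andP [/andP []].
have TWQ u : u \in TW -> u \notin Q by rewrite !inE => /andP [/andP []].
have TWP u : u \in TW -> exists z, twin Q u z.
  move=> uT; move: (uT); rewrite inE => /andP [_ /cards1P [z Hz]].
  by exists z; split; rewrite ?TWB ?TWQ.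
have NTW u : u \in B -> u \notin Q -> u \notin TW ->
    exists x y, [/\ x \in halfset Q u, y \in halfset Q u & x != y].
  move=> uB uQ uT; apply: halfset_ge2 => // z [_ _ Hz].
  by move: uT; rewrite !inE uB uQ Hz cards1.
have inhalf u x : u \notin Q -> x \in halfset Q u -> x \in Q /\ (x != u) && ~~ hh x u.
  move=> uQ; rewrite inE => /andP [xQ hux]; split=> //; rewrite hs hux andbT.
  by apply: contraNneq uQ => <-.
have TW2 : (#|TW| <= 2)%N.
  rewrite leqNgt; apply/negP => /card_gt2P [u1 [u2 [u3 [[T1 T2 T3] [d12 d23 d31]]]]].
  have [[[z1 t1] [z2 t2]] [z3 t3]] := (TWP u1 T1, TWP u2 T2, TWP u3 T3).
  have dz u u' z z' : twin Q u z -> twin Q u' z' -> u != u' -> z != z'.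
    by move=> t t'; apply: contraNneq => E; rewrite E in t; apply/eqP; apply: twin_uniq t t'.
  have r12 := twin_centres_red pQ t1 t2 (dz _ _ _ _ t1 t2 d12).
  have r23 := twin_centres_red pQ t2 t3 (dz _ _ _ _ t2 t3 d23).
  have r31 := twin_centres_red pQ t3 t1 (dz _ _ _ _ t3 t1 d31).
  have [[[q1 _ _ _] [q2 _ _ _]] [q3 _ _ _]] := (twinP t1, twinP t2, twinP t3).
  have := @tf z1 z2 z3 (subsetP QB _ q1) (subsetP QB _ q2) (subsetP QB _ q3) r12 r23.
  by rewrite rs r31.
(* Covers the cases where a mass [a] on each twin suffices: 1/2 for a single twin, 1/3 for two twins
   joined with weight 1/2. *)
have easy (a : R) : 0 <= a -> a * #|TW|%:R <= 2%:R / 3%:R ->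
    (forall u z, u \in TW -> twin Q u z -> exists s, [/\ uniq (z :: s),
       (forall i, i \in s -> [&& i \in TW, i != u & ~~ hh i u]) &
        1 <= a + (1 + a * (size s)%:R) / 2]) -> copos (wform lam hh) B.
  move=> a0 asum aP.
  pose c i : R := (i \in Q)%:R + a * (i \in TW)%:R.
  have c0 i : 0 <= c i by rewrite addr_ge0 // mulr_ge0.
  have cQ i : i \in Q -> c i = 1.
    by move=> iQ; rewrite /c iQ (_ : (i \in TW) = false) ?mulr0 ?addr0 //; apply: contraTF iQ => /TWQ.
  apply: (@wform_certificate R I hh B c) => //.
  - move=> i iB; rewrite /c (_ : (i \in Q) = false); last by apply: contraNF iB; apply: (subsetP QB).
    by rewrite (_ : (i \in TW) = false) ?mulr0 ?addr0 //; apply: contraNF iB => /TWB.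
  - move=> j jB; have [jQ|jQ] := boolP (j \in Q).
      rewrite cQ // lerDl divr_ge0 //; apply: sumr_ge0 => i _; exact: c0.
    have [jT|jT] := boolP (j \in TW).
      have [z tz] := TWP j jT; have [zQ hz jz _] := twinP tz.
      have [s [us sP sa]] := aP j z jT tz.
      apply: (half_sum (s := z :: s)) => //.
        move=> i; rewrite inE => /orP [/eqP ->|/sP /and3P [_ -> ->]] //.
        by rewrite eq_sym jz hs hz.
      rewrite big_cons (cQ z zQ).
      have -> : \sum_(i <- s) c i = a * (size s)%:R.
        rewrite (eq_big_seq (fun=> a)); first by rewrite big_const_seq count_predT iter_addr_0 mulr_natr.
        by move=> i /sP /and3P [iT _ _]; rewrite /c iT (negPf (TWQ i iT)) add0r mulr1.
      have -> : c j = a by rewrite /c jT (negPf jQ) add0r mulr1.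
      exact: sa.
    have [x [y [xH yH xy]]] := NTW j jB jQ jT.
    have [[xQ xj] [yQ yj]] := (inhalf j x jQ xH, inhalf j y jQ yH).
    apply: (half_sum (s := [:: x; y])) => //; first by rewrite /= inE xy.
      by move=> i; rewrite !inE => /orP [] /eqP ->.
    rewrite !big_cons big_nil (cQ x xQ) (cQ y yQ); have := c0 j; lra.
  - rewrite big_split /= -mulr_sumr !cardE Q5; lra.
have [TW1|TW1] := leqP #|TW| 1.
  apply: (easy (1/2)); first by lra.
    have : #|TW|%:R <= 1 :> R by rewrite (ler_nat R _ 1).
    by lra.
  move=> u z _ _; exists [::]; split=> //=; lra.
have /eqP /cards2P [u [u' [uu' TWE]]] : #|TW| = 2%N by apply/eqP; rewrite eqn_leq TW2 TW1.
have [uT uT'] : u \in TW /\ u' \in TW by rewrite TWE !inE !eqxx orbT.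
have [[z tz] [z' tz']] := (TWP u uT, TWP u' uT').
have [huu'|huu'] := boolP (hh u u'); last first.
  apply: (easy (1/3%:R)); first by lra.
    by rewrite TWE cards2 uu' /=; lra.
  have H v v' y : v \in TW -> v' \in TW -> v' != v -> ~~ hh v' v -> twin Q v y -> exists s, [/\ uniq (y :: s),
       (forall i, i \in s -> [&& i \in TW, i != v & ~~ hh i v]) &
        1 <= 1 / 3%:R + (1 + 1 / 3%:R * (size s)%:R) / 2 :> R].
    move=> vT vT' vv' hvv' ty; exists [:: v']; split.
    - rewrite /= inE andbT; have [yQ _ _ _] := twinP ty.
      by apply: contraTneq yQ => ->; apply: TWQ.
    - by move=> i; rewrite inE => /eqP ->; apply/and3P.
    - by rewrite /=; lra.
  move=> v y vT; have : v \in [set u; u'] by rewrite -TWE.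
  rewrite !inE => /orP [] /eqP -> ty; last exact: (H u' u).
  by apply: (H u u') => //; rewrite 1?eq_sym // hs.
have zz' : z != z'.
  by apply: contraNneq uu' => E; rewrite E in tz; apply/eqP; apply: twin_uniq tz tz'.
have [zQ hz uz hu] := twinP tz; have [zQ' hz' uz' hu'] := twinP tz'.
have [uB uQ _] := tz; have [uB' uQ' _] := tz'.
(* Two twins forming a heavy pair do not help each other. Mass 2/3 on both twins and both centres
   covers these four, as 2/3 + 1/3, but a vertex whose weight-1/2 pairs use a centre may now need a
   third such pair. *)
pose c i : R := (i \in Q)%:R - (1/3%:R) * (i \in [set z; z'])%:R + (2%:R/3%:R) * (i \in [set u; u'])%:R.
have zu'n : z != u' by apply: contraNneq uQ' => <-.
have z'un : z' != u by apply: contraNneq uQ => <-.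
have zun : z != u by rewrite eq_sym.
have z'u'n : z' != u' by rewrite eq_sym.
have uz'n : u != z' by rewrite eq_sym.
have u'zn : u' != z by rewrite eq_sym.
have cz : c z = 2%:R/3%:R.
  by rewrite /c !in_set2 zQ eqxx (negPf zun) (negPf zu'n) /=; lra.
have cz' : c z' = 2%:R/3%:R.
  by rewrite /c !in_set2 zQ' eqxx (negPf z'un) (negPf z'u'n) orbT /=; lra.
have cu : c u = 2%:R/3%:R.
  by rewrite /c !in_set2 (negPf uQ) eqxx (negPf uz) (negPf uz'n) /=; lra.
have cu' : c u' = 2%:R/3%:R.
  by rewrite /c !in_set2 (negPf uQ') eqxx (negPf uz') (negPf u'zn) orbT /=; lra.
have cQ x : x \in Q -> x != z -> x != z' -> c x = 1.
  move=> xQ xz xz'; rewrite /c !inE xQ (negPf xz) (negPf xz').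
  rewrite (_ : (x == u) = false); last by apply/negbTE; apply: contraNneq uQ => <-.
  rewrite (_ : (x == u') = false); last by apply/negbTE; apply: contraNneq uQ' => <-.
  by rewrite /=; lra.
have c0 i : 0 <= c i.
  have [->|iz] := eqVneq i z; first by rewrite cz; lra.
  have [->|iz'] := eqVneq i z'; first by rewrite cz'; lra.
  rewrite /c !inE (negPf iz) (negPf iz') /=.
  by case: (i \in Q); case: (_ || _) => /=; lra.
apply: (@wform_certificate R I hh B c) => //.
- move=> i iB.
  have nB x : x \in B -> (i == x) = false by move=> xB; apply/negbTE; apply: contraNneq iB => ->.
  rewrite /c !inE !nB ?(subsetP QB z zQ) ?(subsetP QB z' zQ') //.
  rewrite (_ : (i \in Q) = false); last by apply: contraNF iB; apply: (subsetP QB).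
  by rewrite /=; lra.
- move=> j jB.
  have single i : i != j -> ~~ hh i j -> c i = 2%:R/3%:R -> c j = 2%:R/3%:R ->
      1 <= c j + (\sum_(i | (i != j) && ~~ hh i j) c i) / 2.
    move=> ij hij ci cj; apply: (half_sum (s := [:: i])) => //.
      by move=> k; rewrite inE => /eqP ->; rewrite ij.
    by rewrite big_cons big_nil ci cj; lra.
  have [E|jz] := eqVneq j z; first by apply: (single u); rewrite ?E // hs.
  have [E|jz'] := eqVneq j z'; first by apply: (single u'); rewrite ?E // hs.
  have [E|ju] := eqVneq j u; first by apply: (single z); rewrite ?E // hs.
  have [E|ju'] := eqVneq j u'; first by apply: (single z'); rewrite ?E // hs.
  have [jQ|jQ] := boolP (j \in Q).
    rewrite cQ // lerDl divr_ge0 //; apply: sumr_ge0 => i _; exact: c0.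
  have jT : j \notin TW by rewrite TWE !inE negb_or ju ju'.
  have two s : uniq s -> (forall i, i \in s -> (i != j) && ~~ hh i j) ->
      2 <= \sum_(i <- s) c i ->
      1 <= c j + (\sum_(i | (i != j) && ~~ hh i j) c i) / 2.
    by move=> us sP s2; apply: half_sum sP _ => //; have := c0 j; move: s2; lra.
  pose H := halfset Q j.
  have HP x : x \in H -> (x != j) && ~~ hh x j by move=> /(inhalf j x jQ) [].
  have HQ x : x \in H -> x \in Q by move=> /(inhalf j x jQ) [].
  have done2 x y : x \in H -> y \in H -> x != y -> x != z -> x != z' -> y != z -> y != z' ->
      1 <= c j + (\sum_(i | (i != j) && ~~ hh i j) c i) / 2.
    move=> xH yH xy xz xz' yz yz'; apply: (two [:: x; y]); first by rewrite /= inE xy.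
      by move=> i; rewrite !inE => /orP [] /eqP ->; apply: HP.
    by rewrite !big_cons big_nil (cQ x (HQ x xH) xz xz') (cQ y (HQ y yH) yz yz'); lra.
  (* A partner of mass 1 and a centre [y] make 5/3 of the required 2. The rest comes from the other
     centre, a second partner of mass 1, or the twin [v] of [y], by [half_of_twin]. *)
  have done1 x y t v v' : x \in H -> x != z -> x != z' -> y \in H ->
      c y = 2%:R/3%:R -> c v = 2%:R/3%:R -> c t = 2%:R/3%:R -> y != t -> x != y ->
      [set y; t] = [set z; z'] ->
      v \notin Q -> twin Q v y -> twin Q v' t -> hh v v' -> j != v ->
      1 <= c j + (\sum_(i | (i != j) && ~~ hh i j) c i) / 2.
    move=> xH xz xz' yH cy cv ct yt xy yzE vQ tw1 tw2 hvv' jv.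
    have xyv : (x != v) && (y != v).
      by apply/andP; split; [apply: contraNneq vQ => <-|apply: contraNneq vQ => <-]; apply: HQ.
    have [tH|tH] := boolP (t \in H).
      have xt : x != t.
        have : t \in [set z; z'] by rewrite -yzE !inE eqxx orbT.
        by rewrite !inE => /orP [] /eqP ->.
      apply: (two [:: x; y; t]); first by rewrite /= !inE negb_or xy xt yt.
        by move=> i; rewrite !inE => /or3P [] /eqP ->; apply: HP.
      by rewrite !big_cons big_nil (cQ x (HQ x xH) xz xz') cy ct; have := c0 j; lra.
    have [/exists_inP [x' xH' /and3P [xz1 xz1' xx']]|/exists_inPn noX] :=
        boolP [exists x' in H, [&& x' != z, x' != z' & x != x']].
      exact: (done2 x x').
    have HE : H = [set y; x].
      apply/setP => w; rewrite !inE; apply/idP/idP; last first.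
        by move=> /orP [] /eqP ->; [move: yH|move: xH]; rewrite inE.
      move=> wH'; have wH : w \in H by rewrite inE.
      have := noX w wH; rewrite !negb_and !negbK => /or3P [E|E|/eqP ->]; last by rewrite eqxx orbT.
        have : w \in [set y; t] by rewrite yzE !inE E.
        by rewrite !inE => /orP [->//|/eqP Et]; rewrite Et (negPf tH) in wH.
      have : w \in [set y; t] by rewrite yzE !inE E orbT.
      by rewrite !inE => /orP [->//|/eqP Et]; rewrite Et (negPf tH) in wH.
    have xt : x != t.
      have : t \in [set z; z'] by rewrite -yzE !inE eqxx orbT.
      by rewrite !inE => /orP [] /eqP ->.
    have hjv := half_of_twin pQ tw1 tw2 yt hvv' jB jQ jv HE xy xt.
    case/andP: xyv => xv yv.
    apply: (two [:: x; y; v]); first by rewrite /= !inE negb_or xy xv yv.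
      move=> i; rewrite !inE => /or3P [] /eqP ->; [exact: HP|exact: HP|].
      by rewrite hs hjv andbT eq_sym.
    by rewrite !big_cons big_nil (cQ x (HQ x xH) xz xz') cy cv; have := c0 j; lra.
  have hu'u : hh u' u by rewrite hs.
  have z'z : z' != z by rewrite eq_sym.
  have done1z x : x \in H -> x != z -> x != z' -> z \in H ->
      1 <= c j + (\sum_(i | (i != j) && ~~ hh i j) c i) / 2.
    by move=> xH xz xz' zH; apply: (done1 x z z' u u').
  have done1z' x : x \in H -> x != z -> x != z' -> z' \in H ->
      1 <= c j + (\sum_(i | (i != j) && ~~ hh i j) c i) / 2.
    by move=> xH xz xz' zH; apply: (done1 x z' z u' u) => //; rewrite setUC.
  have [zH|zH] := boolP (z \in H); have [zH'|zH'] := boolP (z' \in H).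
  + have [/exists_inP [x xH /andP [xz xz']]|/exists_inPn noX] :=
        boolP [exists x in H, (x != z) && (x != z')]; first exact: (done1z x).
    have HE : H = [set z; z'].
      apply/setP => w; rewrite [RHS]inE !in_set1; apply/idP/idP => [wH|/orP [] /eqP -> //].
      by have := noX w wH; rewrite negb_and !negbK.
    (* The two centres make 4/3, and [some_half_twin] supplies a twin with the missing 2/3. *)
    have fin v : v \in [set u; u'] -> c v = 2%:R/3%:R -> v \notin Q -> v != j -> ~~ hh j v ->
        1 <= c j + (\sum_(i | (i != j) && ~~ hh i j) c i) / 2.
      move=> vuu cv vQ vj hjv.
      have zv : z != v by apply: contraNneq vQ => <-.
      have zv' : z' != v by apply: contraNneq vQ => <-.
      apply: (two [:: z; z'; v]); first by rewrite /= !inE negb_or zz' zv zv'.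
        move=> i; rewrite !inE => /or3P [] /eqP ->; [exact: HP|exact: HP|].
        by rewrite hs hjv andbT.
      by rewrite !big_cons big_nil cz cz' cv; lra.
    have /orP [h|h] := some_half_twin pQ tz tz' zz' huu' jB jQ ju ju' HE.
      by apply: (fin u) => //; rewrite ?inE ?eqxx // eq_sym.
    by apply: (fin u') => //; rewrite ?inE ?eqxx ?orbT // eq_sym.
  + have [x [y [xH yH xy]]] := NTW j jB jQ jT.
    have notz' w : w \in H -> w != z' by move=> wH; apply: contraTneq wH => ->.
    have [Ex|xz] := eqVneq x z; last by apply: (done1z x) => //; apply: notz'.
    by apply: (done1z y) => //; [rewrite eq_sym -Ex|apply: notz'].
  + have [x [y [xH yH xy]]] := NTW j jB jQ jT.
    have notz w : w \in H -> w != z by move=> wH; apply: contraTneq wH => ->.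
    have [Ex|xz] := eqVneq x z'; last by apply: (done1z' x) => //; apply: notz.
    by apply: (done1z' y) => //; [apply: notz|rewrite eq_sym -Ex].
  + have [x [y [xH yH xy]]] := NTW j jB jQ jT.
    have notz w : w \in H -> w != z by move=> wH; apply: contraTneq wH => ->.
    have notz' w : w \in H -> w != z' by move=> wH; apply: contraTneq wH => ->.
    by apply: (done2 x y) => //; [apply: notz|apply: notz'|apply: notz|apply: notz'].
- rewrite !big_split /= sumrN -!mulr_sumr !cardE Q5 !cards2 zz' uu' /=; lra.
Qed.

End Pentagon.

(** Clusters of type [Rt], collected in [K], have no red pair, so each uses one unit of the cap and
    leaves [5 - #|K|] for the remaining set [B]. The cases follow [#|K|] and the largest heavy
    clique of [B]. Six clusters arise when [#|K| = 1] and [B] has a heavy 5-clique, which is then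
    all of [B]; with [K] empty, such a clique is a pentagon. *)
Lemma reduced_clique (R : realFieldType) (I : finType) (rd fu : rel I) (Rt : pred I) (S : {set I}) :
  symmetric rd -> irreflexive rd -> symmetric fu -> irreflexive fu -> trifree rd S ->
  (forall i j, i \in S -> j \in S -> Rt i -> ~~ rd i j) ->
  (forall A F : {set I}, A \subset S -> F \subset A -> (forall i, i \in F -> ~~ Rt i) ->
     clique (nrd rd) A -> clique fu F -> (#|A| + #|F| <= 5)%N) ->
  let hT i j := (i != j) && [|| rd i j, fu i j, Rt i | Rt j] in
  copos (wform (83%:R / 100%:R : R) hT) S \/ #|S| = 6%N /\ clique hT S.
Proof.
move=> rs ri fs fi tf Rrd cap hT.
have hTs : symmetric hT.
  by move=> i j; rewrite /hT eq_sym rs fs [Rt i || _]orbC.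
have hTi : irreflexive hT by move=> i; rewrite /hT eqxx.
pose K := [set i in S | Rt i]; pose B := [set i in S | ~~ Rt i].
have KS : K \subset S by apply/subsetP => i; rewrite inE => /andP [].
have BS : B \subset S by apply/subsetP => i; rewrite inE => /andP [].
have SE : (#|S| = #|K| + #|B|)%N.
  rewrite -(cardsID K S); congr (_ + _)%N; congr #|pred_of_set _|.
    by apply/setIidPr.
  by apply/setP => i; rewrite !inE; case: (i \in S) => /=; rewrite ?andbT ?andbF.
have KB (A : {set I}) : A \subset B -> #|K :|: A| = (#|K| + #|A|)%N.
  move=> AB; rewrite cardsU (_ : K :&: A = set0) ?cards0 ?subn0 //.
  apply/setP => i; rewrite !inE; have [iA|] := boolP (i \in A); last by rewrite andbF.
  by have := subsetP AB i iA; rewrite inE => /andP [_ /negPf ->]; rewrite andbF.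
have capB : capped rd fu (5 - #|K|) B.
  move=> A F AB FA Ac Fc.
  have : (#|K :|: A| + #|F| <= 5)%N.
    apply: cap => //.
    - by rewrite subUset KS (subset_trans AB BS).
    - by apply: subset_trans FA _; apply: subsetUr.
    - by move=> i iF; have := subsetP AB i (subsetP FA i iF); rewrite inE => /andP [].
    - have KN i j : i \in K -> j \in S -> nrd rd i j.
        by rewrite inE => /andP [iS iR] jS; apply: Rrd.
      have AS := subset_trans AB BS.
      apply/cliqueP => i j; rewrite !in_setU => /orP [iK|iA] /orP [jK|jA] ij.
      + by apply: KN => //; apply: (subsetP KS).
      + by apply: KN => //; apply: (subsetP AS).
      + by rewrite (nrd_sym rs); apply: KN => //; apply: (subsetP AS).
      + by move/cliqueP: Ac; apply.
  by rewrite KB // -addnA => H; rewrite leq_subRL // (leq_trans _ H) // leq_addr.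
have K5 : (#|K| <= 5)%N.
  have := cap K set0 KS (sub0set _); rewrite cards0 addn0; apply.
  - by move=> i; rewrite inE.
  - by apply/cliqueP => i j; rewrite !inE => /andP [iS iR] /andP [jS _] _; apply: Rrd.
  - exact: clique0.
have tfB : trifree rd B := trifreeS BS tf.
have hB (P : {set I}) : P \subset S -> clique hT P -> clique (hrel rd fu) (P :&: B).
  move=> PS /cliqueP hP; apply/cliqueP => i j; rewrite !inE.
  move=> /andP [iP /andP [_ iR]] /andP [jP /andP [_ jR]] ij.
  by have := hP i j iP jP ij; rewrite /hT ij (negPf iR) (negPf jR) !orbF.
have Pcard (P : {set I}) : P \subset S -> (#|P| <= #|K| + #|P :&: B|)%N.
  move=> PS; rewrite -(cardsID B P) addnC leq_add2r; apply: subset_leq_card.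
  apply/subsetP => i; rewrite !inE => /andP [iB iP]; move: iB.
  by rewrite (subsetP PS i iP) /= negbK.
(* The threshold is [2 (1 - 83/100)]. *)
have fin (p m : nat) : (0 < p)%N -> (0 < m)%N ->
    (forall P : {set I}, P \subset B -> clique (hrel rd fu) P -> (#|K| + #|P| <= p)%N) ->
    (#|K| + #|B| <= m)%N -> 34%:R / 100%:R <= p%:R^-1 + m%:R^-1 :> R ->
    copos (wform (83%:R / 100%:R : R) hT) S \/ #|S| = 6%N /\ clique hT S.
  move=> p0 m0 Hp Hm Hpm; left; apply: (wform_bound (p := p) (m := m)) => //.
  - move=> P PS hP; apply: leq_trans (Pcard P PS) _.
    by apply: Hp; [apply: subsetIr|apply: hB].
  - by rewrite SE.
  - by move: Hpm; lra.
have ramB (c : nat) : (0 < c)%N -> (5 - #|K|)%N = c -> (#|B| <= ram c.-1)%N.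
  move=> c0 kc; rewrite kc in capB.
  apply: (ramsey3 rs ri tfB) => A AB Ac.
  exact: (capped_indep _ capB).
have ramP (c : nat) : (5 - #|K|)%N = c ->
    forall P : {set I}, P \subset B -> clique (hrel rd fu) P -> (#|P| <= ram c./2)%N.
  by move=> kc P PB hP; rewrite kc in capB; apply: (capped_hclique rs ri tfB capB PB hP).
have exact_clique (P : {set I}) n : P \subset B -> clique (hrel rd fu) P -> (n <= #|P|)%N ->
    exists P' : {set I}, [/\ P' \subset B, clique (hrel rd fu) P' & #|P'| = n].
  move=> PB hP nP.
  have : [set A : {set I} | A \subset P & #|A| == n] != set0.
    by rewrite -cards_eq0 cards_draws -lt0n bin_gt0.
  case/set0Pn => A; rewrite inE => /andP [AP /eqP An].
  by exists A; split=> //; [apply: subset_trans PB|apply: cliqueS hP].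
have bigc n : (forall P : {set I}, P \subset B -> clique (hrel rd fu) P -> (#|P| <= n)%N) \/
    exists P : {set I}, [/\ P \subset B, clique (hrel rd fu) P & #|P| = n.+1].
  have [/existsP [P /and3P [PB hP nP]]|/existsPn H] :=
    boolP [exists P : {set I}, [&& P \subset B, clique (hrel rd fu) P & n < #|P|]%N].
    by right; apply: exact_clique nP.
  by left=> P PB hP; have := H P; rewrite PB hP /= -leqNgt.
case E : #|K| K5 => [|[|[|[|[|[|k]]]]]] // _.
- have B14 : (#|B| <= 14)%N by apply: (ramB 5) => //; rewrite E.
  have B5 := ramP 5%N; rewrite E in B5; have {}B5 := B5 erefl.
  rewrite E in capB.
  have [B4|[Q [QB hQ Q5]]] := bigc 4%N; last first.
    left; have SB : S = B.
      apply/eqP; rewrite eq_sym eqEcard BS SE E leqnn //.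
    have hTE i j : i \in B -> j \in B -> hT i j = hrel rd fu i j.
      rewrite !inE => /andP [_ iR] /andP [_ jR].
      rewrite /hT /hrel (negPf iR) (negPf jR) !orbF.
      by have [->|//] := eqVneq i j; rewrite ri fi.
    rewrite SB.
    suff : copos (wform (83%:R / 100%:R : R) (hrel rd fu)) B.
      by apply: copos_le => i j iB jB; rewrite /wform hTE.
    have hP (P : {set I}) : P \subset B -> clique (hrel rd fu) P -> (#|P| <= 5)%N := B5 P.
    (* The pentagon certificate presupposes all proper subsets, so the bound is proved for every
       subset of [B], by induction on its size. *)
    move: {-2}B (subxx B) => C; move: {2}#|C|.+1 (ltnSn #|C|) => n.
    elim: n C => // n IH C Cn CB.
    have hs : symmetric (hrel rd fu) by move=> i j; rewrite /hrel rs fs.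
    have hi : irreflexive (hrel rd fu) by move=> i; rewrite /hrel ri fi.
    have capC : capped rd fu 5 C by move=> A F AC; apply: capB; apply: subset_trans CB.
    have tfC := trifreeS CB tfB.
    have [/existsP [P /and3P [PC hPC /eqP P5]]|/existsPn no5] :=
      boolP [exists P : {set I}, [&& P \subset C, clique (hrel rd fu) P & #|P| == 5%N]].
      apply: (pentagon_copos rs ri fs fi tfC capC (Q := P)) => // S' S'C.
      apply: IH; first by apply: leq_trans (proper_card S'C) _.
      exact: subset_trans (proper_sub S'C) CB.
    have C4 (P : {set I}) : P \subset C -> clique (hrel rd fu) P -> (#|P| <= 4)%N.
      move=> PC hPC; have := hP P (subset_trans PC CB) hPC.
      by rewrite leq_eqVlt => /orP [P5|//]; have := no5 P; rewrite PC hPC P5.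
    have [/existsP [P /and3P [PC hPC /eqP P4]]|/existsPn no4] :=
      boolP [exists P : {set I}, [&& P \subset C, clique (hrel rd fu) P & #|P| == 4%N]].
      apply: (wform_bound (p := 4) (m := 11)) => //; last by lra.
      exact: (hclique4_card rs ri fs tfC capC PC hPC P4).
    apply: (wform_bound (p := 3) (m := 14)) => //; last by lra.
      move=> P PC hPC; have := C4 P PC hPC.
      by rewrite leq_eqVlt => /orP [P4|//]; have := no4 P; rewrite PC hPC P4.
    exact: leq_trans (subset_leq_card CB) B14.
  have [B3|[P [PB hP P4]]] := bigc 3%N.
    apply: (fin 3%N 14%N); rewrite ?E //; last by lra.
  apply: (fin 4%N 11%N); rewrite ?E //; last by lra.
  exact: (hclique4_card rs ri fs tfB capB PB hP P4).
- have B9 : (#|B| <= 9)%N by apply: (ramB 4) => //; rewrite E.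
  have B5 := ramP 4%N; rewrite E in B5; have {}B5 := B5 erefl.
  rewrite E in capB.
  have [B4|[Q [QB hQ Q5]]] := bigc 4%N; last first.
    right; have BQ := capped4_hclique5 rs ri fs tfB capB QB hQ Q5.
    split; first by rewrite SE E BQ Q5.
    apply/cliqueP => i j iS jS ij; rewrite /hT ij /=.
    have [iR|iR] := boolP (Rt i); first by rewrite !orbT.
    have [jR|jR] := boolP (Rt j); first by rewrite !orbT.
    have [iB jB] : i \in B /\ j \in B by rewrite !inE iS jS.
    by rewrite !orbF; move/cliqueP: hQ; apply; rewrite // -BQ.
  have [B3|[P [PB hP P4]]] := bigc 3%N.
    by apply: (fin 4%N 10%N); rewrite ?E //; lra.
  apply: (fin 5%N 7%N); rewrite ?E //; last by lra.
  exact: (capped4_hclique4 rs ri fs tfB capB PB hP P4).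
- have B5 : (#|B| <= 5)%N by apply: (ramB 3) => //; rewrite E.
  have P2 := ramP 3%N; rewrite E in P2; have {}P2 := P2 erefl.
  by apply: (fin 4%N 7%N); rewrite ?E //; lra.
- have B2 : (#|B| <= 2)%N by apply: (ramB 2) => //; rewrite E.
  have P2 := ramP 2%N; rewrite E in P2; have {}P2 := P2 erefl.
  by apply: (fin 5%N 5%N); rewrite ?E //; lra.
- have B0 : (#|B| <= 0)%N by apply: (ramB 1) => //; rewrite E.
  have P2 := ramP 1%N; rewrite E in P2; have {}P2 := P2 erefl.
  apply: (fin 5%N 5%N); rewrite ?E //; last by lra.
  - by move=> P PB hP; have := P2 P PB hP; rewrite leqn0 => /eqP ->.
  - by move: B0; rewrite leqn0 => /eqP ->.
- have P2 := ramP 0%N; rewrite E in P2; have {}P2 := P2 erefl.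
  have B0 : (#|B| <= 0)%N.
    rewrite leqn0 cards_eq0; apply/eqP/setP => i; rewrite in_set0; apply/negbTE/negP => iB.
    have : (#|[set i]| <= 0)%N by apply: P2; [rewrite sub1set|apply: clique1].
    by rewrite cards1.
  apply: (fin 5%N 5%N); rewrite ?E //; last by lra.
Qed.

(** * The reduced graph *)

Lemma ecount_sym (T : finType) (E : rel T) (X Y : {set T}) : symmetric E ->
  ecount E X Y = ecount E Y X.
Proof.
move=> Es.
have e (A B : {set T}) : ecount E A B = (\sum_(x in A) \sum_(y in B) E x y)%N.
  apply: eq_bigr => x _; rewrite -sum1_card big_mkcond [RHS]big_mkcond /=.
  by apply: eq_bigr => y _; rewrite inE; case: (y \in B); case: (E x y).
rewrite !e exchange_big; apply: eq_bigr => y _; apply: eq_bigr => x _.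
by rewrite Es.
Qed.

Lemma subset_pair_of_size (T : finType) (A F : {set T}) (n : nat) :
  F \subset A -> (n <= #|A| + #|F|)%N ->
  exists A' F' : {set T}, [/\ A' \subset A, F' \subset F, F' \subset A' & (#|A'| + #|F'| = n)%N].
Proof.
move=> FA nAF.
have sub (P : {set T}) k : (k <= #|P|)%N -> exists P' : {set T}, P' \subset P /\ #|P'| = k.
  move=> kP; have : [set Q : {set T} | Q \subset P & #|Q| == k] != set0.
    by rewrite -cards_eq0 cards_draws -lt0n bin_gt0.
  by case/set0Pn => Q; rewrite inE => /andP [QP /eqP Qk]; exists Q.
have [nA|nA] := leqP n #|A|.
  have [A' [A'A A'n]] := sub A n nA.
  by exists A', set0; rewrite cards0 addn0 !sub0set.
have [F' [F'F F'n]] : exists P' : {set T}, P' \subset F /\ #|P'| = (n - #|A|)%N.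
  by apply: sub; rewrite leq_subLR.
exists A, F'; split=> //; first exact: subset_trans FA.
by rewrite F'n subnKC // ltnW.
Qed.

Section Reduced.
Variables (R : realFieldType) (T K : finType) (f : T -> K) (rdE blE : rel T).
Variables (d e1 eps M : R).
Hypotheses (rs : symmetric rdE) (bs : symmetric blE).
Hypotheses (ri : irreflexive rdE) (bi : irreflexive blE).
Hypothesis rb : forall x y, rdE x y -> ~~ blE x y.
Hypotheses (d0 : 0 < d) (d1 : d <= 1) (e1E : e1 = d ^+ 6 / 7%:R) (epsE : eps = e1 ^+ 2).
Hypotheses (M0 : 0 < M) (T0 : (0 < #|T|)%N).
Hypothesis alphaT : forall Y : {set T}, e1 ^+ 2 * (d * #|T|%:R / M) <= #|Y|%:R ->
  exists x y, [/\ x \in Y, y \in Y & rdE x y || blE x y].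
Hypothesis noK3 : forall P : {set T}, clique rdE P -> #|P| != 3%N.
Hypothesis noK6 : forall P : {set T}, clique blE P -> #|P| != 6%N.

Let V := class f.

Let e1_gt0 : 0 < e1. Proof. by rewrite e1E divr_gt0 ?exprn_gt0 // ltr0n. Qed.
Let e1_led : e1 <= d.
Proof.
rewrite e1E; have : d ^+ 6 <= d.
  by rewrite exprS -[X in _ <= X]mulr1 ler_pM2l // exprn_ile1 // ltW.
have : 0 <= d ^+ 6 by rewrite exprn_ge0 // ltW.
by lra.
Qed.
Let e1_le1 : e1 <= 1. Proof. exact: le_trans e1_led d1. Qed.
Let eps_led : eps <= d.
Proof.
rewrite epsE expr2; apply: le_trans e1_led.
by rewrite -[X in _ <= X]mulr1 ler_pM2l.
Qed.

(** [M] will bound the number of clusters, so that the clusters failing this hold at most [d * #|T|]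
    vertices in all. *)
Definition big_class i := d * #|T|%:R <= #|V i|%:R * M.

Definition good_pair i j := [&& i != j, big_class i, big_class j,
   regular rdE eps (V i) (V j) && regular rdE eps (V j) (V i) &
   regular blE eps (V i) (V j) && regular blE eps (V j) (V i)].

Definition rdK i j := good_pair i j && (2 * d <= density R rdE (V i) (V j)).
Definition blK i j := good_pair i j && (2 * d <= density R blE (V i) (V j)).
(* Above density 1/2, two adjacent vertices of one cluster still have many
   common neighbours in the other: such pairs are full. *)
Definition fuK i j := good_pair i j && (1 / 2 + 2 * d <= density R blE (V i) (V j)).

Lemma good_pair_sym : symmetric good_pair.
Proof.
move=> i j; rewrite /good_pair eq_sym; congr (_ && _).
by rewrite andbCA; do 2 congr (_ && _); congr (_ && _); rewrite andbC.
Qed.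

Lemma density_sym (E : rel T) X Y : symmetric E -> density R E X Y = density R E Y X.
Proof. by move=> Es; rewrite /density ecount_sym // [#|X|%:R * _]mulrC. Qed.

Lemma rdK_sym : symmetric rdK.
Proof. by move=> i j; rewrite /rdK good_pair_sym density_sym. Qed.
Lemma blK_sym : symmetric blK.
Proof. by move=> i j; rewrite /blK good_pair_sym [density _ blE _ _]density_sym. Qed.
Lemma fuK_sym : symmetric fuK.
Proof. by move=> i j; rewrite /fuK good_pair_sym [density _ blE _ _]density_sym. Qed.
Lemma good_pair_irr : irreflexive good_pair.
Proof. by move=> i; rewrite /good_pair eqxx. Qed.
Lemma rdK_irr : irreflexive rdK.
Proof. by move=> i; rewrite /rdK good_pair_irr. Qed.
Lemma blK_irr : irreflexive blK.
Proof. by move=> i; rewrite /blK good_pair_irr. Qed.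
Lemma fuK_irr : irreflexive fuK.
Proof. by move=> i; rewrite /fuK good_pair_irr. Qed.

Definition red_edge (Y : {set T}) := [exists x in Y, exists y in Y, rdE x y].

Definition red_type i := [forall Y : {set T},
  ((Y \subset V i) && (e1 * #|V i|%:R <= #|Y|%:R)) ==> red_edge Y].

(** The default [set0] is never taken, as [coreP] shows. In a big cluster, every large subset of the
    core spans a red edge if the cluster is of red type and a blue edge otherwise. *)
Definition core i := if red_type i then V i else
  odflt set0 [pick Y : {set T} | [&& Y \subset V i, e1 * #|V i|%:R <= #|Y|%:R & ~~ red_edge Y]].

Lemma coreP i : [/\ core i \subset V i, e1 * #|V i|%:R <= #|core i|%:R &
  ~~ red_type i -> ~~ red_edge (core i)].
Proof.
rewrite /core; have [iR|iR] := boolP (red_type i).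
  split=> //; rewrite -[X in _ <= X]mul1r; exact: ler_wpM2r.
case: pickP => [Y /and3P [h1 h2 h3] //|H].
move: iR => /negP []; apply/forallP => Y; apply/implyP => /andP [YV cY].
by have := H Y; rewrite YV cY /= => /negbFE.
Qed.

Lemma big_gt0 i : big_class i -> 0 < #|V i|%:R :> R.
Proof.
rewrite /big_class => H; rewrite -(pmulr_lgt0 _ M0); apply: lt_le_trans H.
by rewrite mulr_gt0 // ltr0n.
Qed.

Lemma core_gt0 i : big_class i -> (0 < #|core i|)%N.
Proof.
move=> ib; have [_ c _] := coreP i; rewrite -(ltr_nat R); apply: lt_le_trans c.
by rewrite mulr_gt0 // big_gt0.
Qed.

Lemma core_edge i (Y : {set T}) : big_class i -> Y \subset core i -> e1 * #|core i|%:R <= #|Y|%:R ->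
  exists x y, [/\ x \in Y, y \in Y & rdE x y || blE x y].
Proof.
move=> ib YU cY; apply: alphaT; have [_ c _] := coreP i.
apply: le_trans cY; rewrite expr2 -mulrA ler_pM2l //.
apply: le_trans c; rewrite ler_pM2l // ler_pdivrMr //.
Qed.

(** The choice [eps = e1 ^+ 2] is made for this: an [e1] share of a core, itself an [e1] share of
    its cluster, is still an [eps] share of the cluster. *)
Lemma lreg_core (E : rel T) i j (a : R) : regular E eps (V i) (V j) ->
  a + eps <= density R E (V i) (V j) -> lreg E e1 a (core i) (core j).
Proof.
move=> reg ad X Y XU YU cX cY.
have [Ui ci _] := coreP i; have [Uj cj _] := coreP j.
have cc k (Z : {set T}) : e1 * #|V k|%:R <= #|core k|%:R -> e1 * #|core k|%:R <= #|Z|%:R ->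
    eps * #|V k|%:R <= #|Z|%:R.
  move=> h1; apply: le_trans; rewrite epsE expr2 -mulrA ler_pM2l //.
move/forallP: reg => /(_ X) /forallP /(_ Y) /implyP.
rewrite (subset_trans XU Ui) (subset_trans YU Uj) !cc // => /(_ isT).
rewrite ler_norml => /andP [H _].
set N := #|X|%:R * #|Y|%:R in H *.
have N0 : 0 <= N by rewrite mulr_ge0.
have := ler_wpM2r N0 ad; rewrite mulrDl; lra.
Qed.

Lemma cardP6 (P : {set T}) : clique blE P -> #|P| = 6%N -> False.
Proof. by move=> /noK6 /eqP. Qed.

(** The value [d ^+ 6 / 7] of [e1] is what [embed] requires for six clusters starting from
    [kappa = 1]. *)
Let size_cond n : (n <= 6)%N -> n.+1%:R * e1 <= 1 * d ^+ n.
Proof.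
move=> n6; rewrite mul1r e1E.
have h1 : n.+1%:R <= 7%:R :> R by rewrite ler_nat.
have h2 : d ^+ 6 <= d ^+ n by apply: ler_wiXn2l => //; apply: ltW.
have h3 : 0 <= d ^+ 6 by rewrite exprn_ge0 // ltW.
apply: le_trans h2; rewrite mulrCA -[X in _ <= X]mulr1 ler_wpM2l //.
rewrite ler_pdivrMr ?ltr0n // mul1r //.
Qed.

Let good_big i j : good_pair i j -> [/\ i != j, big_class i & big_class j].
Proof. by case/and5P. Qed.

Let rd_lreg i j : rdK i j -> lreg rdE e1 d (core i) (core j).
Proof.
case/andP => /and5P [_ _ _ /andP [r _] _] h; apply: lreg_core => //.
by move: h eps_led; lra.
Qed.

Let bl_lreg i j : blK i j -> lreg blE e1 d (core i) (core j).
Proof.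
case/andP => /and5P [_ _ _ _ /andP [r _]] h; apply: lreg_core => //.
by move: h eps_led; lra.
Qed.

Let fu_lreg i j : fuK i j -> lreg blE e1 ((1 + d) / 2) (core i) (core j).
Proof.
case/andP => /and5P [_ _ _ _ /andP [r _]] h; apply: lreg_core => //.
by move: h eps_led d0; lra.
Qed.

Let core_self s : forall i, i \in (s : seq K) -> core i \subset core i /\ 1 * #|core i|%:R <= #|core i|%:R :> R.
Proof. by move=> i _; rewrite mul1r. Qed.

Lemma rdK_trifree S : trifree rdK S.
Proof.
move=> i j k _ _ _ rij rjk; apply/negP => rik.
have [/good_big [ij bi' bj'] /good_big [jk _ bk'] /good_big [ik _ _]] :
  [/\ good_pair i j, good_pair j k & good_pair i k].
  by split; [case/andP: rij|case/andP: rjk|case/andP: rik].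
have mem3 x : x \in [:: i; j; k] ++ [::] -> [|| x == i, x == j | x == k] by rewrite !inE.
have [|||||||P [Pc P3 _]] := @embed R T K rdE e1 d core [:: i; j; k] [::] rs ri e1_gt0 d0 d1 _ _ _ _ _ 1 core.
- by rewrite /= !inE negb_or ij ik jk.
- by move=> x /mem3 /or3P [] /eqP ->; apply: core_gt0.
- move=> x y /mem3 /or3P [] /eqP -> /mem3 /or3P [] /eqP ->; rewrite ?eqxx // => _;
    by apply: rd_lreg; rewrite // rdK_sym.
- by [].
- by [].
- exact: size_cond.
- exact: core_self.
by have := noK3 Pc; rewrite P3.
Qed.

(** A red edge inside the cluster [i] and a vertex of [j] would form a red triangle. *)
Lemma red_type_no_red i j : red_type i -> ~~ rdK i j.
Proof.
move=> iR; apply/negP => rij.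
have /good_big [ij bi' bj'] : good_pair i j by case/andP: rij.
have mem2 x : x \in [:: j] ++ [:: i] -> (x == j) || (x == i) by rewrite !inE.
have [|||||||P [Pc P3 _]] := @embed R T K rdE e1 d core [:: j] [:: i] rs ri e1_gt0 d0 d1 _ _ _ _ _ 1 core.
- by rewrite /= !inE eq_sym ij.
- by move=> x /mem2 /orP [] /eqP ->; apply: core_gt0.
- move=> x y /mem2 /orP [] /eqP -> /mem2 /orP [] /eqP ->; rewrite ?eqxx // => _;
    by apply: rd_lreg; rewrite // rdK_sym.
- by move=> x y; rewrite !inE => /eqP -> /eqP ->; rewrite eqxx.
- move=> x Y; rewrite inE => /eqP -> YU cY.
  move: (iR) => /forallP /(_ Y); rewrite /core iR in YU cY.
  rewrite YU cY => /implyP /(_ isT) /exists_inP [a aY /exists_inP [b bY ab]].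
  by exists a, b.
- exact: size_cond.
- exact: core_self.
by have := noK3 Pc; rewrite P3.
Qed.

(** The clusters in [A] are pairwise blue. Trimmed to [#|A'| + #|F'| = 6], they would give a blue
    [K_6]: a vertex from each member of [A' :\: F'] and a blue edge in the core of each member of
    [F']. *)
Lemma reduced_capped (S A F : {set K}) :
  (forall i j, i \in S -> j \in S -> i != j -> rdK i j || blK i j) ->
  A \subset S -> F \subset A -> (forall i, i \in F -> ~~ red_type i) ->
  clique (nrd rdK) A -> clique fuK F -> (#|A| + #|F| <= 5)%N.
Proof.
move=> Sc AS FA FB Ac Fc; rewrite leqNgt; apply/negP => AF6.
have [A' [F' [A'A F'F F'A' E6]]] := subset_pair_of_size FA AF6.
have blA i j : i \in A' -> j \in A' -> i != j -> blK i j.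
  move=> iA jA ij; have iA' := subsetP A'A i iA; have jA' := subsetP A'A j jA.
  have := Sc i j (subsetP AS i iA') (subsetP AS j jA') ij.
  by move/cliqueP: Ac => /(_ i j iA' jA' ij); rewrite /nrd => /negPf ->.
have A3 : (3 <= #|A'|)%N by have := subset_leq_card F'A'; move: E6; clear; lia.
have A6 : (#|A'| <= 6)%N by rewrite -E6 leq_addr.
have bigA i : i \in A' -> big_class i.
  move=> iA; have [j] : exists j, j \in A' :\ i.
    by apply/card_gt0P; move: A3; rewrite (cardsD1 i) iA add1n ltnS; apply: leq_trans.
  rewrite !inE => /andP [ji jA].
  have ij : i != j by rewrite eq_sym.
  by case/andP: (blA i j iA jA ij) => /good_big [].
pose s1 := enum (A' :\: F'); pose s2 := enum F'.
have mem12 x : x \in s1 ++ s2 -> x \in A'.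
  rewrite mem_cat !mem_enum inE => /orP [/andP [] //|]; exact: (subsetP F'A').
have sz : size (s1 ++ s2) = #|A'|.
  by rewrite size_cat -!cardE -(cardsID F' A') (setIidPr F'A') addnC.
have [|||||||P [Pc P6 _]] := @embed R T K blE e1 d core s1 s2 bs bi e1_gt0 d0 d1 _ _ _ _ _ 1 core.
- rewrite cat_uniq !enum_uniq /= andbT; apply/hasPn => x; rewrite !mem_enum !inE => ->.
  by [].
- by move=> i /mem12 /bigA; apply: core_gt0.
- by move=> i j /mem12 iA /mem12 jA ij; apply: bl_lreg; apply: blA.
- move=> i j; rewrite !mem_enum => iF jF ij; apply: fu_lreg.
  by move/cliqueP: Fc; apply => //; apply: (subsetP F'F).
- move=> i Y; rewrite mem_enum => iF YU cY.
  have [x [y [xY yY xy]]] := core_edge (bigA i (subsetP F'A' i iF)) YU cY.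
  exists x, y; split=> //; have [_ _ /(_ (FB i (subsetP F'F i iF))) noR] := coreP i.
  case/orP: xy => // rxy; case/negP: noR.
  by apply/exists_inP; exists x; rewrite ?(subsetP YU) //; apply/exists_inP; exists y; rewrite ?(subsetP YU).
- by rewrite sz; apply: size_cond.
- exact: core_self.
apply: (cardP6 Pc); rewrite P6 -!cardE -E6 -(cardsID F' A') (setIidPr F'A').
by move: #|_ :\: _| #|F'| => a b; clear; lia.
Qed.

(** The error is largest with red below [2 d] and blue below [1/2 + 2 d], or with both colours below
    [2 d]; either way it is [4 d]. *)
Lemma cluster_density i j : good_pair i j ->
  (ecount rdE (V i) (V j) + ecount blE (V i) (V j))%:R <=
   ((if rdK i j || blK i j then
       if (i != j) && [|| rdK i j, fuK i j, red_type i | red_type j] then 1 else 1 / 2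
     else 0) + 4%:R * d) * (#|V i|%:R * #|V j|%:R).
Proof.
move=> g; have /good_big [ij bi' bj'] := g.
have N0 : 0 < #|V i|%:R * #|V j|%:R :> R by rewrite mulr_gt0 // big_gt0.
have eE (E : rel T) : (ecount E (V i) (V j))%:R = density R E (V i) (V j) * (#|V i|%:R * #|V j|%:R).
  by rewrite /density divfK // gt_eqF.
have tot : density R rdE (V i) (V j) + density R blE (V i) (V j) <= 1.
  rewrite /density -mulrDl ler_pdivrMr // mul1r -natrD -natrM ler_nat.
  rewrite /ecount -big_split /= -sum_nat_const; apply: leq_sum => x _.
  rewrite -cardsUI (_ : _ :&: _ = set0).
    rewrite cards0 addn0; apply: subset_leq_card; apply/subsetP => y.
    by rewrite !inE => /orP [] /andP [].
  apply/setP => y; rewrite !inE; have [xy|] := boolP (rdE x y); last by rewrite andbF.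
  by rewrite (negPf (rb xy)) !andbF.
rewrite natrD !eE -mulrDl ler_pM2r // ij /=.
rewrite /rdK /blK /fuK g /=.
move: tot; set a := density _ _ _ _; set b := density _ _ _ _ => tot.
case: (leP (2 * d) a) => ha /=; first by move: tot ha d0; lra.
case: (leP (2 * d) b) => hb /=; last by move: ha hb d0; lra.
case: (leP (1/2 + 2 * d) b) => hc /=; first by move: tot d0; lra.
by case: ifP => _; move: tot ha hc d0; lra.
Qed.

End Reduced.

Lemma sum_pairs_fibres (R : realFieldType) (T K : finType) (g : T -> K) (F : K -> K -> R) :
  \sum_(p : T * T) F (g p.1) (g p.2) = \sum_k \sum_l F k l * #|class g k|%:R * #|class g l|%:R.
Proof.
rewrite (partition_big (pairmap g) predT) //= pair_bigA /=; apply: eq_bigr => -[k l] _ /=.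
rewrite (eq_bigr (fun=> F k l)); last by move=> p /eqP [-> ->].
rewrite (eq_bigl (fun p => (p.1 \in class g k) && (p.2 \in class g l))).
  by rewrite sum_pairs_const mulrA.
by move=> p; rewrite !inE.
Qed.

Lemma card_modn_class (n m a : nat) :
  (#|[set k : 'I_n | k %% m.+1 == a]| <= n %/ m.+1 + 1)%N.
Proof.
have hE (k : 'I_n) : nat_of_ord (inord (k %/ m.+1)%N : 'I_(n %/ m.+1)%N.+1) = (k %/ m.+1)%N.
  by rewrite inordK // ltnS leq_div2r // ltnW.
rewrite addn1 -[X in (_ <= X)%N]card_ord.
have inj : {in [set k : 'I_n | (k %% m.+1)%N == a] &,
    injective (fun k : 'I_n => inord (k %/ m.+1)%N : 'I_(n %/ m.+1)%N.+1)}.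
  move=> k k'; rewrite !inE => /eqP ka /eqP ka' /(congr1 (@nat_of_ord _)).
  rewrite !hE => E; apply/val_inj; rewrite /= (divn_eq k m.+1) (divn_eq k' m.+1).
  by rewrite ka ka' E.
by rewrite -(card_in_imset inj); apply: max_card.
Qed.

(** The initial partition for [regularity]: it keeps every cluster small, so that few pairs of
    vertices fall inside one cluster. *)
Lemma balanced_labelling (T : finType) (m : nat) : exists f0 : T -> 'I_m.+1,
  forall a, (#|[set x | f0 x == a]| <= #|T| %/ m.+1 + 1)%N.
Proof.
exists (fun x => inord (enum_rank x %% m.+1)%N) => a.
apply: leq_trans (card_modn_class #|T| m a).
rewrite -(card_imset _ (@enum_rank_inj T)); apply: subset_leq_card.
apply/subsetP => k /imsetP [x]; rewrite inE => /eqP xa ->.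
by rewrite inE -xa inordK // ltn_mod.
Qed.

Lemma negb_and5_le (R : realFieldType) (a b c a1 a2 b1 b2 : bool) :
  (~~ [&& a, b, c, a1 && a2 & b1 && b2])%:R <=
   (~~ a)%:R + ((~~ b)%:R + (~~ c)%:R) + ((~~ a1)%:R + (~~ a2)%:R + ((~~ b1)%:R + (~~ b2)%:R)) :> R.
Proof.
rewrite -!natrD ler_nat.
by case: a; case: b; case: c; case: a1; case: a2; case: b1; case: b2.
Qed.

Lemma sum_swap (R : realFieldType) (T : finType) (F : T -> T -> R) :
  \sum_(p : T * T) F p.1 p.2 = \sum_(p : T * T) F p.2 p.1.
Proof. by rewrite -(pair_bigA _ (fun x y => F x y)) exchange_big pair_bigA. Qed.

Lemma sum_fst (R : realFieldType) (T : finType) (F : T -> R) :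
  \sum_(p : T * T) F p.1 = #|T|%:R * \sum_x F x.
Proof.
rewrite -(pair_bigA _ (fun x (y : T) => F x)) /= mulr_sumr; apply: eq_bigr => x _.
by rewrite sumr_const mulr_natl.
Qed.

(** * From a regular partition to six labels *)

Section Structure.
Variables (R : realFieldType) (T K : finType) (f : T -> K) (rdE blE : rel T).
Variables (d e1 eps M : R) (m : nat) (f0 : T -> 'I_m.+1) (r : K -> 'I_m.+1).
Hypotheses (rs : symmetric rdE) (bs : symmetric blE).
Hypotheses (ri : irreflexive rdE) (bi : irreflexive blE).
Hypothesis rb : forall x y, rdE x y -> ~~ blE x y.
Hypotheses (d0 : 0 < d) (d1 : d <= 1) (e1E : e1 = d ^+ 6 / 7%:R) (epsE : eps = e1 ^+ 2).
Hypotheses (M0 : 0 < M) (T0 : (0 < #|T|)%N) (KM : #|K|%:R <= M).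
Hypothesis alphaT : forall Y : {set T}, e1 ^+ 2 * (d * #|T|%:R / M) <= #|Y|%:R ->
  exists x y, [/\ x \in Y, y \in Y & rdE x y || blE x y].
Hypothesis noK3 : forall P : {set T}, clique rdE P -> #|P| != 3%N.
Hypothesis noK6 : forall P : {set T}, clique blE P -> #|P| != 6%N.
Hypothesis f0r : forall x, f0 x = r (f x).
Hypothesis f0b : forall a, (#|[set x | f0 x == a]| <= #|T| %/ m.+1 + 1)%N.
Hypotheses (mT : 1 <= d * #|T|%:R) (md : 1 <= d * m.+1%:R).
Hypothesis regR : \sum_(p : T * T) (~~ regular rdE eps (class f (f p.1)) (class f (f p.2)))%:R
         <= eps * #|T|%:R ^+ 2.
Hypothesis regB : \sum_(p : T * T) (~~ regular blE eps (class f (f p.1)) (class f (f p.2)))%:R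
         <= eps * #|T|%:R ^+ 2.

Let good := good_pair f rdE blE d eps M.
Let rd := rdK f rdE blE d eps M.
Let bl := blK f rdE blE d eps M.
Let fu := fuK f rdE blE d eps M.
Let rt := red_type f rdE e1.
Let hT i j := (i != j) && [|| rd i j, fu i j, rt i | rt j].
Let w i j : R := if rd i j || bl i j then (if hT i j then 1 else 1 / 2) else 0.
Let n : R := #|T|%:R.
Let G (p : T * T) : R := (rdE p.1 p.2 || blE p.1 p.2)%:R.

Let n_gt0 : 0 < n. Proof. by rewrite ltr0n. Qed.

(** The eight is 2 for pairs inside a cluster, 1 for each coordinate in a small cluster, and 1 for
    irregularity in each colour and each order, as [eps <= d]. *)
Lemma not_good_count : \sum_(p : T * T) (~~ good (f p.1) (f p.2))%:R <= 8%:R * d * n ^+ 2.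
Proof.
have eps_d : eps <= d.
  have e1d : e1 <= d.
    rewrite e1E; have : d ^+ 6 <= d.
      by rewrite exprS -[X in _ <= X]mulr1 ler_pM2l // exprn_ile1 // ltW.
    have : 0 <= d ^+ 6 by rewrite exprn_ge0 // ltW.
    by lra.
  have e10 : 0 <= e1 by rewrite e1E divr_ge0 // exprn_ge0 // ltW.
  rewrite epsE expr2; apply: le_trans (e1d).
  by rewrite -[X in _ <= X]mulr1 ler_wpM2l // (le_trans e1d d1).
pose small x : R := (~~ big_class f d M (f x))%:R.
have smallb : \sum_x small x <= d * n.
  have -> : \sum_x small x = \sum_(i | ~~ big_class f d M i) #|class f i|%:R.
    rewrite (partition_big f predT) //= [RHS]big_mkcond; apply: eq_bigr => i _.
    rewrite (eq_bigr (fun=> (~~ big_class f d M i)%:R)); last by move=> x /eqP <-.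
    rewrite sumr_const cardsE; case: (big_class _ _ _ _) => /=; first by rewrite mul0rn.
    by [].
  rewrite -(ler_pM2r M0) mulr_suml.
  apply: le_trans (_ : \sum_(i : K) d * n <= _).
    rewrite big_mkcond; apply: ler_sum => i _; case: ifP => [|_].
      by rewrite /big_class -ltNge => /ltW.
    by rewrite mulr_ge0 // ltW.
  rewrite sumr_const -[X in X <= _]mulr_natr ler_pM2l ?mulr_gt0 //.
have diag : \sum_(p : T * T) (f p.1 == f p.2)%:R <= 2 * d * n ^+ 2.
  rewrite -(pair_bigA _ (fun x y => (f x == f y)%:R)) /=.
  apply: le_trans (_ : \sum_(x : T) 2 * d * n <= _).
    apply: ler_sum => x _.
    have -> : \sum_y (f x == f y)%:R = #|[set y | f x == f y]|%:R :> R.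
      by rewrite -sum1_card natr_sum [RHS]big_mkcond; apply: eq_bigr => y _; rewrite inE; case: ifP.
    apply: le_trans (_ : (#|T| %/ m.+1 + 1)%:R <= _).
      rewrite ler_nat; apply: leq_trans (f0b (f0 x)); apply: subset_leq_card.
      by apply/subsetP => y; rewrite !inE !f0r => /eqP ->.
    have : (#|T| %/ m.+1)%:R * m.+1%:R <= n by rewrite -natrM ler_nat leq_trunc_div.
    set q := (_ %/ _)%:R => qm.
    have q0 : 0 <= q by [].
    have h1 : q <= q * (d * m.+1%:R) by rewrite -[X in X <= _]mulr1 ler_wpM2l.
    have h2 : q * (d * m.+1%:R) <= d * n.
      by rewrite mulrCA ler_pM2l.
    rewrite natrD; move: mT; rewrite -/n -/q; lra.
  rewrite sumr_const -[X in X <= _]mulr_natr -/n; lra.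
apply: le_trans (_ : \sum_(p : T * T) ((f p.1 == f p.2)%:R + (small p.1 + small p.2) +
    ((~~ regular rdE eps (class f (f p.1)) (class f (f p.2)))%:R +
     (~~ regular rdE eps (class f (f p.2)) (class f (f p.1)))%:R +
    ((~~ regular blE eps (class f (f p.1)) (class f (f p.2)))%:R +
     (~~ regular blE eps (class f (f p.2)) (class f (f p.1)))%:R))) <= _).
  apply: ler_sum => p _; rewrite /good /good_pair.
  by apply: le_trans (negb_and5_le _ _ _ _ _ _ _ _) _; rewrite negbK.
rewrite !big_split /=.
rewrite -(sum_swap (fun x y => (~~ regular rdE eps (class f (f x)) (class f (f y)))%:R)).
rewrite -(sum_swap (fun x y => (~~ regular blE eps (class f (f x)) (class f (f y)))%:R)).
rewrite -(sum_swap (fun x y => small x)) sum_fst -/n.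
have sn : n * \sum_x small x <= d * n ^+ 2.
  by rewrite expr2 mulrCA ler_pM2l.
have en : eps * n ^+ 2 <= d * n ^+ 2 by rewrite ler_wpM2r // sqr_ge0.
move: diag regR regB; rewrite -/n; lra.
Qed.

(** The relation [P] allows two uses: for all pairs and for the pairs inside the classes. The error
    adds [4 d] from [cluster_density] and [8 d] from [not_good_count]. *)
Lemma edges_le_weight (P : rel K) :
  \sum_(p | P (f p.1) (f p.2)) G p <=
    \sum_(p | P (f p.1) (f p.2)) w (f p.1) (f p.2) + 12%:R * d * n ^+ 2.
Proof.
have w0 i j : 0 <= w i j by rewrite /w; case: ifP => // _; case: ifP => _; lra.
suff H : \sum_(p | P (f p.1) (f p.2)) G p <=
    \sum_(p | P (f p.1) (f p.2)) (w (f p.1) (f p.2) + (4%:R * d + (~~ good (f p.1) (f p.2))%:R)).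
  apply: le_trans H _; rewrite big_split /= lerD2l.
  apply: le_trans (_ : \sum_(p : T * T) (4%:R * d + (~~ good (f p.1) (f p.2))%:R) <= _).
    rewrite big_mkcond; apply: ler_sum => p _; case: ifP => // _.
    by rewrite addr_ge0 // mulr_ge0 // ltW.
  rewrite big_split /= sumr_const -[X in X + _ <= _]mulr_natr card_prod natrM -/n.
  have := not_good_count; lra.
rewrite (partition_big (pairmap f) predT) //= [X in _ <= X](partition_big (pairmap f) predT) //=.
apply: ler_sum => -[i j] _.
have [Pij|Pij] := boolP (P i j); last first.
  rewrite !big_pred0 // => p; apply/negbTE; apply: contra Pij => /andP [Pp /eqP [<- <-]] //.
have cond p : P (f p.1) (f p.2) && (pairmap f p == (i, j)) = (p.1 \in class f i) && (p.2 \in class f j).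
  rewrite !inE /pairmap xpair_eqE; case: eqP => [->|_]; rewrite ?andbF //=.
  by case: eqP => [->|_]; rewrite ?andbF // Pij.
rewrite (eq_bigl _ _ cond) [X in _ <= X](eq_bigl _ _ cond).
rewrite [X in _ <= X](eq_bigr (fun=> w i j + (4%:R * d + (~~ good i j)%:R))); last first.
  by move=> p; rewrite !inE => /andP [/eqP -> /eqP ->].
rewrite sum_pairs_const.
have -> : \sum_(p : T * T | (p.1 \in class f i) && (p.2 \in class f j)) G p =
    (ecount rdE (class f i) (class f j) + ecount blE (class f i) (class f j))%:R.
  rewrite natrD !ecountE -big_split /=; apply: eq_bigr => p _; rewrite /G /ind.
  case: (boolP (rdE p.1 p.2)) => [/rb /negPf ->|_] /=; first by rewrite addr0.
  by rewrite add0r.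
have [g|ng] := boolP (good i j).
  have := cluster_density e1 rb d0 M0 T0 g.
  by rewrite /= addr0 /w /hT.
rewrite -[X in X <= _]mul1r.
apply: le_trans (_ : 1 * (#|class f i|%:R * #|class f j|%:R) <= _).
  rewrite !mul1r -natrM ler_nat /ecount -big_split /= -sum_nat_const; apply: leq_sum => x _.
  rewrite -cardsUI (_ : _ :&: _ = set0).
    rewrite cards0 addn0; apply: subset_leq_card; apply/subsetP => y.
    by rewrite !inE => /orP [] /andP [].
  apply/setP => y; rewrite !inE; have [xy|] := boolP (rdE x y); last by rewrite andbF.
  by rewrite (negPf (rb xy)) !andbF.
apply: ler_wpM2r; first by rewrite mulr_ge0.
by have := w0 i j; move: d0; rewrite ?ng /=; lra.
Qed.

Lemma structure_of_partition :
  \sum_p G p <= (83%:R / 100%:R + 12%:R * d) * n ^+ 2 \/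
  exists g : T -> 'I_6, \sum_p G p + \sum_(p : T * T | g p.1 == g p.2) G p <=
    \sum_(p : T * T) (g p.1 != g p.2)%:R + 24%:R * d * n ^+ 2.
Proof.
have rds : symmetric rd by apply: rdK_sym.
have bls : symmetric bl by apply: blK_sym.
have fus : symmetric fu by apply: fuK_sym.
have rdi : irreflexive rd by apply: rdK_irr.
have bli : irreflexive bl by apply: blK_irr.
have fui : irreflexive fu by apply: fuK_irr.
have hTs : symmetric hT by move=> i j; rewrite /hT eq_sym rds fus [rt i || _]orbC.
have ws i j : w i j = w j i by rewrite /w rds bls hTs.
have w0 i j : 0 <= w i j by rewrite /w; case: ifP => // _; case: ifP => _; lra.
have wii i : w i i = 0 by rewrite /w rdi bli.
have [rep [repw reptw repsum]] := @symmetrization R T (fun x y => w (f x) (f y))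
   (fun x y => ws _ _) (fun x y => w0 _ _) (fun x => wii _).
have repf x y : f x = f y -> rep x = rep y by move=> fxy; apply: reptw => z; rewrite fxy.
pose g0 x := f (rep x).
have g0E x y : (g0 x == g0 y) = (rep x == rep y).
  apply/idP/idP => [/eqP E|/eqP E]; last by rewrite /g0 E.
  apply: contraT => /repw; rewrite -[f (rep x)]/(g0 x) -[f (rep y)]/(g0 y) E wii ltxx //.
(* Lying in a common class depends only on the clusters, since [rep] is constant on each, so it can
   serve as [P] in [edges_le_weight]. *)
pose P : rel K := fun i j => [exists x, exists y, [&& f x == i, f y == j & rep x == rep y]].
have PE x y : P (f x) (f y) = (rep x == rep y).
  apply/existsP/idP => [[x' /existsP [y' /and3P [/eqP fx /eqP fy]]]|E].
    by rewrite (repf _ _ fx) (repf _ _ fy).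
  by exists x; apply/existsP; exists y; rewrite !eqxx.
have all_le := edges_le_weight (fun _ _ => true).
have ins_le := edges_le_weight P.
have insE (F : T * T -> R) : \sum_(p | P (f p.1) (f p.2)) F p = \sum_(p : T * T | g0 p.1 == g0 p.2) F p.
  by apply: eq_bigl => p; rewrite PE g0E.
rewrite !insE in ins_le.
have {}repsum : \sum_p w (f p.1) (f p.2) + \sum_(p : T * T | g0 p.1 == g0 p.2) w (f p.1) (f p.2)
   <= \sum_(p : T * T) w (g0 p.1) (g0 p.2).
  have insW : \sum_x \sum_(y | rep x == rep y) w (f x) (f y) =
      \sum_(p : T * T | g0 p.1 == g0 p.2) w (f p.1) (f p.2).
    by rewrite pair_big_dep /=; apply: eq_bigl => p; rewrite g0E.
  by move: repsum; rewrite insW !pair_bigA.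
pose S : {set K} := [set g0 x | x : T].
have Sc i j : i \in S -> j \in S -> i != j -> rd i j || bl i j.
  move=> /imsetP [x _ ->] /imsetP [y _ ->]; rewrite g0E => /repw.
  by rewrite /w -/(g0 x) -/(g0 y); case: ifP => //; rewrite ltxx.
have wle (x y : T) : w (g0 x) (g0 y) = (if g0 x == g0 y then 0 else (1 + (hT (g0 x) (g0 y))%:R) / 2).
  case: eqP => [->|/eqP xy]; first exact: wii.
  rewrite /w Sc ?imset_f //; case: (hT _ _) => /=; lra.
have [cop|[S6 Sh]] := @reduced_clique R K rd fu rt S rds rdi fus fui
   (@rdK_trifree R T K f rdE blE d e1 eps M rs ri d0 d1 e1E epsE M0 T0 noK3 S)
   (fun i j _ _ => @red_type_no_red R T K f rdE blE d e1 eps M rs ri d0 d1 e1E epsE M0 T0 noK3 i j)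
   (fun A F AS FA FB Ac Fc => @reduced_capped R T K f rdE blE d e1 eps M bs bi d0 d1 e1E epsE M0 T0 alphaT noK6 S A F Sc AS FA FB Ac Fc).
- left.
  have tot : \sum_(p : T * T) w (g0 p.1) (g0 p.2) <= 83%:R / 100%:R * n ^+ 2.
    (* The form is evaluated at the number of vertices that each cluster represents. *)
    have := cop (fun k => #|class g0 k|%:R) (fun k => ler0n _ _).
    have H0 : forall i, i \notin S -> #|class g0 i|%:R = 0 :> R.
      move=> i iS; apply/eqP; rewrite pnatr_eq0 cards_eq0; apply/eqP/setP => x; rewrite !inE.
      by apply/negbTE; apply: contraNneq iS => <-; apply: imset_f.
    move=> /(_ H0); rewrite -(sum_pairs_fibres g0).
    have -> : \sum_(p : T * T) wform (83%:R / 100%:R) hT (g0 p.1) (g0 p.2) =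
       83%:R / 100%:R * n ^+ 2 - \sum_(p : T * T) w (g0 p.1) (g0 p.2).
      rewrite (eq_bigr (fun p : T * T => 83%:R / 100%:R - w (g0 p.1) (g0 p.2))).
        by rewrite sumrB sumr_const card_prod -[X in X - _]mulr_natr natrM.
      by move=> p _; rewrite /wform wle.
    by rewrite subr_ge0.
  have pos : 0 <= \sum_(p : T * T | g0 p.1 == g0 p.2) w (f p.1) (f p.2) by apply: sumr_ge0.
  rewrite mulrDl; move: all_le; rewrite /=; lra.
right.
have sz : size (enum S) = 6%N by rewrite -cardE.
have gS x : g0 x \in enum S by rewrite mem_enum imset_f.
pose g x : 'I_6 := inord (index (g0 x) (enum S)).
have gE x y : (g x == g y) = (g0 x == g0 y).
  apply/eqP/eqP => [/(congr1 (@nat_of_ord _))|E]; last by rewrite /g E.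
  have lt z : (index (g0 z) (enum S) < 6)%N by rewrite -sz index_mem.
  rewrite /g !inordK // => E.
  by rewrite -(nth_index (g0 x) (gS x)) E nth_index.
exists g.
rewrite [X in _ + X <= _](eq_bigl (fun p : T * T => g0 p.1 == g0 p.2)); last by move=> p; rewrite gE.
have tot : \sum_(p : T * T) w (g0 p.1) (g0 p.2) <= \sum_(p : T * T) (g p.1 != g p.2)%:R.
  apply: ler_sum => p _; rewrite gE wle; case: eqP => //= _.
  by case: (hT _ _) => /=; lra.
move: all_le ins_le; rewrite /=; lra.
Qed.

End Structure.

(** * Upper bound *)

Lemma structure (R : realType) (gamma : R) : 0 < gamma ->
  exists (delta : R) (N : nat), 0 < delta /\
  forall (T : finType) (rdE blE : rel T),
    symmetric rdE -> symmetric blE -> irreflexive rdE -> irreflexive blE ->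
    (forall x y, rdE x y -> ~~ blE x y) -> (N <= #|T|)%N ->
    (forall Y : {set T}, delta * #|T|%:R <= #|Y|%:R ->
       exists x y, [/\ x \in Y, y \in Y & rdE x y || blE x y]) ->
    (forall P : {set T}, clique rdE P -> #|P| != 3%N) ->
    (forall P : {set T}, clique blE P -> #|P| != 6%N) ->
    let G (p : T * T) : R := (rdE p.1 p.2 || blE p.1 p.2)%:R in
    \sum_p G p <= (83%:R / 100%:R + gamma) * #|T|%:R ^+ 2 \/
    exists g : T -> 'I_6, \sum_p G p + \sum_(p : T * T | g p.1 == g p.2) G p <=
      \sum_(p : T * T) (g p.1 != g p.2)%:R + gamma * #|T|%:R ^+ 2.
Proof.
move=> g0.
(* The error [12 d] occurs twice, for all pairs and for those inside the classes. *)
pose d : R := Num.min 1 (gamma / 24%:R).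
have d0 : 0 < d by rewrite lt_min ltr01 divr_gt0 // ltr0n.
have d1 : d <= 1 by rewrite ge_min lexx.
have dg : 24%:R * d <= gamma.
  by rewrite mulrC -ler_pdivlMr ?ltr0n // ge_min lexx orbT.
pose e1 : R := d ^+ 6 / 7%:R.
have e10 : 0 < e1 by rewrite divr_gt0 ?exprn_gt0 // ltr0n.
pose eps := e1 ^+ 2.
have eps0 : 0 < eps by rewrite exprn_gt0.
pose m := Num.bound (1 / d).
have md : 1 <= d * m.+1%:R.
  rewrite mulrC -ler_pdivrMr //; apply: ltW; apply: lt_le_trans (archi_boundP _) _.
    by rewrite divr_ge0 // ltW.
  by rewrite ler_nat.
have [M0 HM] := regularity m.+1 eps0.
pose M : R := M0.+1%:R.
have M_gt0 : 0 < M by rewrite ltr0n.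
exists (e1 ^+ 2 * d / M), m.+1; split; first by rewrite divr_gt0 // mulr_gt0 // exprn_gt0.
move=> T rdE blE rs bs ri bi rb NT alphaT noK3 noK6 G.
have [f0 f0b] := balanced_labelling T m.
have [K [f [r [KM f0r reg]]]] := HM T (fun c => if c then rdE else blE) f0.
have KM' : #|K|%:R <= M by rewrite ler_nat leqW.
have T0 : (0 < #|T|)%N by apply: leq_trans NT.
have mT : 1 <= d * #|T|%:R.
  by apply: le_trans md _; rewrite ler_pM2l // ler_nat.
have alphaT' : forall Y : {set T}, e1 ^+ 2 * (d * #|T|%:R / M) <= #|Y|%:R ->
    exists x y, [/\ x \in Y, y \in Y & rdE x y || blE x y].
  move=> Y H; apply: alphaT; apply: le_trans H.
  by rewrite le_eqVlt; apply/orP; left; apply/eqP; ring.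
have n2 : 0 <= #|T|%:R ^+ 2 :> R by rewrite sqr_ge0.
have dn : 24%:R * d * #|T|%:R ^+ 2 <= gamma * #|T|%:R ^+ 2 by rewrite ler_wpM2r.
have [H|[g H]] := @structure_of_partition R T K f rdE blE d e1 eps M m f0 r rs bs ri bi rb
  d0 d1 erefl erefl M_gt0 T0 KM' alphaT' noK3 noK6 f0r f0b mT md (reg true) (reg false).
  left; refine (le_trans H _); apply: ler_wpM2r => //; rewrite lerD2l.
  by apply: le_trans dg; rewrite ler_wpM2r ?ler_nat // ltW.
by right; exists g; refine (le_trans H _); rewrite lerD2l.
Qed.

(** * Edge sets and adjacency relations *)

Definition adj (n : nat) (G : {set {set 'I_n}}) : rel 'I_n :=
  fun x y => (x != y) && ([set x; y] \in G).

Lemma adj_sym n (G : {set {set 'I_n}}) : symmetric (adj G).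
Proof. by move=> x y; rewrite /adj eq_sym setUC. Qed.

Lemma adj_irr n (G : {set {set 'I_n}}) : irreflexive (adj G).
Proof. by move=> x; rewrite /adj eqxx. Qed.

Lemma adj_clique n (C : {set {set 'I_n}}) (P : {set 'I_n}) (p : nat) :
  ~~ has_clique C p -> clique (adj C) P -> #|P| != p.
Proof.
move=> nC Pc; apply: contra nC => /eqP Pp; apply/existsP; exists P.
rewrite Pp eqxx /=; apply/forallP => e; apply/implyP => /andP [eP /cards2P [x [y [xy eE]]]].
have [xP yP] : x \in P /\ y \in P by split; apply: (subsetP eP); rewrite eE !inE eqxx ?orbT.
by have := cliqueP _ _ Pc x y xP yP xy; rewrite /adj eE => /andP [].
Qed.

Lemma adj_nedges (R : realFieldType) n (G : {set {set 'I_n}}) : is_graph G ->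
  \sum_(p : 'I_n * 'I_n) (adj G p.1 p.2)%:R = 2 * (nedges G)%:R :> R.
Proof.
move=> Gg; rewrite -natr_sum /nedges -natrM; congr _%:R.
have -> : (\sum_(p : 'I_n * 'I_n) adj G p.1 p.2 = \sum_(p : 'I_n * 'I_n | adj G p.1 p.2) 1)%N.
  by rewrite [RHS]big_mkcond; apply: eq_bigr => p _; case: (adj _ _ _).
rewrite (partition_big (fun p => [set p.1; p.2]) (mem G)) /=; last by move=> p /andP [].
rewrite mulnC -sum_nat_const; apply: eq_bigr => e eG.
have /forall_inP /(_ e eG) /cards2P [a [b [ab eE]]] := Gg.
rewrite sum1_card.
have -> : 2%N = #|[set (a, b); (b, a)]| by rewrite cards2 xpair_eqE negb_and ab.
apply: eq_card => -[x y]; rewrite !inE unfold_in /adj !xpair_eqE /=.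
apply/idP/idP => [/andP [/andP [xy xyG] /eqP E]|].
  have : x \in e by rewrite -E !inE eqxx.
  have : y \in e by rewrite -E !inE eqxx orbT.
  by rewrite eE !inE => /orP [] /eqP Ey /orP [] /eqP Ex; move: xy; rewrite Ex Ey ?eqxx ?orbT.
move=> /orP [] /andP [/eqP -> /eqP ->].
  by rewrite ab -eE eG eqxx.
by rewrite eq_sym ab [[set b; a]]setUC -eE eG eqxx.
Qed.

Lemma alpha_edge (R : realFieldType) n (G : {set {set 'I_n}}) (a : R) (Y : {set 'I_n}) :
  is_graph G -> (alpha G)%:R < a -> a <= #|Y|%:R ->
  exists x y, [/\ x \in Y, y \in Y & adj G x y].
Proof.
move=> Gg Ga aY.
have : ~~ independent G Y.
  apply: contraL (lt_le_trans Ga aY) => iY; rewrite -leNgt ler_nat.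
  exact: (leq_bigmax_cond (F := fun S : {set 'I_n} => #|S|) Y iY).
rewrite negb_forall => /existsP [e]; rewrite negb_imply negbK => /andP [eG eY].
have /forall_inP /(_ e eG) /cards2P [a' [b [ab eE]]] := Gg.
exists a', b; split; rewrite ?(subsetP eY) ?eE ?inE ?eqxx ?orbT //.
by rewrite /adj ab -eE.
Qed.

Lemma graph_structure (R : realType) (gamma : R) : 0 < gamma ->
  exists (delta : R) (N : nat), 0 < delta /\
  forall n (G : {set {set 'I_n}}), (N <= n)%N -> is_graph G -> KpKq_free G 3 6 ->
    (alpha G)%:R < delta * n%:R ->
    2 * (nedges G)%:R <= (83%:R / 100%:R + gamma) * n%:R ^+ 2 \/
    exists g : 'I_n -> 'I_6,
      2 * (nedges G)%:R + \sum_(p : 'I_n * 'I_n | g p.1 == g p.2) (adj G p.1 p.2)%:R <=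
      \sum_(p : 'I_n * 'I_n) (g p.1 != g p.2)%:R + gamma * n%:R ^+ 2.
Proof.
move=> g0; have [delta [N [delta0 H]]] := structure g0.
exists delta, N; split=> // n G nN Gg /existsP [C /and3P [CG nC nB]] Ga.
have GE x y : adj C x y || adj (G :\: C) x y = adj G x y.
  rewrite /adj inE; case: (x != y) => //=.
  by have [xC|_] //= := boolP ([set x; y] \in C); rewrite (subsetP CG).
have [|||||||||K|[g K]] := H 'I_n (adj C) (adj (G :\: C)).
- exact: adj_sym.
- exact: adj_sym.
- exact: adj_irr.
- exact: adj_irr.
- by move=> x y; rewrite /adj inE => /andP [_ ->]; rewrite andbF.
- by rewrite card_ord.
- move=> Y; rewrite card_ord => aY; have [x [y [xY yY xy]]] := alpha_edge Gg Ga aY.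
  by exists x, y; rewrite GE.
- by move=> P; apply: adj_clique.
- by move=> P; apply: adj_clique.
- left; move: K; rewrite card_ord -(adj_nedges R Gg); congr (_ <= _).
  by apply: eq_bigr => p _; rewrite GE.
right; exists g; move: K; rewrite card_ord -(adj_nedges R Gg); congr (_ + _ <= _).
  by apply: eq_bigr => p _; rewrite GE.
by apply: eq_bigr => p _; rewrite GE.
Qed.

(** The deviation from balance is an exact sum of squares: dropped, it gives the upper bound on
    [RT]; kept, it shows that the six parts are nearly equal. *)
Lemma same_label_count (R : realFieldType) (T : finType) (g : T -> 'I_6) :
  \sum_(p : T * T) (g p.1 != g p.2)%:R =
  5%:R / 6%:R * #|T|%:R ^+ 2 - \sum_k (#|class g k|%:R - #|T|%:R / 6%:R) ^+ 2 :> R.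
Proof.
have nE : #|T|%:R = \sum_k #|class g k|%:R :> R.
  rewrite -sum1_card natr_sum (partition_big g predT) //=; apply: eq_bigr => k _.
  by rewrite sumr_const cardsE.
have E1 : \sum_(p : T * T) (g p.1 != g p.2)%:R =
    #|T|%:R ^+ 2 - \sum_(p : T * T) (g p.1 == g p.2)%:R :> R.
  have -> : #|T|%:R ^+ 2 = \sum_(p : T * T) 1 :> R.
    by rewrite sumr_const card_prod natrM expr2.
  by rewrite -sumrB; apply: eq_bigr => p _; case: eqP => _ /=; rewrite ?subrr ?subr0.
have E2 : \sum_(p : T * T) (g p.1 == g p.2)%:R = \sum_k #|class g k|%:R ^+ 2 :> R.
  rewrite (sum_pairs_fibres g (fun k l => (k == l)%:R)); apply: eq_bigr => k _.
  rewrite (bigD1 k) //= big1 ?addr0; first by rewrite eqxx mul1r expr2.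
  by move=> l lk; rewrite eq_sym (negPf lk) !mul0r.
rewrite E1 E2.
have -> : \sum_k (#|class g k|%:R - #|T|%:R / 6%:R) ^+ 2 =
    \sum_k #|class g k|%:R ^+ 2 - (#|T|%:R / 3%:R) * \sum_k #|class g k|%:R
     + \sum_(k < 6) (#|T|%:R / 6%:R) ^+ 2 :> R.
  by rewrite mulr_sumr -sumrB -big_split /=; apply: eq_bigr => k _; field.
by rewrite -nE sumr_const card_ord -[X in _ = _ - (_ + X)]mulr_natr; field.
Qed.

Lemma RT_upper (R : realType) (eps : R) : 0 < eps -> exists delta : R, 0 < delta /\
  exists N : nat, forall n : nat, (N <= n)%N ->
    (RT n 3 6 (delta * n%:R))%:R <= (5%:R / 12%:R + eps) * n%:R ^+ 2.
Proof.
move=> eps0.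
have [delta [N [delta0 H]]] := graph_structure eps0.
exists delta; split=> //; exists N => n nN.
have n2 : 0 <= n%:R ^+ 2 :> R by rewrite sqr_ge0.
have en2 : 0 <= eps * n%:R ^+ 2 by rewrite mulr_ge0 // ltW.
rewrite /RT; apply: (big_ind (fun k : nat => k%:R <= (5%:R / 12%:R + eps) * n%:R ^+ 2)).
- by rewrite mulrDl addr_ge0 // mulr_ge0 // divr_ge0.
- by move=> x y hx hy; rewrite /maxn; case: ifP.
move=> G /and3P [Gg Gf Ga].
have [K|[g K]] := H n G nN Gg Gf Ga; first by move: K; rewrite !mulrDl; lra.
have pos : 0 <= \sum_(p : 'I_n * 'I_n | g p.1 == g p.2) (adj G p.1 p.2)%:R :> R by apply: sumr_ge0.
move: K; rewrite same_label_count card_ord mulrDl.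
have : 0 <= \sum_k (#|class g k|%:R - n%:R / 6%:R) ^+ 2 :> R by apply: sumr_ge0 => k _; apply: sqr_ge0.
by lra.
Qed.

(** * Stability *)

(* Take the permutation with most matches: a label [k] with an unmatched source
   has no unmatched target, since a transposition would gain a match. *)
Lemma matching_perm (T K : finType) (a b : T -> K) : exists s : {perm T},
  (#|[set x | a (s x) != b x]| <= \sum_k (#|class b k| - #|class a k|))%N.
Proof.
pose m (s : {perm T}) := #|[set x | a (s x) == b x]|.
case: (@arg_maxnP _ (1%g : {perm T}) xpredT m isT) => s _ smax.
exists s.
have -> : #|[set x | a (s x) != b x]| = (\sum_k #|[set x | (b x == k) && (a (s x) != k)]|)%N.
  rewrite -sum1_card (partition_big b predT) //=; apply: eq_bigr => k _.
  rewrite sum1_card; apply: eq_card => x; rewrite !inE unfold_in /= inE.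
  by case: (b x =P k) => [->|]; rewrite ?andbT ?andbF.
apply: leq_sum => k _.
have [->|[x0]] := set_0Vmem [set x | (b x == k) && (a (s x) != k)]; first by rewrite cards0.
rewrite inE => /andP [/eqP bx0 ax0].
have noy y : a (s y) = k -> b y = k.
  move=> ay; apply/eqP; apply: contraT => bY.
  pose s' := (tperm x0 y * s)%g.
  have x0y : x0 != y by apply: contraNneq ax0 => ->; rewrite ay.
  have s'x0 : s' x0 = s y by rewrite permM tpermL.
  have : (m s < m s')%N.
    apply: proper_card; apply/properP; split.
      apply/subsetP => x; rewrite !inE permM.
      have [->|xx0] := eqVneq x x0; first by rewrite bx0 (negPf ax0).
      have [->|xy] := eqVneq x y; first by rewrite ay eq_sym (negPf bY).
      by rewrite tpermD // eq_sym.
    by exists x0; rewrite !inE ?s'x0 ?ay bx0 ?eqxx // (negPf ax0).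
  by rewrite ltnNge (smax s' isT : m s' <= m s)%N.
have -> : #|class a k| = #|[set y | a (s y) == k]|.
  rewrite -[RHS](card_imset _ (@perm_inj T s)); apply: eq_card => z; rewrite inE.
  apply/idP/imsetP => [az|[y]]; last by rewrite inE => ay ->.
  by exists ((s^-1)%g z); rewrite ?inE permKV.
rewrite leq_subRL; last first.
  by apply: subset_leq_card; apply/subsetP => y; rewrite !inE => /eqP /noy ->.
rewrite -cardsUI (_ : _ :&: _ = set0).
  rewrite cards0 addn0; apply: subset_leq_card; apply/subsetP => y.
  by rewrite !inE => /orP [/eqP /noy ->|/andP [-> _]].
by apply/setP => y; rewrite !inE; case: (a (s y) == k); rewrite ?andbF.
Qed.

Lemma bigminn_le (I : eqType) (r : seq I) (x0 : nat) (F : I -> nat) (i : I) :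
  i \in r -> (\big[minn/x0]_(j <- r) F j <= F i)%N.
Proof.
elim: r => // j r IH; rewrite inE big_cons geq_min => /orP [/eqP ->|/IH ->].
  by rewrite leqnn.
by rewrite orbT.
Qed.

Lemma relabel_adj n (s : {perm 'I_n}) (G : {set {set 'I_n}}) x y :
  adj (relabel s G) (s x) (s y) = adj G x y.
Proof.
rewrite /adj (inj_eq perm_inj); congr (_ && _).
have imE : [set s x; s y] = s @: [set x; y] by rewrite imsetU !imset_set1.
rewrite /relabel imE; apply/imsetP/idP => [[e eG]|xyG]; last by exists [set x; y].
by move=> /(imset_inj perm_inj) ->.
Qed.

Lemma relabel_graph n (s : {perm 'I_n}) (G : {set {set 'I_n}}) : is_graph G -> is_graph (relabel s G).
Proof.
move=> Gg; apply/forall_inP => e /imsetP [e' e'G ->].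
by rewrite card_imset; [exact: (forall_inP Gg)|exact: perm_inj].
Qed.

Lemma Delta_le (R : realFieldType) n (S Z : {set {set 'I_n}}) (s : {perm 'I_n}) :
  is_graph S -> is_graph Z ->
  (Delta S Z)%:R <= \sum_(p : 'I_n * 'I_n) (adj S (s p.1) (s p.2) != adj Z p.1 p.2)%:R :> R.
Proof.
move=> Sg Zg; set Z' := relabel s Z.
have Zg' : is_graph Z' by apply: relabel_graph.
pose D := (S :\: Z') :|: (Z' :\: S).
apply: le_trans (_ : #|D|%:R <= _).
  rewrite ler_nat; apply: (@bigminn_le _ _ _ (fun t => #|(S :\: relabel t Z) :|: (relabel t Z :\: S)|)).
  exact: mem_index_enum.
rewrite -natr_sum ler_nat.
have -> : (\sum_(p : 'I_n * 'I_n) (adj S (s p.1) (s p.2) != adj Z p.1 p.2) =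
   #|[set p : 'I_n * 'I_n | adj S (s p.1) (s p.2) != adj Z p.1 p.2]|)%N.
  by rewrite -sum1_card [RHS]big_mkcond; apply: eq_bigr => p _; rewrite inE; case: (_ != _).
apply: leq_trans (leq_imset_card (fun p : 'I_n * 'I_n => [set s p.1; s p.2]) _).
apply: subset_leq_card; apply/subsetP => e eD.
have eSZ : (e \in S) (+) (e \in Z').
  by move: eD; rewrite /D !inE; case: (e \in S); case: (e \in Z').
have /cards2P [x [y [xy eE]]] : #|e| == 2%N.
  by move: eD; rewrite /D !inE => /orP [] /andP [_]; [apply: (forall_inP Sg)|apply: (forall_inP Zg')].
apply/imsetP; exists ((s^-1)%g x, (s^-1)%g y); last by rewrite /= !permKV.
rewrite inE /= -(relabel_adj s Z) !permKV /adj xy /= -eE -/Z'.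
by move: eSZ; case: (e \in S); case: (e \in Z').
Qed.

Lemma near_turan (R : realType) (kappa : R) : 0 < kappa ->
  exists (delta gamma : R) (N : nat), [/\ 0 < delta, 0 < gamma &
  forall n (G : {set {set 'I_n}}), (N <= n)%N -> is_graph G -> KpKq_free G 3 6 ->
    (alpha G)%:R < delta * n%:R ->
    `|(nedges G)%:R - 5%:R / 12%:R * n%:R ^+ 2| <= gamma * n%:R ^+ 2 ->
    exists g : 'I_n -> 'I_6,
      \sum_(p : 'I_n * 'I_n) (adj G p.1 p.2 != (g p.1 != g p.2))%:R <= kappa * n%:R ^+ 2 /\
      forall k, `|#|class g k|%:R - n%:R / 6%:R| <= kappa * n%:R].
Proof.
move=> k0.
(* The bound 1/1000 excludes the first alternative, as [83/100 + gamma < 5/6 - 2 gamma]. In the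
   second, the inner adjacencies and the squared deviation are each at most [3 gamma n^2]; the
   former count twice, and the surplus of crossing pairs over adjacencies adds [2 gamma n^2], whence
   8. *)
pose gamma : R := Num.min (1 / 1000%:R) (Num.min (kappa / 8%:R) (kappa ^+ 2 / 3%:R)).
have g0 : 0 < gamma by rewrite !lt_min !divr_gt0 ?exprn_gt0 // ltr0n.
have g1 : gamma <= 1 / 1000%:R by rewrite ge_min lexx.
have g2 : gamma <= kappa / 8%:R by rewrite !ge_min lexx orbT.
have g3 : gamma <= kappa ^+ 2 / 3%:R by rewrite !ge_min lexx !orbT.
have [delta [N [delta0 H]]] := graph_structure g0.
exists delta, gamma, N.+1; split=> // n G nN Gg Gf Ga; rewrite ler_norml => /andP [lo hi].
have n0 : 0 < n%:R :> R by rewrite ltr0n; apply: leq_trans nN.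
set n2 := n%:R ^+ 2 in lo hi *.
have n20 : 0 < n2 by rewrite exprn_gt0.
have gn1 : gamma * n2 <= 1 / 1000%:R * n2 by rewrite ler_wpM2r // ltW.
have gn2 : gamma * n2 <= kappa / 8%:R * n2 by rewrite ler_wpM2r // ltW.
have gn3 : gamma * n2 <= kappa ^+ 2 / 3%:R * n2 by rewrite ler_wpM2r // ltW.
have [K|[g K]] := H n G (ltnW nN) Gg Gf Ga.
  by exfalso; move: K lo; rewrite -/n2 mulrDl; lra.
exists g.
set I := \sum_(p : 'I_n * 'I_n | g p.1 == g p.2) _ in K.
have I0 : 0 <= I by apply: sumr_ge0.
have dev0 : 0 <= \sum_k (#|class g k|%:R - n%:R / 6%:R) ^+ 2 :> R by apply: sumr_ge0 => k _; apply: sqr_ge0.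
have DE := same_label_count R g; rewrite card_ord in DE.
have diffE : \sum_(p : 'I_n * 'I_n) (adj G p.1 p.2 != (g p.1 != g p.2))%:R =
    2 * I + \sum_(p : 'I_n * 'I_n) (g p.1 != g p.2)%:R - 2 * (nedges G)%:R :> R.
  have -> : I = \sum_(p : 'I_n * 'I_n) (if g p.1 == g p.2 then (adj G p.1 p.2)%:R else 0).
    by rewrite /I big_mkcond.
  rewrite -(adj_nedges R Gg) mulr_sumr -big_split -sumrB /=; apply: eq_bigr => p _.
  by case: (adj _ _ _); case: (g p.1 == g p.2) => /=; ring.
split.
  by rewrite diffE; move: K lo; rewrite DE -/n2; lra.
move=> k.
have dev : (#|class g k|%:R - n%:R / 6%:R) ^+ 2 <= \sum_k (#|class g k|%:R - n%:R / 6%:R) ^+ 2 :> R.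
  by rewrite [X in _ <= X](bigD1 k) //= lerDl; apply: sumr_ge0 => j _; apply: sqr_ge0.
have sq : (#|class g k|%:R - n%:R / 6%:R) ^+ 2 <= (kappa * n%:R) ^+ 2 :> R.
  by apply: le_trans dev _; rewrite exprMn -/n2; move: K lo; rewrite DE -/n2; lra.
have kn : 0 <= kappa * n%:R by rewrite mulr_ge0 // ltW.
move: sq; rewrite -[X in X <= _]real_normK ?num_real //.
by rewrite ler_pXn2r // nnegrE.
Qed.

Lemma weak_stability (R : realType) (S Z : forall n : nat, {set {set 'I_n}}) :
  (forall n, is_graph (S n)) -> (forall n, is_graph (Z n)) ->
  (forall n, KpKq_free (S n) 3 6) -> (forall n, KpKq_free (Z n) 3 6) ->
  littleo_n (fun n => (alpha (S n))%:R : R) ->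
  littleo_n (fun n => (alpha (Z n))%:R : R) ->
  littleo_n2 (fun n => (nedges (S n))%:R - 5%:R / 12%:R * n%:R ^+ 2 : R) ->
  littleo_n2 (fun n => (nedges (Z n))%:R - 5%:R / 12%:R * n%:R ^+ 2 : R) ->
  littleo_n2 (fun n => (Delta (S n) (Z n))%:R : R).
Proof.
move=> Sg Zg Sf Zf Sa Za Se Ze eps eps0.
(* The 26 is 1 for each graph against its labelling and 12 for mislabelled vertices in each
   coordinate. *)
pose kappa := eps / 26%:R.
have k0 : 0 < kappa by rewrite divr_gt0 // ltr0n.
have [delta [gamma [N [d0 g0 H]]]] := near_turan k0.
have d20 : 0 < delta / 2 by rewrite divr_gt0 // ltr0n.
have [[N1 H1] [N2 H2] ] := (Sa _ d20, Za _ d20).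
have [[N3 H3] [N4 H4] ] := (Se _ g0, Ze _ g0).
exists (N + N1 + N2 + N3 + N4).+1 => n nN.
have [n0 [nN0 [nN1 [nN2 [nN3 nN4]]]]] :
  (0 < n /\ N <= n /\ N1 <= n /\ N2 <= n /\ N3 <= n /\ N4 <= n)%N by move: nN; clear; lia.
have np : 0 < n%:R :> R by rewrite ltr0n.
have small a : `|a%:R| <= delta / 2 * n%:R -> a%:R < delta * n%:R.
  rewrite ger0_norm // => h; apply: le_lt_trans h _.
  by rewrite ltr_pM2r // gtr_pMr // invf_lt1 // ?ltr1n // ltr0n.
have [g [g1 g2]] := H n (S n) nN0 (Sg n) (Sf n) (small _ (H1 n nN1)) (H3 n nN3).
have [h [h1 h2]] := H n (Z n) nN0 (Zg n) (Zf n) (small _ (H2 n nN2)) (H4 n nN4).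
(* All label classes have size within [kappa n] of [n/6], so for each of the six labels at most
   [2 kappa n] vertices remain unmatched. *)
have [s sP] := matching_perm g h.
have mis : #|[set x | g (s x) != h x]|%:R <= 12%:R * kappa * n%:R.
  apply: le_trans (_ : (\sum_k (#|class h k| - #|class g k|))%N%:R <= _); first by rewrite ler_nat.
  rewrite natr_sum; apply: le_trans (_ : \sum_(k < 6) 2 * kappa * n%:R <= _).
    apply: ler_sum => k _; have [le|/ltnW le] := leqP #|class h k| #|class g k|.
      by move/eqP: le => ->; apply: mulr_ge0 => //; apply: mulr_ge0 => //; apply: ltW.
    rewrite natrB //; have := g2 k; have := h2 k; rewrite !ler_norml => /andP [] _ + /andP [+ _].
    lra.
  by rewrite sumr_const card_ord -[X in X <= _]mulr_natr; lra.
rewrite ger0_norm //; apply: le_trans (Delta_le R s (Sg n) (Zg n)) _.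
have tri : \sum_(p : 'I_n * 'I_n) (adj (S n) (s p.1) (s p.2) != adj (Z n) p.1 p.2)%:R <=
   \sum_(p : 'I_n * 'I_n) (adj (S n) (s p.1) (s p.2) != (g (s p.1) != g (s p.2)))%:R +
   (\sum_(p : 'I_n * 'I_n) (g (s p.1) != h p.1)%:R + \sum_(p : 'I_n * 'I_n) (g (s p.2) != h p.2)%:R) +
   \sum_(p : 'I_n * 'I_n) (adj (Z n) p.1 p.2 != (h p.1 != h p.2))%:R :> R.
  rewrite -!big_split /=; apply: ler_sum => p _; rewrite -!natrD ler_nat.
  have : adj (S n) (s p.1) (s p.2) != adj (Z n) p.1 p.2 ->
    [|| adj (S n) (s p.1) (s p.2) != (g (s p.1) != g (s p.2)), g (s p.1) != h p.1,
        g (s p.2) != h p.2 | adj (Z n) p.1 p.2 != (h p.1 != h p.2)].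
    apply: contraTT; rewrite !negb_or !negbK => /and4P [/eqP -> /eqP -> /eqP -> /eqP ->].
    by rewrite eqxx.
  case: (_ != adj _ _ _) => // /(_ isT) /or4P [] ->;
    by apply/negPn; rewrite -ltnNge ltnS leqn0 !addn_eq0 /= ?andbF.
have e1 : \sum_(p : 'I_n * 'I_n) (adj (S n) (s p.1) (s p.2) != (g (s p.1) != g (s p.2)))%:R =
    \sum_(p : 'I_n * 'I_n) (adj (S n) p.1 p.2 != (g p.1 != g p.2))%:R :> R.
  rewrite -(pair_bigA _ (fun x y => (adj (S n) (s x) (s y) != (g (s x) != g (s y)))%:R)).
  rewrite -(pair_bigA _ (fun x y => (adj (S n) x y != (g x != g y))%:R)).
  rewrite [RHS](reindex_inj (@perm_inj _ s)) /=; apply: eq_bigr => x _.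
  by rewrite [RHS](reindex_inj (@perm_inj _ s)).
have cardm : \sum_x (g (s x) != h x)%:R = #|[set x | g (s x) != h x]|%:R :> R.
  by rewrite -sum1_card natr_sum [RHS]big_mkcond; apply: eq_bigr => x _; rewrite inE; case: (_ != _).
move: tri; rewrite e1 -(sum_swap (fun x y => (g (s x) != h x)%:R)) (sum_fst (fun x => (g (s x) != h x)%:R)) cardm card_ord => tri.
have mis' : n%:R * #|[set x | g (s x) != h x]|%:R <= 12%:R * kappa * n%:R ^+ 2.
  have -> : 12%:R * kappa * n%:R ^+ 2 = n%:R * (12%:R * kappa * n%:R) by ring.
  by rewrite ler_pM2l.
apply: le_trans tri _.
have -> : eps = 26%:R * kappa by rewrite /kappa; field.
by move: g1 h1 mis'; lra.
Qed.

(** * Lower bound *)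

Definition indep_set (V : finType) (e : rel V) (I : {set V}) := forall x y, x \in I -> y \in I -> ~~ e x y.

(** The integer form of [prod (1 - x_i) <= 1 / (1 + sum x_i)] with [x_i = s_i / N]; one factor is
    absorbed by [(N - s)(N + s + t) <= N (N + t)]. *)
Lemma prod_sub_bound (N : nat) (I : Type) (r : seq I) (s : I -> nat) : (forall i, s i <= N)%N ->
  ((\prod_(i <- r) (N - s i)) * (N + \sum_(i <- r) s i) <= N ^ (size r).+1)%N.
Proof.
move=> sN; elim: r => [|i r IH]; first by rewrite !big_nil addn0 mul1n expn1.
rewrite !big_cons /= expnS; apply: leq_trans (leq_mul (leqnn N) IH).
set P := (\prod_(i <- r) _)%N; set t := (\sum_(i <- r) _)%N.
have -> : ((N - s i) * P * (N + (s i + t)) = P * ((N - s i) * (N + s i + t)))%N by ring.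
have -> : (N * (P * (N + t)) = P * (N * (N + t)))%N by ring.
apply: leq_mul => //; have := sN i; move: (s i) => u uN.
by rewrite -{2 3 4}(subnK uN); move: (N - u)%N => v; nia.
Qed.

(** The right side equals [j + 3] times [2 (k + 1) N^(k+1)]. After multiplying by [N + s] and
    inserting the bound on [P], what remains is [(j + 1)(N + s) <= 2 (k + 1) N], which the bound on
    [s] gives. *)
Lemma zykov_arith (j N k s P : nat) : k.+1 = (j.+1 * j.+2)%N -> (0 < N)%N ->
  (j.+2 * s <= 2 * (k.+1 * N))%N -> (P * (N + s) <= N ^ k.+2)%N ->
  (j.+3 * (N ^ k * j.+1 * s + 2 * k.+1 * P) <=
    2 * (k.+1 * N * (N ^ k * j.+1) + N ^ k.+1 * (2 * k.+1)))%N.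
Proof.
move=> kE N0 sN PN.
have -> : (2 * (k.+1 * N * (N ^ k * j.+1) + N ^ k.+1 * (2 * k.+1)) = j.+3 * (2 * k.+1 * N ^ k.+1))%N.
  by rewrite expnS; ring.
rewrite leq_pmul2l //.
rewrite -(@leq_pmul2r (N + s)) ?addn_gt0 ?N0 // mulnDl.
have h1 : (2 * k.+1 * P * (N + s) <= 2 * k.+1 * N ^ k.+2)%N by rewrite -mulnA leq_pmul2l.
apply: leq_trans (leq_add (leqnn _) h1) _.
have h2 : (j.+1 * (N + s) <= 2 * k.+1 * N)%N.
  rewrite -(@leq_pmul2l j.+2) //.
  have -> : (j.+2 * (j.+1 * (N + s)) = k.+1 * N + j.+1 * (j.+2 * s))%N by rewrite kE; ring.
  apply: leq_trans (leq_add (leqnn _) (leq_mul (leqnn j.+1) sN)) _.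
  have -> : (j.+2 * (2 * k.+1 * N) = k.+1 * N + (k.+1 * N + j.+1 * (2 * (k.+1 * N))))%N by ring.
  by rewrite leq_add2l leq_addl.
have -> : (N ^ k * j.+1 * s * (N + s) = (N ^ k * s) * (j.+1 * (N + s)))%N by ring.
apply: leq_trans (leq_add (leq_mul (leqnn _) h2) (leqnn _)) _.
rewrite leq_eqVlt; apply/orP; left; apply/eqP; rewrite !expnS; ring.
Qed.

(* Zykov's construction: [k] blown-up copies of [V], and for every choice of
   one vertex per copy a blown-up vertex joined to the chosen ones.  The sizes of the two
   blow-ups balance the copies against the new vertices. *)
Lemma trianglefree_small_alpha (j : nat) : exists (V : finType) (e : rel V),
  [/\ symmetric e, irreflexive e, forall x y z, e x y -> e y z -> ~~ e x z, (0 < #|V|)%N &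
    forall I : {set V}, indep_set e I -> (j.+2 * #|I| <= 2 * #|V|)%N].
Proof.
elim: j => [|j [V [e [es ei et V0 eI]]]].
  exists unit, (fun _ _ => false); split=> // [|I _]; first by rewrite card_unit.
  by rewrite leq_mul2l /=; apply: max_card.
pose k := (j.+1 * j.+2).-1.
have kE : k.+1 = (j.+1 * j.+2)%N by rewrite prednK.
set N := #|V| in V0 eI.
pose p := (N ^ k * j.+1)%N; pose q := (2 * k.+1)%N.
pose W := (('I_k.+1 * V * 'I_p) + ({ffun 'I_k.+1 -> V} * 'I_q))%type.
pose e' (a b : W) := match a, b with
  | inl x, inl y => (x.1.1 == y.1.1) && e x.1.2 y.1.2
  | inl x, inr g => g.1 x.1.1 == x.1.2
  | inr g, inl x => g.1 x.1.1 == x.1.2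
  | inr _, inr _ => false
  end.
have cW : #|{: W}| = (k.+1 * N * p + N ^ k.+1 * q)%N.
  by rewrite card_sum !card_prod card_ffun !card_ord.
exists W, e'; split.
- by move=> [x|g] [y|g'] //=; rewrite eq_sym es.
- by move=> [x|g] //=; rewrite ei andbF.
- move=> [x|g] [y|g'] [z|g''] //=.
  + move=> /andP [/eqP -> exy] /andP [/eqP -> eyz].
    by rewrite negb_and (et _ _ _ exy eyz) orbT.
  + move=> /andP [/eqP -> exy] /eqP ->; apply: contraTneq exy => ->; by rewrite ei.
  + move=> /eqP gx /eqP gz; rewrite negb_and; apply/orP; rewrite -gx -gz.
    by have [->|] := eqVneq x.1.1 z.1.1; [right; rewrite ei|left].
  + move=> /eqP gx /andP [/eqP Ex exy]; rewrite -Ex gx; apply: contraTneq exy => ->.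
    by rewrite ei.
- by rewrite cW addn_gt0 muln_gt0 !muln_gt0 V0 expn_gt0 V0.
move=> I II.
(* The trace of [I] on copy [i] is independent, hence small. A new vertex in [I] must have chosen
   outside all traces, which leaves [P] choices. *)
pose J (i : 'I_k.+1) := [set v | [exists c, inl (i, v, c) \in I]].
have JI i : (j.+2 * #|J i| <= 2 * N)%N.
  apply: eI => v v'; rewrite !inE => /existsP [c vI] /existsP [c' vI'].
  by have := II _ _ vI vI'; rewrite /= eqxx.
have JN i : (#|J i| <= N)%N by apply: max_card.
pose s := (\sum_i #|J i|)%N; pose P := (\prod_i (N - #|J i|))%N.
have cI : (#|I| <= p * s + q * P)%N.
  pose A := [set x | (inl x : W) \in I]; pose B := [set g | (inr g : W) \in I].
  have IE : I = [set (inl x : W) | x in A] :|: [set (inr g : W) | g in B].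
    apply/setP => a; rewrite in_setU; apply/idP/orP.
      case: a => [x xI|g gI]; [left|right]; apply/imsetP; [exists x|exists g] => //; by rewrite inE.
    by move=> [] /imsetP [x]; rewrite inE => xI ->.
  have -> : #|I| = (#|A| + #|B|)%N.
    rewrite IE cardsU card_imset; last by move=> x y [].
    rewrite card_imset; last by move=> x y [].
    rewrite (_ : _ :&: _ = set0) ?cards0 ?subn0 //.
    apply/setP => a; rewrite in_setI in_set0; apply/negbTE/negP.
    by move=> /andP [/imsetP [x _ ->] /imsetP []].
  apply: leq_add.
    apply: leq_trans (_ : #|[set x : 'I_k.+1 * V * 'I_p | x.1.2 \in J x.1.1]| <= _)%N.
      apply: subset_leq_card; apply/subsetP => -[[i v] c]; rewrite !inE /= => H.
      by apply/existsP; exists c.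
    rewrite -sum1_card.
    rewrite (partition_big (fun x : 'I_k.+1 * V * 'I_p => x.1.1) predT) //= mulnC big_distrl /=.
    apply: leq_sum => i _; rewrite sum1_card.
    have -> : (#|J i| * p = #|[set x : V * 'I_p | x.1 \in J i]|)%N.
      by rewrite -[p in LHS]card_ord -cardsT -cardsX; apply: eq_card => -[v c]; rewrite !inE andbT.
    rewrite -(card_imset _ (_ : injective (fun x : V * 'I_p => (i, x.1, x.2)))); last first.
      by move=> [v c] [v' c'] [-> ->].
    apply: subset_leq_card; apply/subsetP => -[[i' v] c]; rewrite unfold_in /= inE /=.
    move=> /andP [vJ /eqP Ei]; apply/imsetP; exists (v, c); rewrite ?Ei //.
    by rewrite inE /= -Ei.
  pose FS := [set g : {ffun 'I_k.+1 -> V} | [forall i, g i \notin J i]].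
  have cF : #|FS| = P.
    rewrite /P -sum1_card big_mkcond /=.
    have -> : (\prod_i (N - #|J i|) = \prod_(i < k.+1) \sum_v (v \notin J i))%N.
      apply: eq_bigr => i _; rewrite /N -(cardC (mem (J i))) addKn -sum1_card big_mkcond.
      by apply: eq_bigr => v _; rewrite !inE; case: ifP.
    rewrite bigA_distr_bigA; apply: eq_bigr => g _; rewrite inE.
    case: forallP => [H|H]; first by rewrite big1 // => i _; rewrite H.
    apply/esym/eqP; rewrite prod_nat_seq_eq0; apply/hasP.
    have /forallPn [i Hi] : ~~ [forall i, g i \notin J i] by apply/negP => /forallP.
    by exists i; rewrite ?mem_index_enum // (negPf Hi).
  have -> : (q * P)%N = #|setX FS [set: 'I_q]| by rewrite cardsX cardsT card_ord cF mulnC.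
  apply: subset_leq_card.
  apply/subsetP => -[g c]; rewrite !inE andbT => gI; apply/forallP => i.
  rewrite inE; apply/existsP => -[c' vI].
  by have := II _ _ vI gI; rewrite /= eqxx.
rewrite cW; apply: leq_trans (leq_mul (leqnn _) cI) _.
apply: zykov_arith => //.
  rewrite /s big_distrr /=; apply: leq_trans (_ : \sum_(i < k.+1) 2 * N <= _)%N; first exact: leq_sum.
  by rewrite sum_nat_const card_ord mulnCA.
have := @prod_sub_bound N _ (index_enum 'I_k.+1) (fun i => #|J i|) JN.
by rewrite (_ : size _ = k.+1) // -[RHS](card_ord k.+1) cardT enumT.
Qed.

(** * The six-part construction *)

Definition graph_of (n : nat) (E : rel 'I_n) : {set {set 'I_n}} :=
  [set S : {set 'I_n} | (#|S| == 2)%N && clique E S].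

Lemma graph_of_graph n (E : rel 'I_n) : is_graph (graph_of E).
Proof. by apply/forall_inP => S; rewrite inE => /andP []. Qed.

Lemma in_graph_of n (E : rel 'I_n) x y : symmetric E -> x != y ->
  ([set x; y] \in graph_of E) = E x y.
Proof.
move=> Es xy; rewrite inE cards2 xy /=; apply/idP/idP; last exact: clique2.
by move/cliqueP; apply; rewrite // !inE eqxx ?orbT.
Qed.

Lemma has_cliqueP n (C : {set {set 'I_n}}) p : has_clique C p ->
  exists S : {set 'I_n}, #|S| = p /\ clique (fun x y => [set x; y] \in C) S.
Proof.
move=> /existsP [S /andP [/eqP Sp /forallP H]]; exists S; split=> //.
apply/cliqueP => x y xS yS xy; have := H [set x; y].
rewrite cards2 xy /= andbT => /implyP; apply.
by rewrite subUset !sub1set xS.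
Qed.

Definition pent (a b : nat) : bool := (b == a.+1 %% 5)%N || (a == b.+1 %% 5)%N.

Lemma pent_trifree a b c : (a < 5)%N -> (b < 5)%N -> (c < 5)%N ->
  pent a b -> pent b c -> ~~ pent a c.
Proof.
by case: a => [|[|[|[|[|a]]]]] //; case: b => [|[|[|[|[|b]]]]] //; case: c => [|[|[|[|[|c]]]]].
Qed.

(** Here [m0] to [m5] count the vertices of a blue clique in the six parts; consecutive parts of the
    pentagon are joined in red, so at most two of the first five are met. *)
Lemma pent_weights (m0 m1 m2 m3 m4 m5 : nat) :
  (m0 <= 2)%N -> (m1 <= 2)%N -> (m2 <= 2)%N -> (m3 <= 2)%N -> (m4 <= 2)%N -> (m5 <= 1)%N ->
  (m0 == 0) || (m1 == 0) -> (m1 == 0) || (m2 == 0) -> (m2 == 0) || (m3 == 0) ->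
  (m3 == 0) || (m4 == 0) -> (m4 == 0) || (m0 == 0) ->
  (m0 + m1 + m2 + m3 + m4 + m5 <= 5)%N.
Proof.
by case: m0 => [|[|[|?]]] //; case: m1 => [|[|[|?]]] //; case: m2 => [|[|[|?]]] //;
   case: m3 => [|[|[|?]]] //; case: m4 => [|[|[|?]]] //; case: m5 => [|[|?]].
Qed.

Section Construction.
Variables (V : finType) (e : rel V) (n : nat).
Hypotheses (es : symmetric e) (ei : irreflexive e).
Hypothesis et : forall x y z, e x y -> e y z -> ~~ e x z.
Hypothesis V0 : (0 < #|V|)%N.

Definition part (x : 'I_n) : nat := (x %% 6)%N.
(** Running cyclically through [V] inside each part gives a nearly balanced blow-up of [e]. *)
Definition vertex (x : 'I_n) : V := enum_val (Ordinal (ltn_pmod (x %/ 6) V0)).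

Definition edge_rel (x y : 'I_n) : bool := (part x != part y) || e (vertex x) (vertex y).

Definition red_rel (x y : 'I_n) : bool :=
  if part x == part y then (part x == 5)%N && e (vertex x) (vertex y)
  else [&& (part x < 5)%N, (part y < 5)%N & pent (part x) (part y)].

Definition construction := graph_of edge_rel.

Lemma edge_rel_sym : symmetric edge_rel.
Proof. by move=> x y; rewrite /edge_rel eq_sym es. Qed.

Lemma red_rel_sym : symmetric red_rel.
Proof.
move=> x y; rewrite /red_rel eq_sym es; case: eqP => [->|_] //.
by rewrite andbCA /pent [X in _ && (_ && X)]orbC.
Qed.

Lemma red_edge_rel x y : red_rel x y -> edge_rel x y.
Proof. by rewrite /red_rel /edge_rel; case: eqP => //= _ /andP []. Qed.

Lemma part_lt6 x : (part x < 6)%N.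
Proof. exact: ltn_pmod. Qed.

Lemma red_rel_trifree x y z : red_rel x y -> red_rel y z -> ~~ red_rel x z.
Proof.
rewrite /red_rel.
case: (part x =P part y) => [->|xy].
  case: (part y =P part z) => [->|yz]; last by move=> /andP [/eqP E _] /and3P [y5]; rewrite E in y5.
  by move=> /andP [_ exy] /andP [-> eyz]; apply: et eyz.
case: (part y =P part z) => [<-|yz].
  by move=> /and3P [_ y5 _] /andP [/eqP E]; rewrite E in y5.
case: (part x =P part z) => [->|xz].
  by move=> /and3P [z5 _ _] _; apply/negP => /andP [/eqP E]; rewrite E in z5.
move=> /and3P [x5 y5 pxy] /and3P [_ z5 pyz].
by rewrite x5 z5; apply: pent_trifree pyz.
Qed.

Definition blue_rel (x y : 'I_n) : bool := edge_rel x y && ~~ red_rel x y.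

Lemma blue_clique_le5 (S : {set 'I_n}) : clique blue_rel S -> (#|S| <= 5)%N.
Proof.
move=> /cliqueP Sc.
pose s (a : nat) := #|[set x in S | part x == a]|.
have SE : #|S| = (s 0 + s 1 + s 2 + s 3 + s 4 + s 5)%N.
  have -> : #|S| = (\sum_(a < 6) s a)%N.
    rewrite -sum1_card (partition_big (fun x => Ordinal (part_lt6 x)) predT) //=.
    by apply: eq_bigr => a _; rewrite sum1_card; apply: eq_card => x; rewrite unfold_in inE.
  by rewrite !big_ord_recr big_ord0 /= add0n.
have inner x y : x \in S -> y \in S -> x != y -> part x = part y -> e (vertex x) (vertex y) /\ part x != 5%N.
  move=> xS yS xy pxy; have := Sc x y xS yS xy; rewrite /blue_rel /edge_rel /red_rel pxy eqxx /=.
  by case/andP => -> ; rewrite andbT.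
have s2 a : (s a <= 2)%N.
  rewrite leqNgt; apply/negP => /card_gt2P [x [y [z [[]]]]].
  rewrite !inE => /andP [xS /eqP px] /andP [yS /eqP py] /andP [zS /eqP pz] [xy yz zx].
  have [exy _] := inner x y xS yS xy (etrans px (esym py)).
  have [eyz _] := inner y z yS zS yz (etrans py (esym pz)).
  have [ezx _] := inner z x zS xS zx (etrans pz (esym px)).
  by have := et exy eyz; rewrite es ezx.
have s5 : (s 5 <= 1)%N.
  rewrite leqNgt; apply/negP => /card_gt1P [x [y []]].
  rewrite !inE => /andP [xS /eqP px] /andP [yS /eqP py] xy.
  have [_] := inner x y xS yS xy (etrans px (esym py)).
  by rewrite px.
have sp a b : (a < 5)%N -> (b < 5)%N -> a != b -> pent a b -> (s a == 0%N) || (s b == 0%N).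
  move=> a5 b5 ab pab; apply: contraT; rewrite negb_or -!lt0n => /andP [/card_gt0P [x] + /card_gt0P [y]].
  rewrite !inE => /andP [xS /eqP px] /andP [yS /eqP py].
  have xy : x != y by apply: contraNneq ab => E; rewrite -px -py E.
  have := Sc x y xS yS xy.
  by rewrite /blue_rel /red_rel px py (negPf ab) a5 b5 pab andbF.
by rewrite SE; apply: pent_weights => //; apply: sp.
Qed.

Lemma construction_free : KpKq_free construction 3 6.
Proof.
apply/existsP; exists (graph_of red_rel); apply/and3P; split.
- apply/subsetP => S; rewrite !inE => /andP [-> /cliqueP Sc]; apply/cliqueP => x y xS yS xy.
  by apply: red_edge_rel; apply: Sc.
- apply/negP => /has_cliqueP [S [S3 /cliqueP Sc]].
  have : (2 < #|S|)%N by rewrite S3.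
  move=> /card_gt2P [x [y [z [[xS yS zS] [xy yz zx]]]]].
  have r a b : a \in S -> b \in S -> a != b -> red_rel a b.
    by move=> aS bS ab; have := Sc a b aS bS ab; rewrite in_graph_of //; apply: red_rel_sym.
  have := red_rel_trifree (r x y xS yS xy) (r y z yS zS yz).
  by rewrite r // eq_sym.
- apply/negP => /has_cliqueP [S [S6 Sc]].
  have : (#|S| <= 5)%N; last by rewrite S6.
  apply: blue_clique_le5; apply/cliqueP => x y xS yS xy.
  have := cliqueP _ _ Sc x y xS yS xy; rewrite /= in_setD /construction.
  rewrite !in_graph_of //; [|exact: edge_rel_sym|exact: red_rel_sym].
  by rewrite /blue_rel andbC.
Qed.

Lemma vertex_fibre v : (#|[set x | vertex x == v]| <= 6 * (n %/ 6 %/ #|V| + 1))%N.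
Proof.
pose c := (n %/ 6 %/ #|V|)%N.
pose h (x : 'I_n) : 'I_6 * 'I_c.+1 := (inord (x %% 6)%N, inord (x %/ 6 %/ #|V|)%N).
have -> : (6 * (n %/ 6 %/ #|V| + 1) = #|{: 'I_6 * 'I_c.+1}|)%N by rewrite card_prod !card_ord addn1.
have inj : {in [set x | vertex x == v] &, injective h}.
  move=> x y; rewrite !inE => /eqP vx /eqP vy [].
  move=> /(congr1 (@nat_of_ord _)); rewrite !inordK ?ltn_pmod // => E6.
  have small z : (nat_of_ord (z : 'I_n) %/ 6 %/ #|V| < c.+1)%N.
    by rewrite ltnS leq_div2r // leq_div2r // ltnW.
  move=> /(congr1 (@nat_of_ord _)); rewrite !inordK // => EV.
  have := vx; rewrite -vy => /enum_val_inj /(congr1 (@nat_of_ord _)) /= EM.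
  apply/val_inj; rewrite /= (divn_eq x 6) (divn_eq y 6) E6.
  by rewrite (divn_eq (x %/ 6) #|V|) (divn_eq (y %/ 6) #|V|) EV EM.
by rewrite -(card_in_imset inj); apply: max_card.
Qed.

(** The image of an independent set under [vertex] is independent in [e], and the fibres of
    [vertex], taken over all six parts together, have about [n / #|V|] elements. *)
Lemma construction_alpha j :
  (forall I : {set V}, indep_set e I -> (j.+2 * #|I| <= 2 * #|V|)%N) ->
  (j.+2 * alpha construction <= 2 * n + 12 * #|V|)%N.
Proof.
move=> eI.
have H Y : independent construction Y -> (j.+2 * #|Y| <= 2 * n + 12 * #|V|)%N.
  move=> Yi.
  pose I := [set vertex x | x in Y].
  have Ii : indep_set e I.
    move=> _ _ /imsetP [x xY ->] /imsetP [y yY ->].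
    have [->|xy] := eqVneq x y; first by rewrite ei.
    apply: contraTN Yi => exy; rewrite negb_forall; apply/existsP; exists [set x; y].
    rewrite negb_imply negbK subUset !sub1set xY yY andbT /construction in_graph_of //.
      by rewrite /edge_rel exy orbT.
    exact: edge_rel_sym.
  have cY : (#|Y| <= #|I| * (6 * (n %/ 6 %/ #|V| + 1)))%N.
    rewrite -sum1_card (partition_big vertex (mem I)) /=; last by move=> x xY; apply: imset_f.
    rewrite -sum_nat_const; apply: leq_sum => v _; rewrite sum1_card.
    apply: leq_trans (vertex_fibre v); apply: subset_leq_card; apply/subsetP => x.
    by rewrite unfold_in inE => /andP [].
  apply: leq_trans (leq_mul (leqnn _) cY) _; rewrite mulnA.
  apply: leq_trans (leq_mul (eI I Ii) (leqnn _)) _.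
  have := leq_trunc_div (n %/ 6) #|V|; have := leq_trunc_div n 6.
  move: (n %/ 6)%N => a; move: (a %/ #|V|)%N => b h1 h2.
  have h3 : (b * #|V| * 6 <= n)%N by apply: leq_trans h1; rewrite leq_mul2r h2 orbT.
  have -> : (2 * #|V| * (6 * (b + 1)) = 2 * (b * #|V| * 6) + 12 * #|V|)%N by ring.
  by rewrite leq_add2r leq_mul2l h3 orbT.
rewrite /alpha; apply: (big_ind (fun k => j.+2 * k <= 2 * n + 12 * #|V|)%N) => //.
  by rewrite muln0.
by move=> x y hx hy; rewrite /maxn; case: ifP.
Qed.

(** Pairs in different parts already suffice; the term [n] absorbs the rounding of the part
    sizes. *)
Lemma construction_edges (R : realFieldType) :
  5%:R / 6%:R * n%:R ^+ 2 - n%:R <= 2 * (nedges construction)%:R :> R.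
Proof.
rewrite -(adj_nedges R (graph_of_graph edge_rel)).
apply: le_trans (_ : \sum_(p : 'I_n * 'I_n) (part p.1 != part p.2)%:R <= _); last first.
  apply: ler_sum => p _; rewrite ler_nat /adj.
  have [pp|//] := boolP (part p.1 != part p.2).
  have xy : p.1 != p.2 by apply: contraNneq pp => ->.
  by rewrite xy in_graph_of //; [rewrite /edge_rel pp|apply: edge_rel_sym].
rewrite -(pair_bigA _ (fun x y => (part x != part y)%:R)) /=.
have -> : 5%:R / 6%:R * n%:R ^+ 2 - n%:R = \sum_(x < n) (5%:R / 6%:R * n%:R - 1) :> R.
  by rewrite sumr_const card_ord -mulr_natr; ring.
apply: ler_sum => x _.
have -> : \sum_y (part x != part y)%:R = n%:R - #|[set y : 'I_n | (y %% 6)%N == part x]|%:R :> R.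
  rewrite -sum1_card natr_sum [X in _ - X]big_mkcond.
  have -> : n%:R = \sum_(y < n) 1 :> R by rewrite sumr_const card_ord.
  rewrite -sumrB; apply: eq_bigr => y _; rewrite inE [part x == _]eq_sym /part.
  by case: eqP => /= _; ring.
have := card_modn_class n 5 (part x); set c := #|_| => cn.
have : 6%:R * c%:R <= n%:R + 6%:R :> R.
  rewrite -natrM -natrD ler_nat; apply: leq_trans (leq_mul (leqnn 6) cn) _.
  by rewrite mulnDr leq_add2r mulnC leq_trunc_div.
by lra.
Qed.

End Construction.

Lemma RT_lower (R : realType) (delta eps : R) : 0 < delta -> 0 < eps ->
  exists N : nat, forall n : nat, (N <= n)%N ->
    (5%:R / 12%:R - eps) * n%:R ^+ 2 <= (RT n 3 6 (delta * n%:R))%:R.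
Proof.
move=> delta0 eps0.
(* Chosen so that [(j + 2) alpha <= 2 n + 12 #|V| < 4 n <= (j + 2) delta n] once [n > 12 #|V|]. *)
pose j := Num.bound (4%:R / delta).
have jd : 4%:R <= delta * j.+2%:R.
  rewrite mulrC -ler_pdivrMr //; apply: ltW; apply: lt_le_trans (archi_boundP _) _.
    by rewrite divr_ge0 // ltW.
  by rewrite ler_nat; do 2 apply: leqW.
have [V [e [es ei et V0 eI]]] := trianglefree_small_alpha j.
pose N1 := Num.bound (1 / (2 * eps)).
exists (N1 + 12 * #|V|).+1 => n nN.
have n0 : 0 < n%:R :> R by rewrite ltr0n; apply: leq_trans nN.
have n1 : 1 <= 2 * eps * n%:R.
  have e2 : 0 < 2 * eps by rewrite mulr_gt0 // ltr0n.
  rewrite mulrC -ler_pdivrMr //; apply: ltW; apply: lt_le_trans (archi_boundP _) _.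
    by rewrite divr_ge0 // ltW.
  by rewrite ler_nat -/N1; move: nN; clear; lia.
have n2 : (12 * #|V| < n)%N by move: nN; clear; lia.
pose G := construction e n V0.
have Ga : (alpha G)%:R < delta * n%:R.
  have := construction_alpha n es ei V0 eI; rewrite -/G => ha.
  have h : j.+2%:R * (alpha G)%:R < 4%:R * n%:R :> R.
    by rewrite -!natrM ltr_nat; apply: leq_ltn_trans ha _; move: n2; clear; lia.
  rewrite -(ltr_pM2l (x := j.+2%:R)) ?ltr0n //; apply: lt_le_trans h _.
  by rewrite mulrA ler_pM2r // mulrC.
have GP : [&& is_graph G, KpKq_free G 3 6 & (alpha G)%:R < delta * n%:R].
  by rewrite /G graph_of_graph construction_free.
apply: le_trans (_ : (nedges G)%:R <= _); last first.
  rewrite ler_nat /RT.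
  exact: (leq_bigmax_cond (F := fun G : {set {set 'I_n}} => nedges G) G GP).
have := construction_edges n es V0 R; rewrite -/G.
have : n%:R <= 2 * eps * n%:R ^+ 2.
  by rewrite expr2 mulrA -[X in X <= _]mul1r ler_pM2r.
rewrite mulrBl; lra.
Qed.

Theorem mainTheorem1 (R : realType) :
  (* 5/12 = (1/2)(1 - 1/r(3,3)) with r(3,3) = 6 *)
  ((1 / 2) * (1 - 1 / 6%:R) = 5%:R / 12%:R :> R) /\
  (* upper bound: RT(n,3,6,o(n)) <= 5/12 n^2 + o(n^2) *)
  (forall eps : R, 0 < eps -> exists delta : R, 0 < delta /\
     exists N : nat, forall n : nat, (N <= n)%N ->
       (RT n 3 6 (delta * n%:R))%:R <= (5%:R / 12%:R + eps) * n%:R ^+ 2) /\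
  (* lower bound: for every delta > 0, RT(n,3,6,delta n) >= 5/12 n^2 - o(n^2) *)
  (forall delta eps : R, 0 < delta -> 0 < eps ->
     exists N : nat, forall n : nat, (N <= n)%N ->
       (5%:R / 12%:R - eps) * n%:R ^+ 2 <= (RT n 3 6 (delta * n%:R))%:R) /\
  (* weak stability *)
  (forall S Z : forall n : nat, {set {set 'I_n}},
     (forall n, is_graph (S n)) -> (forall n, is_graph (Z n)) ->
     (forall n, KpKq_free (S n) 3 6) -> (forall n, KpKq_free (Z n) 3 6) ->
     littleo_n (fun n => (alpha (S n))%:R : R) ->
     littleo_n (fun n => (alpha (Z n))%:R : R) ->
     littleo_n2 (fun n => (nedges (S n))%:R - 5%:R / 12%:R * n%:R ^+ 2 : R) ->
     littleo_n2 (fun n => (nedges (Z n))%:R - 5%:R / 12%:R * n%:R ^+ 2 : R) ->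
     littleo_n2 (fun n => (Delta (S n) (Z n))%:R : R)).
Proof.
split; first by field.
split; first exact: RT_upper.
split; first exact: RT_lower.
exact: weak_stability.
Qed.
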